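(* Let $\mathbf X_n\sim\mathcal U(\mathcal M_n^{\mathbb T})$ and, for fixed $k$, let $\mathbf X_n^k$ denote the projection of $\mathbf X_n$ onto the first $k$ coordinates. Then $(\mathbf X_n^k)_n$ satisfies a large deviation principle (in $(\mathbb C^{p\times p})^k$) with speed $n$ and good rate function $$\mathcal I_\Gamma(\Gamma_1,\dots,\Gamma_k)=\begin{cases}-2p\log\dfrac{\det(T_k)}{\det(T_{k-1})},&\text{if }(\Gamma_1,\dots,\Gamma_k)\in\mathrm{Int}\,\mathcal M_k^{\mathbb T},\\ \infty,&\text{otherwise,}\end{cases}$$ where $T_m=(\Gamma_{i-j})_{i,j=0,\dots,m}$ is the block Toeplitz matrix built from $(\Gamma_1,\dots,\Gamma_k)$, with $\Gamma_0=I_p$ and $\Gamma_{-j}=\Gamma_j^*$.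
   Context: Fix an integer $p\ge1$. Lebesgue measure on $\mathbb C^{p\times p}$ is $dX=\prod_{1\le i,j\le p}d\,\mathrm{Re}(x_{ij})\,d\,\mathrm{Im}(x_{ij})$. Let $\mathcal P(\mathbb T)$ be the set of nonnegative-Hermitian-$p\times p$-matrix-valued measures $\mu$ on the unit circle $\mathbb T$ with $\mu(\mathbb T)=I_p$, $\Gamma_j(\mu)=\int_{-\pi}^{\pi}e^{ij\theta}d\mu(\theta)$, and $\mathcal M_n^{\mathbb T}=\{(\Gamma_1(\mu),\dots,\Gamma_n(\mu)):\mu\in\mathcal P(\mathbb T)\}\subset(\mathbb C^{p\times p})^n$, compact with nonempty interior. $\mathcal U(\mathcal M_n^{\mathbb T})$ is the uniform distribution on $\mathcal M_n^{\mathbb T}$ with respect to $d\Gamma_1\cdots d\Gamma_n$. A sequence of random variables with laws $Q_n$ on a Hausdorff space $U$ satisfies a large deviation principle with speed $n$ and rate function $I:U\to[0,\infty]$ if $I$ is lower semicontinuous and for every Borel $A$: $-\inf_{\mathrm{Int}A}I\le\liminf_n\frac1n\log Q_n(A)\le\limsup_n\frac1n\log Q_n(A)\le-\inf_{\overline A}I$; $I$ is good if its level sets $\{I\le x\}$ are compact. *)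

(* Defs.v *)
From HB Require Import structures.
From mathcomp Require Import all_boot all_order all_algebra.
From mathcomp Require Import complex.
From mathcomp Require Import all_classical all_reals all_analysis.

Set Implicit Arguments.
Unset Strict Implicit.
Unset Printing Implicit Defensive.

Import Order.TTheory GRing.Theory Num.Theory.
Import numFieldNormedType.Exports.

Local Open Scope classical_set_scope.
Local Open Scope ring_scope.
Local Open Scope sesquilinear_scope.

(* The topology of the modulus on R[i]; matrices over R[i] inherit from it. *)
HB.instance Definition _ (R : realType) := NormedModule.copy R[i] R[i]^o.

Definition borel (T : topologicalType) := g_sigma_algebraType (@open T).
HB.instance Definition _ (T : ptopologicalType) := Measurable.on (borel T).

(* At n = 0 the factor n^-1 is 0; this does not affect the limits. *)
Definition scaled_log (R : realType) (U : Type) (Q : nat -> set U -> \bar R)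
    (A : set U) : nat -> \bar R :=
  fun n => ((n%:R^-1)%:E * lne (Q n A))%E.

Definition LDP (R : realType) (U : topologicalType)
    (Q : nat -> set U -> \bar R) (I : U -> \bar R) : Prop :=
  [/\ forall u, (0 <= I u)%E,
      lower_semicontinuous I &
      forall A : set U, <<s @open U >> A ->
        [/\ (- ereal_inf (I @` A°) <= limn_einf (scaled_log Q A))%E,
            (limn_einf (scaled_log Q A) <= limn_esup (scaled_log Q A))%E &
            (limn_esup (scaled_log Q A) <= - ereal_inf (I @` closure A))%E]].

Definition good_rate (R : realType) (U : topologicalType) (I : U -> \bar R) :=
  forall x : R, compact [set u | (I u <= x%:E)%E].

Section ChargeIntegral.
Context (R : realType) (d : measure_display) (T : measurableType d).
Implicit Types (nu : {charge set T -> \bar R}) (f : T -> R).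

Definition hahn_pos nu : set T := sval (cid (Hahn_decomposition nu)).
Definition hahn_neg nu : set T := sval (cid (svalP (cid (Hahn_decomposition nu)))).
Definition hahn_pos_neg nu : hahn_decomposition nu (hahn_pos nu) (hahn_neg nu) :=
  svalP (cid (svalP (cid (Hahn_decomposition nu)))).

Definition charge_integral nu f : R :=
  (\int[jordan_pos (hahn_pos_neg nu)]_x f x)
  - (\int[jordan_neg (hahn_pos_neg nu)]_x f x).

(* Integral of g against the complex measure nu +i nu'. *)
Definition complex_integral nu nu' (g : T -> R[i]) : R[i] :=
  let u x := complex.Re (g x) in
  let v x := complex.Im (g x) in
  Complex (charge_integral nu u - charge_integral nu' v)
          (charge_integral nu v + charge_integral nu' u).

End ChargeIntegral.

Definition circle (R : realType) := set_type [set z : R[i] | `|z| = 1].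
HB.instance Definition _ (R : realType) := Topological.on (circle R).

Definition circle_point (R : realType) : circle R :=
  SigSub (mem_set (normr1 R[i] : [set z : R[i] | `|z| = 1] 1)).
HB.instance Definition _ (R : realType) :=
  isPointed.Build (circle R) (circle_point R).

Definition nonneg_hermitian (R : realType) (p : nat) (A : 'M[R[i]]_p) : Prop :=
  A^t* = A /\ forall v : 'cV[R[i]]_p, 0 <= (v^t* *m A *m v) 0 0.

(* A p x p matrix of complex measures, given by the real and imaginary parts of
   its entries, which are finite signed measures (charges). *)
Record matrix_charge (R : realType) (p : nat) := MatrixCharge {
  re_part : 'I_p -> 'I_p -> {charge set (borel (circle R)) -> \bar R} ;
  im_part : 'I_p -> 'I_p -> {charge set (borel (circle R)) -> \bar R} }.

Section MatrixMeasures.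
Context (R : realType) (p : nat).
Implicit Types mu : matrix_charge R p.

Definition matrix_charge_val mu (A : set (borel (circle R))) : 'M[R[i]]_p :=
  \matrix_(a, b) Complex (fine (re_part mu a b A)) (fine (im_part mu a b A)).

Definition is_prob_matrix_measure mu : Prop :=
  (forall A, measurable A -> nonneg_hermitian (matrix_charge_val mu A)) /\
  matrix_charge_val mu setT = 1%:M.

Definition matrix_integral mu (g : circle R -> R[i]) : 'M[R[i]]_p :=
  \matrix_(a, b) complex_integral (re_part mu a b) (im_part mu a b) g.

(* z ^+ j is e^{i j theta} at the point z = e^{i theta} of the circle. *)
Definition moment mu (j : nat) : 'M[R[i]]_p :=
  matrix_integral mu (fun z => val z ^+ j).

End MatrixMeasures.

(* (C^{p x p})^n with the product topology. The matrices Gamma_1, ..., Gamma_n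
   are indexed from 0: Gamma_j is G (j - 1). *)
Definition mseq (R : realType) (p n : nat) := {ptws 'I_n -> 'M[R[i]]_p}.
HB.instance Definition _ (R : realType) (p n : nat) :=
  Topological.on (mseq R p n).
HB.instance Definition _ (R : realType) (p n : nat) := Pointed.on (mseq R p n).

Section MomentSpace.
Context (R : realType) (p : nat).

Definition moment_space (n : nat) : set (mseq R p n) :=
  [set G | exists mu : matrix_charge R p, is_prob_matrix_measure mu /\
                                          forall l : 'I_n, G l = moment mu l.+1].
Arguments moment_space n : clear implicits.

Definition entry_or0 (n : nat) (G : mseq R p n) (l : nat) : 'M[R[i]]_p :=
  oapp G 0 (insub l : option 'I_n).

(* The padding by 0 only plays a role when n < k. *)
Definition first_coords (n k : nat) (G : mseq R p n) : mseq R p k :=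
  fun l : 'I_k => entry_or0 G l.
Arguments first_coords {n} k G.

(* Gamma_0 = 1, Gamma_(-j) = Gamma_j^*. *)
Definition Gamma (k : nat) (G : mseq R p k) (j : int) : 'M[R[i]]_p :=
  match j with
  | Posz 0 => 1%:M
  | Posz l.+1 => entry_or0 G l
  | Negz l => (entry_or0 G l)^t*
  end.

Definition block_toeplitz (k : nat) (G : mseq R p k) (m : nat) :=
  \mxblock_(i < m.+1, j < m.+1) Gamma G (i%:Z - j%:Z).

(* On the interior both determinants are positive real numbers. *)
Definition rate_Gamma (k : nat) (G : mseq R p k) : \bar R :=
  if `[< (moment_space k)° G >] then
    (- 2 * p%:R * ln (complex.Re (\det (block_toeplitz G k)
                                  / \det (block_toeplitz G k.-1))))%:E
  else +oo%E.

End MomentSpace.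
Arguments moment_space R p n : clear implicits.
Arguments first_coords {R p n} k G.
Arguments rate_Gamma R p k G : clear implicits.

(* N-fold product of the Lebesgue measure of R, as an iterated integral: each
   step is product_measure1 transported along (x, t) |-> x :: t. *)
Fixpoint lebesgue_tuple (R : realType) (N : nat) :
    set (N.-tuple R) -> \bar R :=
  match N with
  | 0 => fun A => \d_([tuple] : 0.-tuple R) A
  | N'.+1 => fun A => (\int[@lebesgue_measure R]_x
      lebesgue_tuple [set t : N'.-tuple R | A [tuple of x :: t]])%E
  end.

Section Lebesgue.
Context (R : realType) (p n : nat).

(* The last index selects the real part (false) or the imaginary part (true). *)
Definition coord : finType := ('I_n * 'I_p * 'I_p * bool)%type.

Definition mseq_of_coords (t : #|coord|.-tuple R) : mseq R p n :=
  fun l : 'I_n => \matrix_(a, b)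
    Complex (tnth t (enum_rank ((l, a, b, false) : coord)))
            (tnth t (enum_rank ((l, a, b, true) : coord))).

Definition lebesgue_mseq (A : set (mseq R p n)) : \bar R :=
  lebesgue_tuple (mseq_of_coords @^-1` A).

Definition uniform_moment_space (A : set (mseq R p n)) : \bar R :=
  (lebesgue_mseq (A `&` moment_space R p n) / lebesgue_mseq (moment_space R p n))%E.

End Lebesgue.

(* Main.v *)
Require Import Defs.
From HB Require Import structures.
From mathcomp Require Import all_boot all_order all_algebra.
From mathcomp Require Import fingroup perm complex spectral.
From mathcomp Require Import all_classical all_reals all_analysis measurable_realfun.
From mathcomp Require Import ring lra.
Set Implicit Arguments.
Unset Strict Implicit.
Unset Printing Implicit Defensive.

Import Order.TTheory GRing.Theory Num.Theory.
Import numFieldNormedType.Exports.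

Local Open Scope classical_set_scope.
Local Open Scope ring_scope.
Local Open Scope sesquilinear_scope.

(* Write d_m = det T_m / det T_(m-1). If T_m > 0, then T_(m+1) > 0 holds exactly when Gamma_(m+1)
   lies in a matrix ball D + A K B with K^* K < 1, where A and B are triangular with
   |det A|^2 = |det B|^2 = d_m, and then d_(m+1) = d_m det(1 - K^* K). The substitution
   Gamma_(m+1) = D + A K B has Jacobian d_m^(2p), so integrating out Gamma_n, ..., Gamma_(k+1) over
   {T_n > 0} leaves a constant times d_k^(2p(n-k)) on {T_k > 0}.

   The moment space lies between {T_n > 0} and {T_n >= 0}. A moment sequence is a limit of Riemann
   sums over small cells of the circle, whose Toeplitz matrices are nonnegative. Conversely, if
   T_n > 0, factor T_n = L L^*: the block shift of the rows of L is a partial isometry, it extends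
   to a unitary matrix, and the spectral decomposition of the latter gives a finitely supported
   matrix measure with the prescribed moments. Dilations show that the two sets have equal volume.

   Hence the k-th marginal has a density proportional to d_k^(2p(n-k)) with 0 < d_k <= 1, and
   Laplace's method gives the rate function - 2p log d_k. *)

(** Cholesky factors are used rather than square roots because, for triangular A and B, the map K
    |-> A K B is triangular in the row-major real coordinates. Its Jacobian then comes from
    one-dimensional affine substitutions made in the fixed order of the iterated integral. On the 2
    p^2 real coordinates it equals (det A det B)^(2p), and |det A| |det B| = d_m because deleting
    the first or the last index of T_m leaves the same Toeplitz matrix. The constants of the
    successive integrations stay unevaluated: they do not depend on the event and cancel against the
    normalisation. That the moment space has positive finite volume is read off from the total mass
    1 of the given law. The exponent 2p(n-k) differs from 2pn by a fixed amount, which is lost after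
    division by n, and the normalising integral has no exponential decay because d_k = 1 at Gamma =
    0. Integrals against matrix measures are defined through a chosen Hahn decomposition and are
    therefore reached only by Riemann sums. *)

Section PositiveDefinite.

(** * Definite matrices, Schur complements and Cholesky factors *)

Context {C : numClosedFieldType}.

Lemma adjM m n q (A : 'M[C]_(m, n)) (B : 'M[C]_(n, q)) :
  (A *m B)^t* = B^t* *m A^t*.
Proof. by rewrite trmx_mul map_mxM. Qed.

Lemma adjD m n (A B : 'M[C]_(m, n)) : (A + B)^t* = A^t* + B^t*.
Proof. by rewrite linearD /= map_mxD. Qed.

Lemma adjN m n (A : 'M[C]_(m, n)) : (- A)^t* = - A^t*.
Proof. by rewrite linearN /= map_mxN. Qed.

Lemma adjZ m n (a : C) (A : 'M[C]_(m, n)) : (a *: A)^t* = a^* *: A^t*.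
Proof. by rewrite linearZ /= map_mxZ. Qed.

Lemma adj0 m n : (0 : 'M[C]_(m, n))^t* = 0.
Proof. by rewrite trmx0 map_mx0. Qed.

Lemma adj_scalar n (a : C) : (a%:M : 'M[C]_n)^t* = (a^*)%:M.
Proof. by rewrite tr_scalar_mx map_scalar_mx. Qed.

Lemma adj1 n : (1%:M : 'M[C]_n)^t* = 1%:M.
Proof. by rewrite adj_scalar conjC1. Qed.

Lemma adj_inv n (A : 'M[C]_n) : (invmx A)^t* = invmx (A^t*).
Proof. by rewrite trmx_inv map_invmx. Qed.

Lemma adj_block n1 n2 m1 m2 (a : 'M[C]_(n1, m1)) b c (d : 'M[C]_(n2, m2)) :
  (block_mx a b c d)^t* = block_mx (a^t*) (c^t*) (b^t*) (d^t*).
Proof. by rewrite tr_block_mx map_block_mx. Qed.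

Lemma adj_col n1 n2 m (a : 'M[C]_(n1, m)) (b : 'M[C]_(n2, m)) :
  (col_mx a b)^t* = row_mx (a^t*) (b^t*).
Proof. by rewrite tr_col_mx map_row_mx. Qed.

Lemma adj_row n m1 m2 (a : 'M[C]_(n, m1)) (b : 'M[C]_(n, m2)) :
  (row_mx a b)^t* = col_mx (a^t*) (b^t*).
Proof. by rewrite tr_row_mx map_col_mx. Qed.

Lemma adj_unit n (A : 'M[C]_n) : (A^t* \in unitmx) = (A \in unitmx).
Proof. by rewrite map_unitmx unitmx_tr. Qed.

Lemma invmx_mul n (A B : 'M[C]_n) : A \in unitmx -> B \in unitmx ->
  invmx (A *m B) = invmx B *m invmx A.
Proof.
move=> uA uB; have uAB : A *m B \in unitmx by rewrite unitmx_mul uA.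
apply: (can_inj (mulKmx uAB)).
by rewrite mulmxV // mulmxA -(mulmxA A) mulmxV // mulmx1 mulmxV.
Qed.

Lemma det_adj n (A : 'M[C]_n) : \det (A^t*) = (\det A)^*.
Proof. by rewrite det_map_mx det_tr. Qed.

(** Row vectors agree with the row conventions of [row_free] and [kermx]. The statement uses column
    vectors; [nonneg_hermitianE] passes between the two. *)
Definition qf n (A : 'M[C]_n) (v : 'rV[C]_n) : C := (v *m A *m v^t*) 0 0.

Definition pd n (A : 'M[C]_n) := A^t* = A /\ forall v, v != 0 -> 0 < qf A v.
Definition psd n (A : 'M[C]_n) := A^t* = A /\ forall v, 0 <= qf A v.

Lemma qf1E n (v : 'rV[C]_n) : qf 1%:M v = \sum_i `|v 0 i| ^+ 2.
Proof.
rewrite /qf mulmx1 mxE; apply: eq_bigr => i _.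
by rewrite !mxE -normCK.
Qed.

Lemma qf1_gt0 n (v : 'rV[C]_n) : v != 0 -> 0 < qf 1%:M v.
Proof.
move=> v0; rewrite qf1E lt_def sumr_ge0 ?andbT; last first.
  by move=> i _; rewrite exprn_ge0.
apply: contra v0; rewrite psumr_eq0; last by move=> i _; rewrite exprn_ge0.
move=> /allP v0; apply/eqP/rowP => i; rewrite mxE.
by have := v0 i (mem_index_enum _); rewrite expf_eq0 /= normr_eq0 => /eqP.
Qed.

Lemma qfD n (A B : 'M[C]_n) v : qf (A + B) v = qf A v + qf B v.
Proof. by rewrite /qf mulmxDr mulmxDl mxE. Qed.

Lemma qfN n (A : 'M[C]_n) v : qf (- A) v = - qf A v.
Proof. by rewrite /qf mulmxN mulNmx mxE. Qed.

Lemma qfZ n (a : C) (A : 'M[C]_n) v : qf (a *: A) v = a * qf A v.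
Proof. by rewrite /qf -scalemxAr -scalemxAl mxE. Qed.

Lemma qf_congr m n (X : 'M[C]_(m, n)) A v :
  qf (X *m A *m X^t*) v = qf A (v *m X).
Proof. by rewrite /qf adjM !mulmxA. Qed.

Lemma qfE n (A : 'M[C]_n) v :
  qf A v = \sum_i \sum_j v 0 i * A i j * (v 0 j)^*.
Proof.
rewrite /qf mxE exchange_big /=; apply: eq_bigr => j _.
by rewrite !mxE big_distrl.
Qed.

Lemma pd1 n : pd (1%:M : 'M[C]_n).
Proof. by split; [exact: adj1|move=> v /qf1_gt0]. Qed.

Lemma pd_psd n (A : 'M[C]_n) : pd A -> psd A.
Proof.
move=> [hA pA]; split=> // v; have [->|/pA/ltW//] := eqVneq v 0.
by rewrite /qf !mul0mx mxE.
Qed.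

Lemma pdD_psd n (A B : 'M[C]_n) : pd A -> psd B -> pd (A + B).
Proof.
move=> [hA pA] [hB pB]; split; first by rewrite adjD hA hB.
by move=> v /pA ?; rewrite qfD ltr_wpDr.
Qed.

Lemma pdZ n (a : C) (A : 'M[C]_n) : 0 < a -> pd A -> pd (a *: A).
Proof.
move=> a0 [hA pA]; split; last by move=> v /pA ?; rewrite qfZ mulr_gt0.
by rewrite adjZ hA geC0_conj ?ltW.
Qed.

Lemma psdZ n (a : C) (A : 'M[C]_n) : 0 <= a -> psd A -> psd (a *: A).
Proof.
move=> a0 [hA pA]; split; last by move=> v; rewrite qfZ mulr_ge0.
by rewrite adjZ hA geC0_conj.
Qed.

Lemma psd_congr m n (X : 'M[C]_(m, n)) A : psd A -> psd (X *m A *m X^t*).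
Proof.
move=> [hA pA]; split; last by move=> v; rewrite qf_congr.
by rewrite !adjM trmxCK hA mulmxA.
Qed.

Lemma psd_gram m n (X : 'M[C]_(m, n)) : psd (X *m X^t*).
Proof. by rewrite -[X in X *m _]mulmx1; apply/psd_congr/pd_psd/pd1. Qed.

Lemma pd_congr m n (X : 'M[C]_(m, n)) A :
  row_free X -> pd A -> pd (X *m A *m X^t*).
Proof.
move=> fX [hA pA]; split; first by rewrite !adjM trmxCK hA mulmxA.
move=> v v0; rewrite qf_congr; apply: pA.
by apply: contra v0; rewrite mulmx_free_eq0.
Qed.

Lemma pd_congr_unit n (X A : 'M[C]_n) : X \in unitmx ->
  pd (X *m A *m X^t*) <-> pd A.
Proof.
move=> uX; split=> [|pA]; last by apply: pd_congr => //; rewrite row_free_unit.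
move=> /(pd_congr (X := invmx X)); rewrite row_free_unit unitmx_inv => /(_ uX).
by rewrite !mulmxA mulVmx // mul1mx -mulmxA -adjM mulVmx // adj1 mulmx1.
Qed.

Lemma pd_unit n (A : 'M[C]_n) : pd A -> A \in unitmx.
Proof.
move=> [hA pA]; rewrite -row_free_unit -kermx_eq0.
apply/rowV0P => v /sub_kermxP vA.
by apply/eqP/negPn/negP => /pA; rewrite /qf vA mul0mx mxE ltxx.
Qed.

Lemma pd_adj n (A : 'M[C]_n) : pd A -> A^t* = A. Proof. by case. Qed.

Lemma qf_row_mx n m (A : 'M[C]_n) (D : 'M[C]_m) u v :
  qf (block_mx A 0 0 D) (row_mx u v) = qf A u + qf D v.
Proof.
rewrite /qf mul_row_block !mulmx0 addr0 add0r adj_row mul_row_col.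
by rewrite mxE.
Qed.

Lemma pd_block_diag n m (A : 'M[C]_n) (D : 'M[C]_m) :
  pd (block_mx A 0 0 D) <-> pd A /\ pd D.
Proof.
split=> [[]|[[hA pA] [hD pD]]].
  rewrite adj_block !adj0 => /eq_block_mx [hA _ _ hD] p; split; split=> // v v0.
    have := p (row_mx v 0); rewrite qf_row_mx row_mx_eq0 eqxx andbT => /(_ v0).
    by rewrite [qf D 0]/qf !mul0mx mxE addr0.
  have := p (row_mx 0 v); rewrite qf_row_mx row_mx_eq0 eqxx /= => /(_ v0).
  by rewrite [qf A 0]/qf !mul0mx mxE add0r.
split=> [|v]; first by rewrite adj_block !adj0 hA hD.
rewrite -[v]hsubmxK row_mx_eq0 qf_row_mx negb_and => /orP[] v0.
  by rewrite ltr_wpDr ?pA //; apply: (pd_psd (conj hD pD)).2.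
by rewrite ltr_wpDl ?pD //; apply: (pd_psd (conj hA pA)).2.
Qed.

(** Block Gaussian elimination. The factor [X] is unitriangular, so this one identity yields both
    the determinant formula and the definiteness criterion below. *)
Lemma schur_congr n m (A : 'M[C]_n) (B : 'M[C]_(n, m)) (D : 'M[C]_m) :
  A^t* = A -> A \in unitmx ->
  let X := block_mx 1%:M 0 (- (B^t* *m invmx A)) 1%:M in
  X *m block_mx A B (B^t*) D *m X^t* =
  block_mx A 0 0 (D - B^t* *m invmx A *m B).
Proof.
move=> hA uA X; rewrite /X adj_block !adj1 adj0 adjN adjM trmxCK adj_inv hA.
rewrite !mulmx_block !mul1mx !mul0mx !mulmx1 !mulmx0 !addr0 !mulNmx.
rewrite mulmxKV // addNr !mul0mx add0r mulmxN mulKVmx // addNr.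
by rewrite [- _ + D]addrC.
Qed.

Lemma schur_det n m (A : 'M[C]_n) (B : 'M[C]_(n, m)) (D : 'M[C]_m) :
  A^t* = A -> A \in unitmx ->
  \det (block_mx A B (B^t*) D) = \det A * \det (D - B^t* *m invmx A *m B).
Proof.
move=> hA uA; have := congr1 (@determinant _ _) (schur_congr B D hA uA).
by rewrite /= !det_mulmx det_adj !det_lblock !det1 !mulr1 conjC1 mul1r mulr1.
Qed.

Lemma pd_schur n m (A : 'M[C]_n) (B : 'M[C]_(n, m)) (D : 'M[C]_m) :
  pd (block_mx A B (B^t*) D) <-> pd A /\ pd (D - B^t* *m invmx A *m B).
Proof.
set S := block_mx _ _ _ _.
have key : pd A -> pd S <-> pd A /\ pd (D - B^t* *m invmx A *m B).
  move=> pA; have := schur_congr B D (pd_adj pA) (pd_unit pA).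
  set X := block_mx 1%:M _ _ _ => /= XE.
  have uX : X \in unitmx by rewrite unitmxE det_lblock !det1 mulr1 unitr1.
  have [h1 h2] := pd_congr_unit S uX; have [h3 h4] := pd_block_diag A (D - B^t* *m invmx A *m B).
  by rewrite XE in h1 h2; split=> [/h2/h3|/h4/h1].
split=> [pS|[pA]]; last by move=> pD; apply/key.
(* The corner [A] is the compression of [S] to the first n coordinates, hence definite. *)
apply/key => //; have := pd_congr (X := row_mx 1%:M 0 : 'M[C]_(n, n + m)) _ pS.
rewrite mul_row_block !mul1mx !mul0mx !addr0 adj_row adj1 adj0 mul_row_col.
rewrite mulmx1 mulmx0 addr0; apply.
apply/row_freeP; exists (col_mx 1%:M 0).
by rewrite mul_row_col mulmx1 mulmx0 addr0.
Qed.

Lemma qf_scalar11 (a : C) (v : 'rV[C]_1) : qf a%:M v = a * `|v 0 0| ^+ 2.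
Proof. by rewrite -[a%:M]scalemx1 qfZ qf1E big_ord1. Qed.

(** Induction on the size: the 1 by 1 corner is a positive number, its Schur complement is definite
    and one size smaller, and the first column of the factor is that of the matrix divided by the
    square root of the corner. *)
Lemma cholesky n (A : 'M[C]_n) : pd A ->
  exists L : 'M[C]_n, [/\ is_trig_mx L, forall i, 0 < L i i & A = L *m L^t*].
Proof.
elim: n A => [|n IHn] A pA.
  exists 0; split; [exact: (mx0_is_trig)|by case|].
  by apply/matrixP => -[].
have [a [b [c [d AE]]]] : exists (a : 'M[C]_1) (b : 'M[C]_(1, n)) (c : 'M[C]_(n, 1)) (d : 'M[C]_n),
    A = block_mx a b c d.
  by do 4 eexists; rewrite -[LHS](@submxK _ 1 n 1 n).
change (@pd (1 + n) A) in pA; have dE : c = b^t*.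
  by have := pd_adj pA; rewrite AE adj_block => /eq_block_mx[_ _ -> _].
rewrite {}AE {}dE in pA *; have [pa ps] := (pd_schur _ _ _).1 pA.
have [L [tL dL sL]] := IHn _ ps.
have aE : a = (a 0 0)%:M by rewrite [LHS]mx11_scalar.
have a0 : 0 < a 0 0.
  have := pa.2 1%:M; rewrite aE qf_scalar11 !mxE eqxx mulr1n normr1 expr1n mulr1.
  by apply; rewrite -scalemx1 scale1r oner_eq0.
pose s := sqrtC (a 0 0); have s0 : 0 < s by rewrite sqrtC_gt0.
have ss : s * s = a 0 0 by rewrite -expr2 sqrtCK.
have sc : s^* = s by rewrite geC0_conj // ltW.
suff: exists M : 'M[C]_(1 + n), [/\ is_trig_mx M, forall i, 0 < M i i & block_mx a b (b^t*) d = M *m M^t*] by [].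
exists (block_mx s%:M 0 (s^-1 *: b^t*) L); split.
- rewrite is_trig_block_mx // eqxx tL andbT /=.
  by apply/is_trig_mxP => i j; rewrite !ord1.
- move=> i; case: (split_ordP i) => j ->; last by rewrite block_mxEdr.
  by rewrite block_mxEul !mxE !ord1 eqxx mulr1n.
rewrite adj_block adj0 adj_scalar sc mulmx_block !mul0mx !mulmx0 !addr0.
rewrite adjZ trmxCK fmorphV /= sc.
rewrite -scalar_mxM ss -aE mul_scalar_mx scalerA divff ?gt_eqF // scale1r.
rewrite -!scalemxAl mul_mx_scalar scalerA mulVf ?gt_eqF // scale1r -scalemxAr scalerA.
rewrite -sL -invfM ss; congr block_mx.
rewrite {2}aE invmx_scalar mul_mx_scalar -scalemxAl.
by rewrite addrC subrK.
Qed.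

End PositiveDefinite.

(** * Spectral bounds and unitary extension of isometries *)

Section Spectral.
Context {C : numClosedFieldType}.

(** The eigenvalues are displayed as values of the form on the rows of [S], so bounds on the form
    pass directly to them. *)
Lemma hermitian_diag n (A : 'M[C]_n) : A^t* = A ->
  exists S : 'M[C]_n, exists D : 'rV[C]_n,
    [/\ S \is unitarymx, A = S^t* *m diag_mx D *m S & forall i, D 0 i = qf A (row i S)].
Proof.
move=> hA; have nA : A \is normalmx by apply/normalmxP; rewrite hA.
have uS := spectral_unitarymx A; exists (spectralmx A), (spectral_diag A).
have AE := orthomx_spectralP nA; rewrite (invmx_unitary uS) in AE.
split=> // i; rewrite {2}AE.
have -> : qf (spectralmx A ^t* *m diag_mx (spectral_diag A) *m spectralmx A) (row i (spectralmx A))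
  = qf (diag_mx (spectral_diag A)) (delta_mx 0 i).
  rewrite -[X in _ *m _ *m X]trmxCK qf_congr rowE -mulmxA.
  by rewrite (unitarymxP uS) mulmx1.
rewrite /qf -rowE row_diag_mx -scalemxAl mxE -rowE !mxE !eqxx /= conjC1.
by rewrite mulr1.
Qed.

Lemma qf1_row_unitary m n (S : 'M[C]_(m, n)) i :
  S \is unitarymx -> qf 1%:M (row i S) = 1.
Proof.
move=> /unitarymxP/matrixP/(_ i i); rewrite [RHS]mxE eqxx /= mulr1n => E.
by rewrite /qf mulmx1 -[RHS]E !mxE; apply: eq_bigr => j _; rewrite !mxE.
Qed.

Lemma pd_det_gt0 n (A : 'M[C]_n) : pd A -> 0 < \det A.
Proof.
move=> pA; have [L [tL dL AE]] := cholesky pA.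
rewrite AE det_mulmx det_adj det_trig //.
have ? : 0 < \prod_(i < n) L i i by apply: prodr_gt0 => i _; exact: dL.
by rewrite geC0_conj ?ltW // mulr_gt0.
Qed.

Lemma det_diag_congr n (S : 'M[C]_n) D : S \is unitarymx ->
  \det (S^t* *m diag_mx D *m S) = \prod_i D 0 i.
Proof.
move=> uS; rewrite !det_mulmx mulrAC -det_mulmx.
have /unitarymxP := uS; rewrite -trmxC_unitary in uS.
by move: uS => /unitarymxP; rewrite trmxCK => -> _; rewrite det1 mul1r det_diag.
Qed.

Lemma pd_diag n (D : 'rV[C]_n) : (forall i, 0 < D 0 i) -> pd (diag_mx D).
Proof.
move=> D0; split.
  rewrite tr_diag_mx map_diag_mx; congr diag_mx; apply/rowP => i.
  by rewrite !mxE /= geC0_conj // ltW.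
move=> v v0; rewrite qfE.
have -> : \sum_i \sum_j v 0 i * diag_mx D i j * (v 0 j)^* = \sum_i D 0 i * `|v 0 i| ^+ 2.
  apply: eq_bigr => i _; rewrite (bigD1 i) //= big1 ?addr0.
    by rewrite mxE eqxx mulr1n normCK [v 0 i * _]mulrC mulrA.
  by move=> j; rewrite mxE eq_sym => /negPf ->; rewrite mulr0n mulr0 mul0r.
have [i vi] : exists i, v 0 i != 0 by apply/rV0Pn.
rewrite (bigD1 i) //= ltr_wpDr //.
  by apply: sumr_ge0 => j _; rewrite mulr_ge0 ?exprn_ge0 // ltW.
by rewrite mulr_gt0 // exprn_gt0 // normr_gt0.
Qed.

(** The eigenvalues are nonnegative, and a nonzero product excludes 0 among them. In [closed_level]
    this turns a lower bound on the determinant into definiteness. *)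
Lemma psd_det_pd n (A : 'M[C]_n) : psd A -> \det A != 0 -> pd A.
Proof.
move=> [hA pA]; have [S [D [uS AE DE]]] := hermitian_diag hA.
rewrite AE det_diag_congr // => /prodf_neq0 D0.
rewrite -[X in _ *m _ *m X]trmxCK; apply: pd_congr.
  by rewrite row_free_unit adj_unit unitarymx_unit.
by apply: pd_diag => i; rewrite lt_def D0 //= DE.
Qed.

Lemma pd_det_le1 n (A : 'M[C]_n) : pd A -> psd (1%:M - A) -> \det A <= 1.
Proof.
move=> [hA pA] [_ p1]; have [S [D [uS AE DE]]] := hermitian_diag hA.
rewrite {1}AE det_diag_congr // prodr_ile1 // => i _; rewrite DE.
rewrite (pd_psd (conj hA pA)).2 /=.
have := p1 (row i S); rewrite qfD qfN subr_ge0.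
by rewrite qf1_row_unitary.
Qed.

Lemma pd_bound n (A : 'M[C]_n) : pd A ->
  exists2 e : C, 0 < e & psd (A - e%:M).
Proof.
move=> pA; have hA := pd_adj pA; have [S [D [uS AE DE]]] := hermitian_diag hA.
have D0 i : 0 < D 0 i.
  rewrite DE; apply: pA.2; apply/eqP => S0; have := qf1_row_unitary i uS.
  by rewrite S0 /qf !mul0mx mxE => /eqP; rewrite eq_sym oner_eq0.
have s0 : 0 < \sum_i (D 0 i)^-1 + 1.
  by rewrite ltr_wpDl // sumr_ge0 // => i _; rewrite invr_ge0 ltW.
(* 1 plus the sum of the inverse eigenvalues exceeds every inverse eigenvalue, so this number lies
   strictly below the whole spectrum. *)
exists (\sum_i (D 0 i)^-1 + 1)^-1; first by rewrite invr_gt0.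
set e := _^-1; have e0 : 0 < e by rewrite invr_gt0.
split; first by rewrite adjD adjN adj_scalar geC0_conj ?ltW // hA.
move=> v; rewrite qfD qfN.
have -> : qf e%:M v = qf (e%:M) (v *m S^t*).
  rewrite -(qf_congr (S^t*) e%:M v) trmxCK mul_mx_scalar -scalemxAl.
  move: uS; rewrite -trmxC_unitary => /unitarymxP; rewrite trmxCK => ->.
  by rewrite scalemx1.
rewrite {1}AE -[X in _ *m _ *m X]trmxCK qf_congr -qfN -qfD.
rewrite -scalemx1 -scaleNr scalemx1 -diag_const_mx -raddfD.
set D' := D + _; have : pd (diag_mx D').
  apply: pd_diag => i; rewrite !mxE subr_gt0 invf_plt ?posrE //.
  by rewrite (bigD1 i) //= -addrA ltrDl ltr_wpDl // sumr_ge0 // => j _;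
     rewrite invr_ge0 ltW.
by move=> /pd_psd [].
Qed.

Lemma qf_real n (A : 'M[C]_n) v : A^t* = A -> qf A v \is Num.real.
Proof.
move=> hA; apply/CrealP; rewrite /qf.
have -> : ((v *m A *m v^t*) 0 0)^* = ((v *m A *m v^t*)^t*) 0 0 by rewrite !mxE.
by rewrite !adjM trmxCK hA mulmxA.
Qed.

Lemma qf_norm_le n (A : 'M[C]_n) v (e : C) : 0 <= e ->
  (forall i j, `|A i j| <= e) -> `|qf A v| <= e * n%:R * qf 1%:M v.
Proof.
move=> e0 Ae; rewrite qfE; apply: (le_trans (ler_norm_sum _ _ _)).
(* Arithmetic-geometric mean on |v_i| |v_j|; the double sum then costs a factor n. *)
apply: (@le_trans _ _ (\sum_i \sum_j e * ((`|v 0 i| ^+ 2 + `|v 0 j| ^+ 2) / 2%:R))).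
  apply: ler_sum => i _; apply: (le_trans (ler_norm_sum _ _ _)).
  apply: ler_sum => j _; rewrite !normrM norm_conjC mulrAC mulrC.
  apply: ler_pM; rewrite ?mulr_ge0 //.
  exact: (real_leif_mean_square (normr_real _) (normr_real _)).1.
rewrite qf1E le_eqVlt; apply/orP; left; apply/eqP.
under eq_bigr do rewrite -mulr_sumr -mulr_suml big_split /= sumr_const card_ord.
rewrite -mulr_sumr -mulr_suml big_split /= sumr_const card_ord sumrMnl.
by rewrite -mulr2n -[X in X / _]mulr_natr mulfK ?pnatr_eq0 // -mulrA mulr_natl.
Qed.

Lemma pd_perturb n (A : 'M[C]_n) : pd A ->
  exists2 e : C, 0 < e & forall B : 'M[C]_n, B^t* = B ->
    (forall i j, `|B i j - A i j| <= e) -> pd B.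
Proof.
move=> pA; have [d d0 pAd] := pd_bound pA.
have n1 : 0 < n%:R + 1 :> C by rewrite ltr_wpDl.
(* On unit vectors the form of [A] is at least [d], and entries of size d/(n+1) move it by at most d
   n/(n+1) < d. *)
exists (d / (n%:R + 1)); first by rewrite divr_gt0.
move=> B hB BA; split=> // v v0.
have -> : B = (A - d%:M) + d%:M + (B - A) by rewrite subrK addrC subrK.
rewrite (qfD _ (B - A)) (qfD _ d%:M) -addrA ltr_wpDl //; first exact: pAd.2.
have rBA : qf (B - A) v \is Num.real by apply: qf_real; rewrite adjD adjN hB (pd_adj pA).
have bBA : `|qf (B - A) v| <= d / (n%:R + 1) * n%:R * qf 1%:M v.
  apply: qf_norm_le => [|i j]; last by rewrite !mxE.
  by rewrite divr_ge0 // ltW.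
rewrite -scalemx1 qfZ -[qf (B - A) v]opprK subr_gt0.
apply: (le_lt_trans (real_ler_norm _)); rewrite ?rpredN // normrN.
apply: (le_lt_trans bBA); rewrite ltr_pM2r ?qf1_gt0 //.
by rewrite mulrAC ltr_pdivrMr // ltr_pM2l // ltrDl.
Qed.

Local Notation "B ^!" :=
  (orthomx (@Num.conj_op C) (mx_of_hermitian (hermitian1mx _)) B) : matrix_set_scope.

Lemma orthonormal_complement r s (A : 'M[C]_(r, r + s)) : row_free A ->
  exists2 W : 'M[C]_(s, r + s), W *m W^t* = 1%:M & A *m W^t* = 0.
Proof.
move=> fA; have rk : \rank (A^!)%MS = s.
  by rewrite rank_ortho (eqP fA) addKn.
(* The basis of the complement has a number of rows that is only provably equal to s, so this number
   is generalised and substituted afterwards. *)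
have [m [W [mE WW AW]]] : exists m, exists W : 'M[C]_(m, r + s),
    [/\ m = s, W *m W^t* = 1%:M & A *m W^t* = 0].
  exists (\rank (A^!)%MS), (schmidt (row_base (A^!)%MS)); split=> //.
    by apply/unitarymxP; rewrite schmidt_unitarymx // rank_leq_col.
  apply/orthomx1P; rewrite orthomx_sym.
  by rewrite eqmx_schmidt_free ?row_base_free ?eq_row_base.
by subst m; exists W.
Qed.

Lemma row_free_gram m n (A : 'M[C]_(m, n)) : pd (A *m A^t*) -> row_free A.
Proof.
move=> pA; rewrite -kermx_eq0; apply/rowV0P => v /sub_kermxP vA.
apply/eqP; rewrite -(mulmx_free_eq0 v (B := A *m A^t*)) ?row_free_unit ?pd_unit //.
by rewrite mulmxA vA mul0mx.
Qed.

(** Equal Gram matrices make the rows of [A] and [B] isometric. Orthonormal complements complete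
    them to invertible square matrices [X] and [Y], again with equal Gram matrices, and then
    [invmx X *m Y] is unitary. *)
Lemma unitary_extension r s (A B : 'M[C]_(r, r + s)) : row_free A ->
  A *m A^t* = B *m B^t* ->
  exists2 U : 'M[C]_(r + s), U \is unitarymx & A *m U = B.
Proof.
move=> fA AB; have pAA : pd (A *m A^t*).
  by rewrite -[X in X *m _]mulmx1; apply: pd_congr => //; exact: pd1.
have fB : row_free B by apply: row_free_gram; rewrite -AB.
have [W WW AW] := orthonormal_complement fA.
have [V VV BV] := orthonormal_complement fB.
pose X := col_mx A W; pose Y := col_mx B V.
have gram M N : M *m N^t* = 0 :> 'M[C]_(r, s) -> N *m N^t* = 1%:M :> 'M[C]_s ->
   col_mx M N *m (col_mx M N)^t* = block_mx (M *m M^t*) 0 0 1%:M.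
  move=> MN NN; rewrite adj_col mul_col_row MN NN; congr block_mx.
  by rewrite -[LHS]trmxCK adjM trmxCK MN adj0.
have XY : X *m X^t* = Y *m Y^t* by rewrite !gram // AB.
have uX : X \in unitmx.
  have : pd (X *m X^t*) by rewrite gram // pd_block_diag; split=> //; exact: pd1.
  by move=> /pd_unit; rewrite unitmx_mul => /andP[].
exists (invmx X *m Y).
  apply/unitarymxP; rewrite adjM mulmxA -[_ *m Y *m _]mulmxA -XY mulmxA.
  by rewrite mulVmx // mul1mx -adjM mulVmx // adj1.
have : X *m (invmx X *m Y) = Y by rewrite mulKVmx.
by rewrite mul_col_mx => /eq_col_mx[].
Qed.

End Spectral.

(** * Matrices of a kernel along a listing of its indices *)

Section Kernel.
Context {C : numClosedFieldType} {J : eqType}.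
Implicit Types (f : J -> J -> C).

Definition kmx f N (e : 'I_N -> J) : 'M[C]_N := \matrix_(i, j) f (e i) (e j).

(** Two listings of one index set differ by a permutation, which acts by a congruence that preserves
    the determinant. Each Toeplitz matrix can thus be read in the order that suits the Schur
    complement at hand. *)
Lemma kmx_reindex f N N' (e : 'I_N -> J) (e' : 'I_N' -> J) :
  injective e -> injective e' ->
  (forall i, exists j, e i = e' j) -> (forall j, exists i, e' j = e i) ->
  [/\ \det (kmx f e) = \det (kmx f e'), pd (kmx f e) <-> pd (kmx f e')
    & psd (kmx f e) -> psd (kmx f e')].
Proof.
move=> ie ie' ee' e'e.
have [s sE] : exists s : 'I_N -> 'I_N', forall i, e i = e' (s i).
  have ex i : exists j, e i == e' j by have [j ->] := ee' i; exists j.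
  by exists (fun i => xchoose (ex i)) => i; apply/eqP; exact: (xchooseP (ex i)).
have is_ : injective s by move=> i j /(congr1 e'); rewrite -!sE => /ie.
have NN' : N = N'.
  apply/eqP; rewrite eqn_leq -[X in (X <= _)%N]card_ord -[X in (_ <= X)%N]card_ord.
  rewrite (leq_card _ is_) /= -[X in (X <= _)%N]card_ord -[X in (_ <= X)%N]card_ord.
  have ex j : exists i, e' j == e i by have [i ->] := e'e j; exists i.
  have et j : e' j = e (xchoose (ex j)) by apply/eqP; exact: (xchooseP (ex j)).
  apply: (leq_card (fun j => xchoose (ex j))) => i j E.
  by apply: ie'; rewrite !et E.
subst N'; pose t := perm is_.
have kE : kmx f e = perm_mx t *m kmx f e' *m (perm_mx t)^t*.
  rewrite tr_perm_mx map_perm_mx -row_permE -[RHS]mulmx1.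
  apply/matrixP => i j; rewrite mulmx1 -[t^-1%g]invgK invgK -col_permE.
  by rewrite !mxE !permE -!sE.
have ut : perm_mx t \in @unitmx C N by exact: unitmx_perm.
split; first 1 last.
- by rewrite kE; apply: pd_congr_unit.
- move=> /(psd_congr (invmx (perm_mx t))).
  by rewrite kE !mulmxA mulVmx // mul1mx -mulmxA -adjM mulVmx // adj1 mulmx1.
- rewrite kE !det_mulmx mulrAC -det_mulmx tr_perm_mx map_perm_mx -perm_mxM mulgV.
  by rewrite perm_mx1 det1 mul1r.
Qed.

End Kernel.

(** * Block Toeplitz matrices and the matrix ball of the next coefficient *)

Section Toeplitz.
Context {C : numClosedFieldType} {p : nat}.
Local Notation J := (nat * 'I_p)%type.
Implicit Types (g : nat -> 'M[C]_p) (m : nat).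

(** [g l] stands for Gamma_(l+1), hence the predecessors. *)
Definition tcoef g (i j : nat) : 'M[C]_p :=
  if i == j then 1%:M else if (j < i)%N then g (i - j).-1 else (g (j - i).-1)^t*.

Definition tker g (x y : J) : C := tcoef g x.1 y.1 x.2 y.2.

Lemma tcoef_adj g i j : (tcoef g i j)^t* = tcoef g j i.
Proof.
by rewrite /tcoef eq_sym; case: ltngtP => // _; rewrite ?trmxCK ?adj1.
Qed.

Lemma tker_adj g x y : (tker g x y)^* = tker g y x.
Proof. by rewrite /tker -(tcoef_adj g x.1) !mxE. Qed.

Lemma tcoef_shift g i j : tcoef g i.+1 j.+1 = tcoef g i j.
Proof. by rewrite /tcoef eqSS ltnS !subSS. Qed.

(* m * p, in the form that makes toep g m.+1 a block matrix. *)
Fixpoint tsz m : nat := if m is m'.+1 then (p + tsz m')%N else 0%N.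

Definition shift (x : J) : J := (x.1.+1, x.2).

Definition fcat n1 n2 (f1 : 'I_n1 -> J) (f2 : 'I_n2 -> J) (i : 'I_(n1 + n2)) : J :=
  match fintype.split i with inl j => f1 j | inr j => f2 j end.

Fixpoint tidx m : 'I_(tsz m) -> J :=
  match m return 'I_(tsz m) -> J with
  | 0 => fun i => False_rect _ (Bool.diff_false_true (ltn_ord i))
  | m'.+1 => fcat (pair 0%N) (shift \o @tidx m')
  end.
Arguments tidx : clear implicits.

(* The first m block rows: toep g m.+1 is the T_m of the statement, and g l is Gamma_(l+1). *)
Definition toep g m : 'M[C]_(tsz m) := kmx (tker g) (tidx m).

Lemma fcat_lshift n1 n2 (f1 : 'I_n1 -> J) (f2 : 'I_n2 -> J) i :
  fcat f1 f2 (lshift n2 i) = f1 i.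
Proof. by rewrite /fcat -[lshift n2 i]/(unsplit (inl i)) unsplitK. Qed.

Lemma fcat_rshift n1 n2 (f1 : 'I_n1 -> J) (f2 : 'I_n2 -> J) i :
  fcat f1 f2 (rshift n1 i) = f2 i.
Proof. by rewrite /fcat -[rshift n1 i]/(unsplit (inr i)) unsplitK. Qed.

Lemma kmx_fcat (f : J -> J -> C) n1 n2 (f1 : 'I_n1 -> J) (f2 : 'I_n2 -> J) :
  kmx f (fcat f1 f2) = block_mx (kmx f f1) (\matrix_(i, j) f (f1 i) (f2 j))
    (\matrix_(i, j) f (f2 i) (f1 j)) (kmx f f2).
Proof.
apply/matrixP => i j; rewrite mxE.
case: (split_ordP i) => i' ->; case: (split_ordP j) => j' ->;
  by rewrite ?block_mxEul ?block_mxEur ?block_mxEdl ?block_mxEdr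
     !(fcat_lshift, fcat_rshift) mxE.
Qed.

Definition enumerates N (e : 'I_N -> J) (S : pred nat) :=
  injective e /\ forall x, S x.1 <-> exists i, x = e i.

Lemma enumerates_ext N (e : 'I_N -> J) (S S' : pred nat) :
  enumerates e S -> S =1 S' -> enumerates e S'.
Proof. by move=> [ie eS] SS'; split=> // x; rewrite -SS'. Qed.

Lemma enumerates_fcat n1 n2 (f1 : 'I_n1 -> J) (f2 : 'I_n2 -> J) S1 S2 :
  enumerates f1 S1 -> enumerates f2 S2 -> (forall i, S1 i -> S2 i -> False) ->
  enumerates (fcat f1 f2) (predU S1 S2).
Proof.
move=> [i1 e1] [i2 e2] dis; split.
  have dis' i j : f1 i <> f2 j.
    move=> E; apply: (dis (f1 i).1); [apply/e1|apply/e2]; first by exists i.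
    by exists j.
  move=> i j; case: (split_ordP i) => i' ->; case: (split_ordP j) => j' ->;
    rewrite !(fcat_lshift, fcat_rshift).
  - by move=> /i1 ->.
  - by move=> /dis'.
  - by move=> /esym/dis'.
  - by move=> /i2 ->.
move=> x; split=> [/orP[/e1[i ->]|/e2[i ->]]|[i ->]].
- by exists (lshift _ i); rewrite fcat_lshift.
- by exists (rshift _ i); rewrite fcat_rshift.
apply/orP; case: (split_ordP i) => i' ->; rewrite !(fcat_lshift, fcat_rshift).
  by left; apply/e1; exists i'.
by right; apply/e2; exists i'.
Qed.

Lemma enumerates_pair l : enumerates (pair l) (pred1 l).
Proof.
split=> [i j [] //|[i a]]; split=> /= [/eqP ->|[b [-> _]]//]; by exists a.
Qed.

Lemma enumerates_shift N (e : 'I_N -> J) S : enumerates e S ->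
  enumerates (shift \o e) (fun i => if i is j.+1 then S j else false).
Proof.
move=> [ie eS]; split=> [i j|[[|l] a]] /=.
- rewrite /shift; case E : (e i) => [l a]; case E' : (e j) => [l' a'] /= [ll' aa'].
  by apply: ie; rewrite E E' ll' aa'.
- by split=> // -[].
split=> [Sl|[i [lE aE]]].
  by have /eS[i iE] : S (l, a).1 by []; exists i; rewrite /= -iE.
by apply/(eS (l, a)); exists i; rewrite [RHS]surjective_pairing -lE -aE.
Qed.

Lemma enumerates_tidx m : enumerates (tidx m) (fun l => (l < m)%N).
Proof.
elim: m => [|m IHm] /=.
  by split=> [[]//|x]; split=> // -[[]].
apply: (enumerates_ext (enumerates_fcat (enumerates_pair 0) (enumerates_shift IHm) _)).
  by move=> [].
by case.
Qed.

Lemma tidx_lt m i : ((tidx m i).1 < m)%N.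
Proof. by have [_ h] := enumerates_tidx m; apply/h; exists i. Qed.

Lemma kmx_enumerates (f : J -> J -> C) N N' (e : 'I_N -> J) (e' : 'I_N' -> J) S :
  enumerates e S -> enumerates e' S ->
  [/\ \det (kmx f e) = \det (kmx f e'), pd (kmx f e) <-> pd (kmx f e')
    & psd (kmx f e) -> psd (kmx f e')].
Proof.
move=> [ie eS] [ie' eS']; apply: kmx_reindex => // i.
  by apply/eS'/eS; exists i.
by apply/eS/eS'; exists i.
Qed.

Lemma kmx_shift g N (e : 'I_N -> J) : kmx (tker g) (shift \o e) = kmx (tker g) e.
Proof. by apply/matrixP => i j; rewrite !mxE /tker /= tcoef_shift. Qed.

Lemma kmx_pair g l : kmx (tker g) (pair l) = 1%:M.
Proof. by apply/matrixP => i j; rewrite mxE /tker /tcoef /= eqxx. Qed.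

Lemma tker_adj_mx g n1 n2 (f1 : 'I_n1 -> J) (f2 : 'I_n2 -> J) :
  (\matrix_(i, j) tker g (f1 i) (f2 j))^t* = \matrix_(i, j) tker g (f2 i) (f1 j).
Proof. by apply/matrixP => i j; rewrite !mxE /= tker_adj. Qed.

(** The rows are the inner indices 1, ..., m of the window 0, ..., m+1; the column [l] will be one
    of the two ends, 0 or m+1. *)
Definition tcol g m l : 'M[C]_(tsz m, p) :=
  \matrix_(i, j) tker g ((shift \o tidx m) i) (l, j).

(** The correction term of a Schur complement over the inner indices. The block it corrects is left
    out, so that the diagonal and the off-diagonal blocks share one formula. *)
Definition tschur g m l l' : 'M[C]_p :=
  - ((tcol g m l)^t* *m invmx (toep g m) *m tcol g m l').

Lemma enumerates_front m :
  enumerates (fcat (shift \o tidx m) (pair 0%N)) (fun l => (l < m.+1)%N).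
Proof.
apply: enumerates_ext.
  apply: (enumerates_fcat (enumerates_shift (enumerates_tidx m)) (enumerates_pair 0)).
  by case.
by case=> //= i; rewrite orbF.
Qed.

Lemma enumerates_back m :
  enumerates (fcat (tidx m) (pair m)) (fun l => (l < m.+1)%N).
Proof.
apply: enumerates_ext.
  apply: (enumerates_fcat (enumerates_tidx m) (enumerates_pair m)).
  by move=> i; rewrite ltn_neqAle /= => /andP[/negP].
by move=> i /=; rewrite ltnS [RHS]leq_eqVlt orbC.
Qed.

Lemma toep_front g m :
  kmx (tker g) (fcat (shift \o tidx m) (pair 0%N)) =
  block_mx (toep g m) (tcol g m 0) ((tcol g m 0)^t*) 1%:M.
Proof. by rewrite kmx_fcat kmx_shift kmx_pair tker_adj_mx. Qed.

(** By shift invariance the window 0, ..., m may be read as 1, ..., m+1. The same matrix is thus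
    [toep g m] bordered by the index 0 ([toep_front]) or by the index m+1. *)
Lemma toep_back g m :
  kmx (tker g) (fcat (tidx m) (pair m)) =
  block_mx (toep g m) (tcol g m m.+1) ((tcol g m m.+1)^t*) 1%:M.
Proof.
rewrite kmx_fcat kmx_pair tker_adj_mx; congr block_mx;
  by apply/matrixP => i j; rewrite !mxE /tker /= tcoef_shift.
Qed.

(** The coefficient [g m] occurs only between the two ends. Listing them last puts it in the corner,
    and the Schur complement is affine in it. *)
Lemma toep_full g m :
  kmx (tker g) (fcat (shift \o tidx m) (fcat (pair m.+1) (pair 0%N))) =
  block_mx (toep g m) (row_mx (tcol g m m.+1) (tcol g m 0))
    ((row_mx (tcol g m m.+1) (tcol g m 0))^t*)
    (block_mx 1%:M (g m) ((g m)^t*) 1%:M).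
Proof.
rewrite kmx_fcat kmx_shift; congr block_mx.
- apply/matrixP => i j; rewrite mxE.
  by case: (split_ordP j) => j' ->; rewrite ?row_mxEl ?row_mxEr mxE
    !(fcat_lshift, fcat_rshift).
- rewrite -tker_adj_mx; congr (_ ^t*).
  apply/matrixP => i j; rewrite mxE.
  by case: (split_ordP j) => j' ->; rewrite ?row_mxEl ?row_mxEr mxE
    !(fcat_lshift, fcat_rshift).
rewrite kmx_fcat !kmx_pair; congr block_mx; apply/matrixP => i j;
  by rewrite !mxE /tker /tcoef /= ?subn0 ?mxE.
Qed.

Lemma enumerates_full m :
  enumerates (fcat (shift \o tidx m) (fcat (pair m.+1) (pair 0%N)))
    (fun l => (l < m.+2)%N).
Proof.
apply: enumerates_ext.
  apply: (enumerates_fcat (enumerates_shift (enumerates_tidx m))).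
    by apply: (enumerates_fcat (enumerates_pair m.+1) (enumerates_pair 0)); case.
  move=> [|i] //= im; rewrite /= orbF eqSS => /eqP E.
  by rewrite E ltnn in im.
by case=> [|i] //=; rewrite orbF eqSS !ltnS [RHS]leq_eqVlt orbC.
Qed.

Definition tdet g m : C := \det (toep g m.+1) / \det (toep g m).

Lemma toep_ext g g' m : (forall l, (l.+1 < m)%N -> g l = g' l) -> toep g m = toep g' m.
Proof.
move=> gg'; apply/matrixP => i j; rewrite !mxE /tker /tcoef.
have := tidx_lt i; have := tidx_lt j; set a := (tidx m i).1; set b := (tidx m j).1.
move=> bm am; have [ab|ba|//] := ltngtP a b.
  by rewrite gg' // prednK ?subn_gt0 // (leq_ltn_trans (leq_subr _ _) bm).
by rewrite gg' // prednK ?subn_gt0 // (leq_ltn_trans (leq_subr _ _) am).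
Qed.

Lemma tcol0_ext g g' m : (forall l, (l < m)%N -> g l = g' l) -> tcol g m 0 = tcol g' m 0.
Proof.
move=> gg'; apply/matrixP => i j; rewrite !mxE /tker /tcoef /=.
by rewrite ?subn0 gg' // tidx_lt.
Qed.

Lemma tcolS_ext g g' m : (forall l, (l < m)%N -> g l = g' l) ->
  tcol g m m.+1 = tcol g' m m.+1.
Proof.
move=> gg'; apply/matrixP => i j; rewrite !mxE /tker /= !tcoef_shift /tcoef.
have im := tidx_lt i; rewrite (ltn_eqF im) ltnNge ltnW //= gg' //.
by rewrite prednK ?subn_gt0 // leq_subr.
Qed.

Lemma toep_adj g m : (toep g m)^t* = toep g m.
Proof. exact: tker_adj_mx. Qed.

Lemma pd_toepS g m : pd (toep g m.+1) -> pd (toep g m).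
Proof.
rewrite /toep; have [_ <- _] := kmx_enumerates (tker g) (enumerates_back m) (enumerates_tidx m.+1).
by rewrite toep_back pd_schur => -[].
Qed.

Lemma pd_toep_le g m n : (m <= n)%N -> pd (toep g n) -> pd (toep g m).
Proof.
move=> /subnK <-; elim: (n - m)%N => //= k IHk /pd_toepS; exact: IHk.
Qed.

(** Bordering [toep g m] on either side writes [tdet g m] as the determinant of a Schur complement
    in two ways. This is why both factors of the matrix ball have the same determinant in
    modulus. *)
Lemma toep_schur g m : pd (toep g m.+1) ->
  [/\ pd (1%:M + tschur g m 0 0), pd (1%:M + tschur g m m.+1 m.+1),
      tdet g m = \det (1%:M + tschur g m 0 0) &
      tdet g m = \det (1%:M + tschur g m m.+1 m.+1)].
Proof.
move=> pT; have pM := pd_toepS pT; have dM := pd_det_gt0 pM.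
have [dF pF _] := kmx_enumerates (tker g) (enumerates_front m) (enumerates_tidx m.+1).
have [dB pB _] := kmx_enumerates (tker g) (enumerates_back m) (enumerates_tidx m.+1).
rewrite toep_front in dF pF; rewrite toep_back in dB pB.
have [_ ?] := (pd_schur _ _ _).1 (pF.2 pT); have [_ ?] := (pd_schur _ _ _).1 (pB.2 pT).
split=> //; rewrite /tdet {1}/toep.
  by rewrite -dF schur_det ?pd_unit ?toep_adj // mulrC mulKf ?gt_eqF.
by rewrite -dB schur_det ?pd_unit ?toep_adj // mulrC mulKf ?gt_eqF.
Qed.

(* Given the first m matrices, the m-th one ranges over the matrix ball D + A K B, |K| < 1, where
   A A^* and B^* B are the Schur complements of toep g m in the two ends of toep g m.+1. *)
Lemma toep_step g m : pd (toep g m.+1) ->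
  exists A B D : 'M[C]_p,
  [/\ is_trig_mx A /\ (forall i, 0 < A i i), is_trig_mx B^T /\ (forall i, 0 < B i i),
      `|\det A| ^+ 2 = tdet g m /\ `|\det B| ^+ 2 = tdet g m &
      forall g' K, (forall l, (l < m)%N -> g' l = g l) -> g' m = D + A *m K *m B ->
        (pd (toep g' m.+2) <-> pd (1%:M - K^t* *m K)) /\
        (pd (toep g' m.+2) -> tdet g' m.+1 = tdet g m * \det (1%:M - K^t* *m K))].
Proof.
move=> pT; have pM := pd_toepS pT; have dM := pd_det_gt0 pM.
have [p1 p2 d1 d2] := toep_schur pT.
have [A [tA A0 AE]] := cholesky p2.
have [L [tL L0 LE]] := cholesky p1.
have uA : A \in unitmx.
  have := pd_unit p2; by rewrite AE unitmx_mul => /andP[].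
have uL : L \in unitmx.
  have := pd_unit p1; by rewrite LE unitmx_mul => /andP[].
(* The centre cancels the correction in the off-diagonal block of the Schur complement, which leaves
   A K L^* there. *)
exists A, (L^t*), (- tschur g m m.+1 0); split.
- by [].
- split=> [|i]; last by rewrite !mxE /= conj_Creal ?gtr0_real.
  apply/is_trig_mxP => i j ij; rewrite !mxE (is_trig_mxP tL) //= ?conjC0 //.
- by rewrite d2 det_adj norm_conjC {1}AE -d2 d1 LE !det_mulmx !det_adj -!normCK.
move=> g' K gg' g'm.
have TE : toep g' m = toep g m by apply: toep_ext => l lm; apply: gg'; exact: ltnW.
have T1E : toep g' m.+1 = toep g m.+1 by apply: toep_ext => l lm; exact: gg'.
have c0 : tcol g' m 0 = tcol g m 0 by exact: tcol0_ext.
have c1 : tcol g' m m.+1 = tcol g m m.+1 by exact: tcolS_ext.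
have [dF pF _] := kmx_enumerates (tker g') (enumerates_full m) (enumerates_tidx m.+2).
rewrite toep_full TE c0 c1 in dF pF.
have SE : block_mx 1%:M (g' m) ((g' m)^t*) 1%:M -
   (row_mx (tcol g m m.+1) (tcol g m 0))^t* *m invmx (toep g m)
      *m row_mx (tcol g m m.+1) (tcol g m 0) =
   block_mx (A *m A^t*) (A *m K *m L^t*) ((A *m K *m L^t*)^t*) (L *m L^t*).
  rewrite adj_row mul_col_mx mul_col_row opp_block_mx add_block_mx.
  rewrite -[X in _ + X]/(tschur g m m.+1 m.+1).
  rewrite -AE -LE; congr block_mx; rewrite -?[X in _ + X]/(tschur g m m.+1 0) ?g'm.
    by rewrite addrC addrA subrr add0r.
  rewrite adjD addrC -[- (_ *m tcol g m m.+1)]/(tschur g m 0 m.+1).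
  have -> : (- tschur g m m.+1 0)^t* = - tschur g m 0 m.+1.
    by rewrite adjN /tschur adjN !adjM trmxCK adj_inv toep_adj mulmxA.
  by rewrite addrA subrr add0r.
(* A second elimination, now of the block A A^*; what remains is congruent to 1 - K^* K through
   [L]. *)
have S2E : L *m L^t* - (A *m K *m L^t*)^t* *m invmx (A *m A^t*) *m (A *m K *m L^t*)
    = L *m (1%:M - K^t* *m K) *m L^t*.
  rewrite invmx_mul ?adj_unit // !adjM trmxCK mulmxBr mulmx1 mulmxBl; congr (_ - _).
  by rewrite !mulmxA mulmxKV // mulmxK ?adj_unit.
have uAA : A *m A^t* \in unitmx by rewrite -AE pd_unit.
have hAA : (A *m A^t*)^t* = A *m A^t* by rewrite -AE pd_adj.
split.
  rewrite /toep -pF pd_schur SE pd_schur S2E pd_congr_unit //.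
  split=> [[_ []]//|pK]; split=> //; split=> //; by rewrite -AE.
(* With M = [toep g m] and T = [toep g m.+1], the ratio is det M d_m d_m det(1 - K^* K) / det T, and
   det M / det T = 1 / d_m. *)
move=> pT'; rewrite {1}/tdet {1}/toep -dF schur_det ?pd_unit ?toep_adj // SE.
rewrite schur_det // S2E T1E -AE -d2 !det_mulmx.
rewrite -[_ * \det (L^t*)]mulrAC -det_mulmx -LE -d1 /tdet.
have dT := pd_det_gt0 pT.
by field; rewrite !gt_eqF.
Qed.

End Toeplitz.
Arguments tidx {p} m.

(** * The lower integral on the real line *)

Section LowerIntegral.
Import HBNNSimple.
Context {R : realType}.
Local Notation mu := (@lebesgue_measure R).
Local Open Scope ereal_scope.
Implicit Types f g : measurableTypeR R -> \bar R.

(** The integral of a nonnegative function is a supremum over simple functions below it, so an upper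
    bound need only be checked on measurable minorants. *)
Lemma integral_lub f a : (forall t, 0 <= f t) ->
  (forall g, measurable_fun setT g -> (forall t, 0 <= g t) -> (forall t, g t <= f t) ->
    \int[mu]_t g t <= a) ->
  \int[mu]_t f t <= a.
Proof.
move=> f0 fa; rewrite ge0_integralE // patch_setT.
apply: ge_ereal_sup => _ [h hf <-]; rewrite -integralT_nnsfun.
apply: fa => //; last by move=> t; rewrite lee_fin; exact: fun_ge0.
exact/measurable_EFinP.
Qed.

Lemma integral_mono f g : (forall t, 0 <= f t) -> (forall t, f t <= g t) ->
  \int[mu]_t f t <= \int[mu]_t g t.
Proof.
move=> f0 fg; rewrite !ge0_integralE //; last by move=> t _; exact: le_trans (fg t).
rewrite !patch_setT; apply: le_ereal_sup => _ [h hf <-]; exists h => //.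
by move=> t; exact: le_trans (fg t).
Qed.

Lemma measurable_affine (c b : R) :
  measurable_fun setT (fun t : measurableTypeR R => (c * t + b)%R : measurableTypeR R).
Proof.
have -> : (fun t : measurableTypeR R => (c * t + b)%R : measurableTypeR R) =
  ((cst c \* id) \+ cst b)%R by [].
by apply: measurable_funD => //; apply: measurable_funM.
Qed.

Lemma affine_preimage_itv (c b x y : R) : (0 < c)%R ->
  (fun t : R => (c * t + b)%R) @^-1` `]x, y] = `]((x - b) / c)%R, ((y - b) / c)%R]%classic.
Proof.
move=> c0; apply/seteqP; split=> t /=; rewrite !in_itv /= => /andP[xt ty];
  apply/andP; split.
- by rewrite ltr_pdivrMr // ltrBlDr mulrC.
- by rewrite ler_pdivlMr // lerBrDr mulrC.
- by rewrite -ltrBlDr mulrC -ltr_pdivrMr.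
- by rewrite -lerBrDr mulrC -ler_pdivlMr.
Qed.

(** The image of Lebesgue measure under t |-> c t + b, multiplied by c, gives every half-open
    interval its length; uniqueness identifies it with Lebesgue measure. *)
Lemma measurable_integral_affine (c b : R) f : (0 < c)%R ->
  measurable_fun setT f -> (forall t, 0 <= f t) ->
  c%:E * \int[mu]_t f (c * t + b)%R = \int[mu]_t f t.
Proof.
move=> c0 mf f0; pose phi := fun t : measurableTypeR R => (c * t + b)%R : measurableTypeR R.
have mphi : measurable_fun setT phi by exact: measurable_affine.
pose phim : {mfun measurableTypeR R >-> measurableTypeR R} :=
  HB.pack phi (isMeasurableFun.Build _ _ _ _ _ mphi).
have E A : measurable A -> mu A = mscale (NngNum (ltW c0)) (pushforward mu phim) A.
  apply: lebesgue_measure_unique => X [[x y] _ <-].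
  transitivity (c%:E * mu (phi @^-1` (`]x, y]%classic : set R))); last by [].
  have -> : phi @^-1` (`]x, y]%classic : set R) = `]((x - b) / c)%R, ((y - b) / c)%R]%classic.
    exact: affine_preimage_itv.
  rewrite !lebesgue_measure_itv /=.
  rewrite !lte_fin ltr_pM2r ?invr_gt0 // ltrD2r.
  case: ifP => _; last by rewrite mule0.
  by rewrite -!EFinB -EFinM; congr EFin; field; rewrite gt_eqF.
rewrite [RHS](eq_measure_integral (mscale (NngNum (ltW c0)) (pushforward mu phim))); last first.
  by move=> A mA _; exact: E.
rewrite ge0_integral_mscale //=; congr (_ * _).
by rewrite ge0_integral_pushforward.
Qed.

(** Minorants of the substituted function are transported to minorants of [f], which gives one
    inequality. The other is the same inequality for the inverse affine map. *)
Lemma integral_affine (c b : R) f : (0 < c)%R -> (forall t, 0 <= f t) ->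
  c%:E * \int[mu]_t f (c * t + b)%R = \int[mu]_t f t.
Proof.
have key (c' b' : R) h : (0 < c')%R -> (forall t, 0 <= h t) ->
    \int[mu]_t h (c' * t + b')%R <= c'^-1%:E * \int[mu]_t h t.
  move=> c0 h0; apply: integral_lub => // g mg g0 gh.
  have ci0 : (0 < c'^-1)%R by rewrite invr_gt0.
  rewrite -(measurable_integral_affine (- (c'^-1 * b')) ci0 mg g0) lee_pmul2l ?lte_fin //.
  apply: integral_mono => t //; apply: (le_trans (gh _)).
  by rewrite mulrDr mulrN mulrA divff ?gt_eqF // !mul1r mulrA divff ?gt_eqF // mul1r subrK.
move=> c0 f0; apply/eqP; rewrite eq_le; apply/andP; split.
  have := key c b f c0 f0; rewrite -(lee_pmul2l (x := c%:E)) ?lte_fin //.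
  by rewrite muleA -EFinM divff ?gt_eqF // mul1e.
have ci0 : (0 < c^-1)%R by rewrite invr_gt0.
have := key (c^-1)%R (- (c^-1 * b))%R (fun t => f (c * t + b)%R) ci0 (fun=> f0 _).
rewrite invrK; congr (_ <= _); apply: eq_integral => t _; congr f.
by rewrite mulrDr mulrN !mulrA divff ?gt_eqF // !mul1r subrK.
Qed.

Lemma integral_scale (c : R) f : (0 < c)%R -> (forall t, 0 <= f t) ->
  \int[mu]_t (c%:E * f t) = c%:E * \int[mu]_t f t.
Proof.
have key (c' : R) h : (0 < c')%R -> (forall t, 0 <= h t) ->
    \int[mu]_t (c'%:E * h t) <= c'%:E * \int[mu]_t h t.
  move=> c0 h0; apply: integral_lub => [t|g mg g0 gh].
    by rewrite mule_ge0 // lee_fin ltW.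
  rewrite -(lee_pmul2l (x := c'^-1%:E)) ?lte_fin ?invr_gt0 //.
  rewrite muleA -EFinM mulVf ?gt_eqF // mul1e -ge0_integralZl //; last first.
    by rewrite lee_fin invr_ge0 ltW.
  apply: integral_mono => t; first by rewrite mule_ge0 // lee_fin invr_ge0 ltW.
  rewrite -(lee_pmul2l (x := c'%:E)) ?lte_fin //.
  by rewrite muleA -EFinM divff ?gt_eqF // mul1e.
move=> c0 f0; apply/eqP; rewrite eq_le key //=.
rewrite -(lee_pmul2l (x := c^-1%:E)) ?lte_fin ?invr_gt0 //.
rewrite muleA -EFinM mulVf ?gt_eqF // mul1e.
have := key (c^-1)%R (fun t => c%:E * f t) _ _; rewrite invr_gt0 => /(_ c0) h.
apply: le_trans (h _) => [|t]; last by rewrite mule_ge0 // lee_fin ltW.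
under [leRHS]eq_integral do rewrite muleA -EFinM mulVf ?gt_eqF // mul1e.
by [].
Qed.

Lemma integral_itv_indic (x r : R) : (0 <= r)%R ->
  \int[mu]_t (`|t - x| <= r)%R%:R%:E = (r *+ 2)%:E.
Proof.
move=> r0; transitivity (\int[mu]_t (\1_(`[x - r, x + r]%classic : set (measurableTypeR R)) t)%:E).
  by apply: eq_integral => t _; rewrite indicE mem_setE in_itv /= ler_distl.
rewrite integral_indic // setIT.
etransitivity; first exact: (lebesgue_measure_itv `[(x - r)%R, (x + r)%R]).
rewrite /= lte_fin; case: ltP => [_|h].
  by rewrite -EFinB; congr EFin; rewrite mulr2n; lra.
suff -> : r = 0%R by rewrite mul0rn.
lra.
Qed.

End LowerIntegral.

(** * Iterated integrals and triangular substitutions *)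

Section IteratedIntegral.
Context {R : realType} {I : eqType}.
Local Notation mu := (@lebesgue_measure R).
Local Notation env := (I -> R).
Local Open Scope ereal_scope.
Implicit Types (s : seq I) (x y : env) (f g : env -> \bar R).

Definition upd x i (t : R) : env := fun j => if j == i then t else x j.

(* No integrand is assumed measurable: the integral of a nonnegative function is its lower integral,
   which is monotone, homogeneous and compatible with affine substitutions. *)
Fixpoint lint s f x : \bar R :=
  if s is i :: s' then \int[mu]_t lint s' f (upd x i t) else f x.

Definition agree s x y := forall j, j \notin s -> x j = y j.

Lemma agree_sub s s' x y : {subset s <= s'} -> agree s x y -> agree s' x y.
Proof. by move=> ss' xy j js'; apply: xy; apply: contra js' => /ss'. Qed.

Lemma agree_upd i s x y t : agree s (upd x i t) y -> agree (i :: s) x y.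
Proof.
move=> xy j; rewrite inE negb_or => /andP[ji js].
by rewrite -xy // /upd (negPf ji).
Qed.

Lemma agree_upd_same i s x t : agree (i :: s) (upd x i t) x.
Proof. by move=> j; rewrite inE negb_or /upd => /andP[/negPf ->]. Qed.

Lemma lint_ge0 s f x : (forall y, 0 <= f y) -> 0 <= lint s f x.
Proof.
by move=> f0; elim: s x => [|i s IHs] x //=; apply: integral_ge0 => t _.
Qed.

Lemma lint_le s f g x : (forall y, 0 <= f y) ->
  (forall y, agree s x y -> f y <= g y) -> lint s f x <= lint s g x.
Proof.
move=> f0; elim: s x => [|i s IHs] x fg /=; first exact: fg.
apply: integral_mono => t; first exact: lint_ge0.
by apply: IHs => y xy; apply: fg; exact: agree_upd xy.
Qed.

Lemma lint_ext s f g x :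
  (forall y, agree s x y -> f y = g y) -> lint s f x = lint s g x.
Proof.
elim: s x => [|i s IHs] x fg /=; first exact: fg.
apply: eq_integral => t _; apply: IHs => y xy; apply: fg; exact: agree_upd xy.
Qed.

Lemma lint_agree s f x y : agree s x y -> lint s f x = lint s f y.
Proof.
elim: s x y => [|i s IHs] x y xy /=; first by congr f; apply/funext => j; exact: xy.
apply: eq_integral => t _; apply: IHs => j js; rewrite /upd.
by have [//|ji] := eqVneq; apply: xy; rewrite inE negb_or ji.
Qed.

Lemma lint_cat s1 s2 f x : lint (s1 ++ s2) f x = lint s1 (lint s2 f) x.
Proof. by elim: s1 x => [|i s IHs] x //=; apply: eq_integral => t _. Qed.

Lemma lint0 s x : lint s (fun _ => 0) x = 0.
Proof. by elim: s x => [|i s IHs] x //=; apply: integral0_eq => u _; rewrite IHs. Qed.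

Lemma lint_scale s (c : R) f x : (0 <= c)%R -> (forall y, 0 <= f y) ->
  lint s (fun y => c%:E * f y) x = c%:E * lint s f x.
Proof.
move=> + f0; rewrite le_eqVlt => /predU1P[<-|c0].
  by rewrite mul0e -[RHS](lint0 s x); apply: lint_ext => y _; rewrite mul0e.
elim: s x => [|i s IHs] x //=; under eq_integral do rewrite IHs.
by rewrite integral_scale // => t; exact: lint_ge0.
Qed.

Lemma lint_indep s f x x' :
  (forall y y', (forall j, j \in s -> y j = y' j) -> f y = f y') ->
  lint s f x = lint s f x'.
Proof.
(* The induction needs the hypothesis relative to the base points: a variable fixed by an outer
   integral has the same value t on both sides. *)
suff key : (forall y y', agree s x y -> agree s x' y' -> (forall j, j \in s -> y j = y' j) ->
    f y = f y') -> lint s f x = lint s f x'.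
  by move=> h; apply: key => y y' _ _; exact: h.
elim: s x x' => [|i s IHs] x x' h /=; first exact: h.
apply: eq_integral => t _; apply: IHs => y y' xy xy' yy'.
apply: h; [exact: agree_upd xy|exact: agree_upd xy'|move=> j].
have [js _|js] := boolP (j \in s); first exact: yy'.
by rewrite inE (negPf js) orbF => /eqP ji; rewrite -xy // -xy' // /upd ji eqxx.
Qed.

(** The offset [b] may depend only on coordinates outside [i :: s'], among them those integrated
    further out. With these fixed, each integral undergoes an affine substitution in a single real
    variable. *)
Fixpoint triangular s (Phi : env -> env) (a : I -> R) : Prop :=
  if s is i :: s' then
    (exists b : env -> R, (forall x, Phi x i = (a i * x i + b x)%R) /\
       (forall x y, agree (i :: s') x y -> b x = b y)) /\ triangular s' Phi a
  else True.

Lemma lint_triangular s Phi (a : I -> R) f x : uniq s ->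
  (forall i, i \in s -> (0 < a i)%R) -> (forall y, 0 <= f y) ->
  (forall j, j \notin s -> forall x y, agree s x y -> Phi x j = Phi y j) ->
  triangular s Phi a ->
  (\prod_(i <- s) a i)%:E * lint s (fun y => f (Phi y)) x = lint s f (Phi x).
Proof.
move=> + + f0; elim: s x => [|i s IHs] x /=; first by rewrite big_nil mul1e.
move=> /andP[is_ us] a0 out [[b [bE bagree]] tri].
have a0' j : j \in s -> (0 < a j)%R by move=> js; apply: a0; rewrite inE js orbT.
have ai0 : (0 < a i)%R by apply: a0; rewrite inE eqxx.
have sub : {subset s <= i :: s} by move=> j js; rewrite inE js orbT.
have out' j : j \notin s -> forall y z, agree s y z -> Phi y j = Phi z j.
  move=> js y z yz; have [->|ji] := eqVneq j i.
    by rewrite !bE yz // (bagree y z) //; exact: agree_sub yz.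
  by apply: out; rewrite ?inE ?negb_or ?ji //; exact: agree_sub yz.
have pa0 : (0 < \prod_(j <- s) a j)%R.
  by rewrite big_seq; apply: prodr_gt0 => j /a0'.
rewrite big_cons EFinM -muleA -integral_scale //; last by move=> t; exact: lint_ge0.
under eq_integral do rewrite IHs //.
rewrite -[RHS](integral_affine (b x) ai0); last by move=> t; exact: lint_ge0.
congr (_ * _); apply: eq_integral => t _; apply: lint_agree => j js.
rewrite /upd; have [->|ji] := eqVneq j i.
  by rewrite bE /upd eqxx (bagree _ x) //; exact: agree_upd_same.
by apply: out; rewrite ?inE ?negb_or ?ji //; exact: agree_upd_same.
Qed.

Lemma lint_box s (c : I -> R) (r : R) x : uniq s -> (0 < r)%R ->
  lint s (fun y => (all (fun i => `|y i - c i| <= r)%R s)%:R%:E) x =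
  ((r *+ 2) ^+ size s)%:E.
Proof.
move=> + r0; elim: s x => [|i s IHs] x //=.
move=> /andP[is_ us].
transitivity (\int[mu]_t (((r *+ 2) ^+ size s)%:E * (`|t - c i| <= r)%R%:R%:E)); last first.
  rewrite integral_scale ?exprn_gt0 ?mulrn_wgt0 // integral_itv_indic ?ltW //.
  by rewrite -EFinM exprSr.
apply: eq_integral => t _.
rewrite (_ : lint s _ _ = lint s (fun y => (`|t - c i| <= r)%R%:R%:E *
    (all (fun i => `|y i - c i| <= r)%R s)%:R%:E) (upd x i t)); last first.
  apply: lint_ext => y xy; rewrite -xy // /upd eqxx.
  by case: (_ <= r)%R; rewrite ?mul1e ?mul0e.
case: (`|t - c i| <= r)%R.
  by rewrite mule1 -(IHs (upd x i t)) //; apply: lint_ext => y _; rewrite mul1e.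
rewrite mule0 -(lint0 s (upd x i t)); apply: lint_ext => y _; exact: mul0e.
Qed.

End IteratedIntegral.

(** * Real coordinates of a block and the Jacobian of K |-> D + A K B *)

Section Coordinates.
Context {R : realType} {p : nat}.
Local Notation I := (nat * 'I_p * 'I_p * bool)%type.
Local Notation env := (I -> R).
Local Notation C := R[i].

Definition gam (x : env) (l : nat) : 'M[C]_p :=
  \matrix_(a, b) Complex (x (l, a, b, false)) (x (l, a, b, true)).

(** The order matters twice: it is the order of [enum] on [coord], in which the Lebesgue measure of
    the statement iterates, and it is row-major inside a block, which makes the block substitution
    triangular. *)
Definition crds (ls : seq nat) : seq I :=
  [seq (y, c) | y <- [seq (z, b) | z <- [seq (l, a) | l <- ls, a <- enum 'I_p],
                                   b <- enum 'I_p], c <- enum {: bool}].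

Lemma crds_cat l1 l2 : crds (l1 ++ l2) = crds l1 ++ crds l2.
Proof. by rewrite /crds !allpairs_cat. Qed.

Lemma mem_crds ls l a b c : ((l, a, b, c) \in crds ls) = (l \in ls).
Proof.
rewrite /crds; apply/allpairsP/idP => [[[[[l' a'] b'] c'] /= [h _ [-> _ _ _]]]|h].
  by have /allpairsP[[[l1 a1] b1] /= [+ _ [-> _ _]]] := h => /allpairsP[[l2 a2] /= [? _ [-> _]]].
exists ((l, a, b), c); split; rewrite ?mem_enum //.
by apply: allpairs_f; rewrite ?mem_enum //; apply: allpairs_f; rewrite ?mem_enum.
Qed.

Lemma uniq_crds ls : uniq ls -> uniq (crds ls).
Proof.
move=> u; have inj (T1 T2 : eqType) (s1 : seq T1) (s2 : seq T2) :
    uniq s1 -> uniq s2 -> uniq [seq (x, y) | x <- s1, y <- s2].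
  by move=> u1 u2; apply: allpairs_uniq => // -[? ?] [? ?] _ _ [-> ->].
by rewrite /crds !inj ?enum_uniq.
Qed.

Lemma size_crds ls : size (crds ls) = (size ls * p * p * 2)%N.
Proof. by rewrite /crds !size_allpairs !size_enum_ord -cardE card_bool. Qed.

Lemma pairwise_allpairs (T1 T2 T3 : eqType) (r1 : rel T1) (r2 : rel T3) (f : T1 -> T2 -> T3)
    (s : seq T1) (t : seq T2) :
  pairwise r1 s -> (forall x y u v, r1 x y -> r2 (f x u) (f y v)) ->
  (forall x, pairwise r2 [seq f x u | u <- t]) -> pairwise r2 [seq f x u | x <- s, u <- t].
Proof.
move=> + h1 h2; elim: s => //= x s IHs /andP[xs /IHs ps].
rewrite pairwise_cat h2 ps !andbT; apply/allrelP => _ _ /mapP[u _ ->] /allpairsP[[y v] /= [ys _ ->]].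
by apply: h1; move/allP: xs; apply.
Qed.

Lemma pairwise_enum_ord n : pairwise (fun i j : 'I_n => (i < j)%N) (enum 'I_n).
Proof.
rewrite -(pairwise_map val ltn) val_enum_ord -sorted_pairwise.
  exact: iota_ltn_sorted.
exact: ltn_trans.
Qed.

(** Row-major order on the entries of a block. It is not strict, because the real and the imaginary
    part of one entry do not enter each other's offset. *)
Definition row_le (i j : I) : bool :=
  (i.1.1.2 < j.1.1.2)%N || ((i.1.1.2 == j.1.1.2) && (i.1.2 <= j.1.2)%N).

Lemma pairwise_crds l : pairwise row_le (crds [:: l]).
Proof.
pose r1 (x y : nat * 'I_p) := (x.2 < y.2)%N.
pose r2 (x y : nat * 'I_p * 'I_p) :=
  (x.1.2 < y.1.2)%N || ((x.1.2 == y.1.2) && (x.2 < y.2)%N).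
apply: (pairwise_allpairs (r1 := r2)); last 2 first.
- by move=> x y c c'; rewrite /r2 /row_le /= => /orP[->//|/andP[-> /ltnW->]]; rewrite orbT.
- move=> x; rewrite pairwise_map; apply/(pairwiseP false) => i j _ _ _.
  by rewrite /row_le /= eqxx leqnn orbT.
apply: (pairwise_allpairs (r1 := r1)); last 2 first.
- by move=> x y c c'; rewrite /r1 /r2 /= => ->.
- move=> x; rewrite pairwise_map; apply: sub_pairwise (pairwise_enum_ord p).
  by move=> b b'; rewrite /r2 /= eqxx => ->; rewrite orbT.
rewrite /= cats0 pairwise_map; exact: pairwise_enum_ord.
Qed.

Definition part (c : bool) (z : C) : R := if c then complex.Im z else complex.Re z.

Definition blk_map (l : nat) (A B D : 'M[C]_p) (x : env) : env :=
  fun i => if i.1.1.1 == l then part i.2 ((D + A *m gam x l *m B) i.1.1.2 i.1.2) else x i.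

Lemma gam_blk_map l A B D x : gam (blk_map l A B D x) l = D + A *m gam x l *m B.
Proof.
by apply/matrixP => a b; rewrite mxE /blk_map /= eqxx; case: (_ a b).
Qed.

Lemma partD c (z w : C) : part c (z + w) = part c z + part c w.
Proof. by case: c; rewrite /part raddfD. Qed.

Lemma part_real_mul c (u z : C) : u \is Num.real -> part c (u * z) = complex.Re u * part c z.
Proof.
move=> /complex_realP[r ->]; case: z => z z'.
by case: c; rewrite /part /= ?mul0r ?subr0 ?addr0.
Qed.

Lemma part_gam x l a b c : part c (gam x l a b) = x (l, a, b, c).
Proof. by rewrite mxE; case: c. Qed.

(** Triangularity restricts the entry (a, b) of A X B to entries of X weakly above and to the left.
    The coefficient of X_ab is A_aa B_bb, which is real when the diagonals are positive, so real and
    imaginary parts do not mix to leading order. *)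
Lemma blk_map_entry l (A B D : 'M[C]_p) x a b :
  is_trig_mx A -> is_trig_mx B^T ->
  (D + A *m gam x l *m B) a b = A a a * B b b * gam x l a b +
    (D a b + \sum_(ij : 'I_p * 'I_p | [&& (ij.1 <= a)%N, (ij.2 <= b)%N & ij != (a, b)])
                A a ij.1 * gam x l ij.1 ij.2 * B ij.2 b).
Proof.
move=> tA tB; rewrite mxE addrC.
have -> : (A *m gam x l *m B) a b = \sum_(ij : 'I_p * 'I_p) A a ij.1 * gam x l ij.1 ij.2 * B ij.2 b.
  rewrite -(pair_bigA _ (fun i j => A a i * gam x l i j * B j b)) exchange_big /= mxE.
  by apply: eq_bigr => j _; rewrite mxE big_distrl.
rewrite (bigD1 (a, b)) //= -addrA; congr (_ + _); first by rewrite mulrAC.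
rewrite addrC; congr (_ + _); rewrite big_mkcond [RHS]big_mkcond.
apply: eq_bigr => -[i j] _ /=; case: eqP => [|_] /=; first by rewrite !andbF.
rewrite andbT; case: leqP => ia /=; last by rewrite (is_trig_mxP tA) // !mul0r.
case: leqP => jb //=; have := is_trig_mxP tB b j jb; rewrite mxE => ->.
by rewrite mulr0.
Qed.

Lemma triangular_blk_map l (A B D : 'M[C]_p) s :
  is_trig_mx A -> (forall i, 0 < A i i) -> is_trig_mx B^T -> (forall i, 0 < B i i) ->
  pairwise row_le s -> {subset s <= crds [:: l]} ->
  triangular s (blk_map l A B D)
    (fun i => complex.Re (A i.1.1.2 i.1.1.2 * B i.1.2 i.1.2)).
Proof.
move=> tA A0 tB B0; elim: s => //= i s IHs /andP[le_i ps] sub; split; last first.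
  by apply: IHs => // j js; apply: sub; rewrite inE js orbT.
have : i \in crds [:: l] by apply: sub; rewrite inE eqxx.
case: i le_i sub => [[[l' a] b] c] le_i sub; rewrite mem_crds inE => /eqP ?; subst l'.
exists (fun x => part c (D a b + \sum_(ij : 'I_p * 'I_p | [&& (ij.1 <= a)%N, (ij.2 <= b)%N & ij != (a, b)])
                A a ij.1 * gam x l ij.1 ij.2 * B ij.2 b)); split=> [x|x y xy].
  rewrite /blk_map /= eqxx blk_map_entry // [LHS]partD; congr (_ + _).
  by rewrite part_real_mul ?part_gam // realM ?gtr0_real.
congr (part c (_ + _)); apply: eq_bigr => -[a' b'] /= /and3P[la lb ab].
suff xyE c' : x (l, a', b', c') = y (l, a', b', c') by rewrite !mxE !xyE.
have nle : ~~ row_le (l, a, b, c) (l, a', b', c').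
  rewrite /row_le /= ltnNge la /=; apply: contra ab => /andP[/eqP -> lb'].
  by rewrite xpair_eqE eqxx -val_eqE eqn_leq lb lb'.
apply: xy; rewrite inE negb_or; apply/andP; split.
  by apply: contra nle => /eqP[-> -> _]; rewrite /row_le /= eqxx leqnn orbT.
by apply: contra nle => js; move/allP: le_i; apply.
Qed.

(** Each entry contributes A_aa B_bb twice, for its real and its imaginary part; the product over
    all (a, b) is (det A det B)^(2p). *)
Lemma lint_blk_map l (A B D : 'M[C]_p) (F : 'M[C]_p -> \bar R) x :
  is_trig_mx A -> (forall i, 0 < A i i) -> is_trig_mx B^T -> (forall i, 0 < B i i) ->
  (forall G, (0 <= F G)%E) ->
  ((complex.Re ((\det A * \det B) ^+ (2 * p)))%R%:E *
    lint (crds [:: l]) (fun y => F (D + A *m gam y l *m B)%R) x =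
    lint (crds [:: l]) (fun y => F (gam y l)) x)%E.
Proof.
move=> tA A0 tB B0 F0.
have := @lint_triangular R I (crds [:: l]) (blk_map l A B D)
  (fun i => complex.Re (A i.1.1.2 i.1.1.2 * B i.1.2 i.1.2)) (fun y => F (gam y l)) x.
have AB0 a b : 0 < A a a * B b b by rewrite mulr_gt0.
rewrite (_ : lint _ _ (blk_map l A B D x) = lint (crds [:: l]) (fun y => F (gam y l)) x); last first.
  apply: lint_agree => -[[[l' a] b] c]; rewrite mem_crds inE /blk_map /=.
  by move=> /negPf ->.
move=> <- //; first 1 last.
- by rewrite uniq_crds.
- by move=> i _; have := AB0 i.1.1.2 i.1.2; rewrite ltcE => /andP[].
- move=> [[[l' a] b] c]; rewrite mem_crds inE => ll' y z yz.
  by rewrite /blk_map /= (negPf ll') yz // mem_crds inE.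
- apply: triangular_blk_map => //; exact: pairwise_crds.
congr (_%:E * _)%E; last first.
  by apply: lint_ext => y _; rewrite gam_blk_map.
apply: esym; rewrite -[LHS]/(complex.Re (real_complex R _)) rmorph_prod /=.
congr complex.Re.
transitivity (\prod_(i <- crds [:: l]) (A i.1.1.2 i.1.1.2 * B i.1.2 i.1.2)).
  apply: eq_bigr => i _; have : A i.1.1.2 i.1.1.2 * B i.1.2 i.1.2 \is Num.real.
    by rewrite realM ?gtr0_real.
  by move=> /complex_realP[r ->].
rewrite det_trig // -(det_tr B) det_trig // /crds !big_allpairs big_seq1.
rewrite big_enum /=.
transitivity (\prod_(a < p) ((A a a * A a a) ^+ p * (\prod_(b < p) B^T b b) ^+ 2)).
  apply: eq_bigr => a _; rewrite big_enum /=.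
  transitivity (\prod_(b < p) ((A a a * A a a) * (B^T b b * B^T b b))).
    apply: eq_bigr => b _; rewrite big_enum /= big_bool /= mxE; ring.
  by rewrite big_split /= prodr_const card_ord -expr2 -prodrXl; under [X in _ * X]eq_bigr do rewrite -expr2.
rewrite big_split /= prodr_const card_ord -exprM exprMn; congr (_ * _).
by rewrite -prodrXl; apply: eq_bigr => a _; rewrite -expr2 exprM.
Qed.

Definition mseq_of (n : nat) (x : env) : mseq R p n := fun l : 'I_n => gam x l.

Lemma lebesgue_tupleE (J : eqType) (P : set (seq R)) (s : seq J) x : uniq s ->
  lebesgue_tuple [set t : (size s).-tuple R | P t] =
  lint s (fun y => (`[< P (map y s) >])%:R%:E) x.
Proof.
elim: s P x => [|j s IHs] P x /= => [_|/andP[js us]].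
  by rewrite diracE; congr (_%:R%:E); apply/idP/idP => [/set_mem/asboolP//|/asboolP/mem_set].
apply: eq_integral => t _; rewrite (IHs (fun u => P (t :: u)) (upd x j t)) //.
apply: lint_ext => y xy; congr (`[< P (_ :: _) >]%:R%:E).
by rewrite -xy // /upd eqxx.
Qed.

Lemma enum_prodE (T1 T2 : finType) :
  enum {: T1 * T2} = [seq (x, y) | x <- enum T1, y <- enum T2].
Proof. by rewrite [LHS]enumT unlock. Qed.

Definition natcrd n (c : Defs.coord p n) : I := (nat_of_ord c.1.1.1, c.1.1.2, c.1.2, c.2).

Lemma crds_enum n : crds (iota 0 n) = map (@natcrd n) (enum (Defs.coord p n)).
Proof.
have lift (T1 T1' T2 : Type) (h : T1 -> T1') (s1 : seq T1) (s2 : seq T2) :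
    [seq (x, y) | x <- map h s1, y <- s2] = map (fun z => (h z.1, z.2)) [seq (x, y) | x <- s1, y <- s2].
  by rewrite allpairs_mapl map_allpairs.
by rewrite /Defs.coord !enum_prodE -val_enum_ord /crds !lift.
Qed.

Lemma lebesgue_mseqE n (A : set (mseq R p n)) x :
  lebesgue_mseq A = lint (crds (iota 0 n)) (fun y => (`[< A (mseq_of y) >])%:R%:E) x.
Proof.
have sz : size (crds (iota 0 n)) = #|Defs.coord p n| by rewrite crds_enum size_map -cardE.
(* A predicate on sequences, so that tuples of the two lengths [#|coord|] and [size (crds _)], equal
   only by a proof, can be exchanged. *)
pose P : set (seq R) := fun r => forall t : #|Defs.coord p n|.-tuple R, tval t = r ->
  A (mseq_of_coords t).
transitivity (lebesgue_tuple [set t : #|Defs.coord p n|.-tuple R | P t]).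
  congr lebesgue_tuple; apply/seteqP; split=> t /=.
    by move=> At t' /val_inj ->.
  by apply.
have -> : lebesgue_tuple [set t : #|Defs.coord p n|.-tuple R | P t] =
    lebesgue_tuple [set t : (size (crds (iota 0 n))).-tuple R | P t] by rewrite sz.
rewrite (lebesgue_tupleE P x) ?uniq_crds ?iota_uniq //.
apply: lint_ext => y _; congr ((nat_of_bool _)%:R%:E); apply: asbool_equiv_eq.
have key (t : #|Defs.coord p n|.-tuple R) : tval t = map y (crds (iota 0 n)) ->
    mseq_of_coords t = mseq_of y.
  move=> tE; apply/funext => l; apply/matrixP => a b; rewrite !mxE !(tnth_nth 0) tE crds_enum.
  have h (c : Defs.coord p n) : nth 0 (map y (map (@natcrd n) (enum (Defs.coord p n)))) (enum_rank c) = y (natcrd c).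
    by rewrite -map_comp (nth_map c) ?nth_enum_rank // -cardE ltn_ord.
  by rewrite !h.
split=> [Py|Ay t tE]; last by rewrite key.
have szt : size (map y (crds (iota 0 n))) == #|Defs.coord p n| by rewrite size_map sz.
by rewrite -(key (Tuple szt)) //; apply: Py.
Qed.

End Coordinates.

(** * Integrating out the last blocks *)

Section Density.
Context {R : realType} {p : nat}.
Local Notation I := (nat * 'I_p * 'I_p * bool)%type.
Local Notation env := (I -> R).
Local Notation C := R[i].
Local Notation Re := complex.Re.

Lemma gtc0_Re (z : C) : 0 < z -> z = (Re z)%:C%C /\ 0 < Re z.
Proof. by case: z => a b; rewrite ltcE /= => /andP[/eqP -> ->]. Qed.

Lemma ReX (r : R) n : Re (r%:C%C ^+ n) = r ^+ n.
Proof. by rewrite -rmorphXn. Qed.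

(** For [e = 0] this is the indicator of T_m > 0. Integrating out the last block keeps the shape, up
    to a constant, and raises the exponent by 2p. *)
Definition weight m e (g : nat -> 'M[C]_p) : \bar R :=
  if `[< pd (toep g m.+1) >] then ((Re (tdet g m)) ^+ e)%:E else 0%E.

Lemma tdet_gt0 (g : nat -> 'M[C]_p) m : pd (toep g m.+1) -> 0 < tdet g m.
Proof. by move=> pT; apply: divr_gt0; apply: pd_det_gt0 => //; exact: pd_toepS. Qed.

Lemma weight_ge0 m e g : (0 <= weight m e g)%E.
Proof.
rewrite /weight; case: asboolP => // /tdet_gt0 /gtc0_Re[_ d0].
by rewrite lee_fin exprn_ge0 // ltW.
Qed.

Lemma pd_toep_step (g g' : nat -> 'M[C]_p) m : (forall l, (l < m)%N -> g l = g' l) ->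
  toep g m.+1 = toep g' m.+1.
Proof. by move=> gg'; apply: toep_ext => l; exact: gg'. Qed.

Lemma tdet_ext (g g' : nat -> 'M[C]_p) m : (forall l, (l < m)%N -> g l = g' l) ->
  tdet g m = tdet g' m.
Proof.
move=> gg'; rewrite /tdet (pd_toep_step gg'); congr (_ / \det _).
by apply: toep_ext => l lm; apply: gg'; exact: ltnW.
Qed.

Lemma weight_ext m e (g g' : nat -> 'M[C]_p) : (forall l, (l < m)%N -> g l = g' l) ->
  weight m e g = weight m e g'.
Proof. by move=> gg'; rewrite /weight (pd_toep_step gg') (tdet_ext gg'). Qed.

Definition contr (K : 'M[C]_p) : 'M[C]_p := 1%:M - K^t* *m K.

Definition cweight e (K : 'M[C]_p) : \bar R :=
  if `[< pd (contr K) >] then ((Re (\det (contr K))) ^+ e)%:E else 0%E.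

Lemma cweight_ge0 e K : (0 <= cweight e K)%E.
Proof.
rewrite /cweight; case: asboolP => // /pd_det_gt0 /gtc0_Re[_ d0].
by rewrite lee_fin exprn_ge0 // ltW.
Qed.

Lemma contr_le1 K : pd (contr K) -> 0 < \det (contr K) <= 1.
Proof.
move=> pK; rewrite pd_det_gt0 //=; apply: pd_det_le1 => //.
rewrite /contr opprB addrC subrK -[X in _ *m X]trmxCK; exact: psd_gram.
Qed.

(** The form at a basis vector bounds the norm of a column of [K] by 1. The matrix ball thus lies in
    a cube, which makes [cconst] finite. *)
Lemma contr_entry K a b : pd (contr K) -> `|K a b| <= 1.
Proof.
move=> /pd_psd[_ /(_ (delta_mx 0 b))]; rewrite qfD qfN subr_ge0.
have -> : qf 1%:M (delta_mx 0 b : 'rV[C]_p) = 1.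
  rewrite qf1E (bigD1 b) //= big1 ?addr0; first by rewrite mxE !eqxx normr1 expr1n.
  by move=> i ib; rewrite mxE eqxx (negPf ib) normr0 expr0n.
have -> : qf (K^t* *m K) (delta_mx 0 b) = \sum_i `|K i b| ^+ 2.
  rewrite -[X in _ *m X]mul1mx -[X in _ *m (_ *m X)]trmxCK mulmxA qf_congr qf1E.
  by apply: eq_bigr => i _; rewrite -rowE !mxE norm_conjC.
move=> h; rewrite -(@expr_le1 _ 2) //; apply: le_trans h.
by rewrite (bigD1 a) //= lerDl sumr_ge0 // => i _; rewrite exprn_ge0.
Qed.

Lemma normc_part c (z : C) : `|part c z|%:C%C <= `|z|.
Proof.
have -> : `|part c z|%:C%C = `|(part c z)%:C%C| by rewrite normc_def /= expr0n addr0 sqrtr_sqr.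
case: z => a b; rewrite !normc_def /= !expr0n !addr0 lecE /= eqxx /= ler_wsqrtr //.
by case: c => /=; rewrite ?lerDl ?lerDr sqr_ge0.
Qed.

(** The integral of det(1 - K^* K)^e over the unit matrix ball. It is carried along unevaluated and
    cancels in [law_first_coords]. *)
Definition cconst m e : \bar R := lint (crds [:: m]) (fun y => cweight e (gam y m)) (fun=> 0).

Lemma cconst_ge0 m e : (0 <= cconst m e)%E.
Proof. by apply: lint_ge0 => y; exact: cweight_ge0. Qed.

Lemma cconstE m e x :
  lint (crds [:: m]) (fun y => cweight e (gam y m)) x = cconst m e.
Proof.
apply: lint_indep => y y' yy'; congr cweight.
by apply/matrixP => a b; rewrite !mxE !yy' ?mem_crds ?inE.
Qed.

Lemma cconst_fin m e : (cconst m e < +oo)%E.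
Proof.
apply: le_lt_trans (ltry (((1 : R) *+ 2) ^+ size (@crds p [:: m]))).
rewrite -(lint_box (fun=> 0) (fun=> 0)) ?uniq_crds //.
apply: lint_le => y; first exact: cweight_ge0.
move=> _; rewrite /cweight; case: asboolP => [pK|_]; last by rewrite lee_fin.
have -> : all (fun i => `|y i - 0| <= 1) (crds [:: m]).
  apply/allP => -[[[l a] b] c]; rewrite mem_crds inE => /eqP ->.
  rewrite subr0 -part_gam; have := le_trans (normc_part c _) (contr_entry a b pK).
  by rewrite lecE => /andP[].
rewrite lee_fin; have /andP[/gtc0_Re[dE d0]] := contr_le1 pK.
by rewrite lecE => /andP[_ /= d1]; rewrite exprn_ile1 // ltW.
Qed.

Lemma weight_step m e x :
  lint (crds [:: m]) (fun y => weight m.+1 e (gam y)) x =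
  (cconst m e * weight m (e + 2 * p) (gam x))%E.
Proof.
have below y : agree (crds [:: m]) x y -> forall l, (l < m)%N -> gam y l = gam x l.
  move=> xy l lm; apply/matrixP => a b; rewrite !mxE !xy // mem_crds inE;
  by rewrite ltn_eqF.
(* Where T_m fails to be definite both sides vanish, since a definite T_(m+1) has a definite corner
   T_m. *)
case: (pselect (pd (toep (gam x) m.+1))) => pT; last first.
  rewrite [in RHS]/weight asboolF // mule0 -[RHS](lint0 (crds [:: m]) x).
  apply: lint_ext => y /below yx; rewrite /weight asboolF // => /pd_toepS.
  by rewrite (pd_toep_step yx).
have [A [B [D [[tA A0] [tB B0] [dA dB] step]]]] := toep_step pT.
have /gtc0_Re[dE d0] := tdet_gt0 pT; set d := Re _ in dE d0.
have uA : A \in unitmx.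
  rewrite unitmxE unitfE det_trig //; apply/prodf_neq0 => i _; exact: lt0r_neq0.
have uB : B \in unitmx.
  rewrite unitmxE unitfE -det_tr det_trig //; apply/prodf_neq0 => i _.
  by rewrite mxE; exact: lt0r_neq0.
(* The integrand as a function of X = D + A K B, with K solved from X. *)
pose F (X : 'M[C]_p) := ((d ^+ e)%:E * cweight e (invmx A *m (X - D) *m invmx B))%E.
have F0 X : (0 <= F X)%E by rewrite mule_ge0 ?cweight_ge0 // lee_fin exprn_ge0 // ltW.
transitivity (lint (crds [:: m]) (fun y => F (gam y m)) x).
  apply: lint_ext => y /below yx; set K := invmx A *m (gam y m - D) *m invmx B.
  have yE : gam y m = D + A *m K *m B.
    by rewrite /K !mulmxA mulmxV // mul1mx mulmxKV // addrC subrK.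
  have [pE tE] := step (gam y) K yx yE; rewrite /weight /F -/K /cweight.
  case: asboolP => [py|npy].
    rewrite asboolT; last exact/pE.
    have /pE/pd_det_gt0/gtc0_Re[kE k0] := py.
    rewrite tE // dE kE -rmorphM -EFinM -exprMn.
    by rewrite /= -/d.
  by rewrite asboolF ?mule0 // => /pE.
rewrite -(lint_blk_map m D x tA A0 tB B0 F0).
transitivity ((d ^+ (2 * p))%:E * ((d ^+ e)%:E * cconst m e))%E.
  congr (_%:E * _)%E.
    (* Positive diagonals make the determinants equal to their moduli, so (det A det B)^(2p) =
       d^(2p). *)
    have nA : `|\det A| = \det A.
      by rewrite ger0_norm // det_trig // prodr_ge0 // => i _; exact: ltW.
    have nB : `|\det B| = \det B.
      rewrite ger0_norm // -det_tr det_trig // prodr_ge0 // => i _; rewrite mxE; exact: ltW.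
    rewrite nA in dA; rewrite nB in dB.
    rewrite exprMn !exprM dA dB -exprD dE -[LHS]/(Re _) ReX addnn -mul2n.
    by rewrite exprM.
  have de0 : 0 <= d ^+ e by rewrite exprn_ge0 // ltW.
  rewrite -(cconstE m e x).
  rewrite -[RHS](lint_scale _ x de0); last by move=> y; exact: cweight_ge0.
  apply: lint_ext => y _; rewrite /F; congr (_ * cweight e _)%E.
  by rewrite addrC addKr !mulmxA mulVmx // mul1mx mulmxK.
rewrite muleCA muleA muleC; congr (_ * _)%E.
by rewrite /weight asboolT // -/d -EFinM -exprD addnC.
Qed.

Lemma weight_lint k j e : exists2 c : R, 0 <= c & forall x,
  lint (crds (iota k j)) (fun y => weight (k + j) e (gam y)) x =
  (c%:E * weight k (e + 2 * p * j) (gam x))%E.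
Proof.
elim: j k => [|j IHj] k.
  by exists 1 => // x /=; rewrite addn0 muln0 addn0 mul1e.
have [c c0 cE] := IHj k.+1.
have cf : cconst k (e + 2 * p * j) \is a fin_num.
  by rewrite ge0_fin_numE ?cconst_fin ?cconst_ge0.
exists (c * fine (cconst k (e + 2 * p * j))); first by rewrite mulr_ge0 ?fine_ge0 ?cconst_ge0.
move=> x; rewrite -[iota k j.+1]/([:: k] ++ iota k.+1 j) crds_cat lint_cat.
rewrite (lint_ext (g := fun y => (c%:E * weight k.+1 (e + 2 * p * j) (gam y))%E)); last first.
  by move=> y _; rewrite -cE addSnnS.
rewrite lint_scale //; last by move=> y; exact: weight_ge0.
by rewrite weight_step EFinM fineK // muleA mulnS addnA addnAC.
Qed.

Definition PDset n : set (mseq R p n) := [set G | pd (toep (entry_or0 G) n.+1)].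
Definition PSDset n : set (mseq R p n) := [set G | psd (toep (entry_or0 G) n.+1)].

Lemma entry_mseq_of n (x : env) l : (l < n)%N -> entry_or0 (mseq_of x : mseq R p n) l = gam x l.
Proof. by move=> ln; rewrite /entry_or0 insubT. Qed.

Lemma first_coords_mseq_of n k (x : env) : (k <= n)%N ->
  first_coords k (mseq_of x : mseq R p n) = mseq_of x.
Proof.
move=> kn; apply/funext => l; rewrite /first_coords entry_mseq_of //.
exact: leq_trans kn.
Qed.

Lemma agree_mseq_of k j (x y : env) : agree (crds (iota k j)) x y ->
  mseq_of y = mseq_of x :> mseq R p k.
Proof.
move=> xy; apply/funext => l; apply/matrixP => a b; rewrite !mxE !xy //;
by rewrite mem_crds mem_iota leqNgt ltn_ord.
Qed.

Lemma weight0_PDset n (x : env) :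
  weight n 0 (gam x) = (`[< @PDset n (mseq_of x) >])%:R%:E.
Proof.
rewrite /weight /PDset /= (@pd_toep_step _ (gam x)); last by move=> l ln; exact: entry_mseq_of.
by rewrite expr0; case: asboolP.
Qed.

(** For e = 2p(n-k) and up to a factor independent of [A], this is the volume of the points of {T_n
    > 0} whose first k coordinates lie in [A]. *)
Definition kmass k e (A : set (mseq R p k)) : \bar R :=
  lint (crds (iota 0 k)) (fun x => ((`[< A (mseq_of x) >])%:R%:E * weight k e (gam x))%E) (fun=> 0).

Lemma lebesgue_first_coords k j : exists2 c : R, 0 <= c & forall A : set (mseq R p k),
  lebesgue_mseq [set G : mseq R p (k + j) | A (first_coords k G) /\ PDset G] =
  (c%:E * kmass (2 * p * j) A)%E.
Proof.
have [c c0 cE] := weight_lint k j 0; exists c => // A.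
rewrite (lebesgue_mseqE _ (fun=> 0)) iotaD add0n crds_cat lint_cat.
rewrite (lint_ext (g := fun x =>
  (c%:E * ((`[< A (mseq_of x) >])%:R%:E * weight k (2 * p * j) (gam x)))%E)); last first.
  move=> x _; case: (pselect (A (mseq_of x))) => Ax.
    rewrite asboolT // mul1e -[(2 * p * j)%N]add0n -cE; apply: lint_ext => y xy.
    rewrite weight0_PDset; congr ((nat_of_bool _)%:R%:E).
    apply: asbool_equiv_eq; split=> [[]//|Py]; split=> //.
    by rewrite first_coords_mseq_of ?leq_addr // (agree_mseq_of xy).
  rewrite asboolF // mul0e mule0 -[RHS](lint0 (crds (iota k j)) x).
  apply: lint_ext => y xy; rewrite asboolF // => -[].
  by rewrite first_coords_mseq_of ?leq_addr // (agree_mseq_of xy).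
rewrite lint_scale // => y; by rewrite mule_ge0 ?weight_ge0 // lee_fin.
Qed.

(** Gamma_0 = 1 is not scaled, so damping the other coefficients by t amounts to a combination with
    the identity. *)
Lemma toep_dilation (t : R) (g : nat -> 'M[C]_p) m :
  toep (fun l => t%:C%C *: g l) m = t%:C%C *: toep g m + ((1 - t)%:C%C)%:M.
Proof.
apply/matrixP => i j; rewrite !mxE /tker /tcoef.
have [it _] := @enumerates_tidx p m.
have ijE : (i == j) = (tidx m i == tidx m j) by rewrite inj_eq.
rewrite ijE -pair_eqE /= /pair_eq; case: eqP => [_|_] /=.
  by rewrite !mxE; case: eqP => _; rewrite ?mulr0 ?mulr1 ?addr0 // mulr1n rmorphB /= addrC subrK.
case: ifP => _; rewrite !mxE mulr0n addr0 //.
by rewrite rmorphM; congr (_ * _); rewrite /= conj_Creal // complex_real.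
Qed.

Lemma pd_toep_dilation (t : R) (g : nat -> 'M[C]_p) m : 0 < t < 1 ->
  psd (toep g m) -> pd (toep (fun l => t%:C%C *: g l) m).
Proof.
move=> /andP[t0 t1] pg; rewrite toep_dilation addrC -scalemx1.
apply: pdD_psd; first by apply: pdZ (pd1 _); rewrite ltcR subr_gt0.
by apply: psdZ => //; rewrite lecR ltW.
Qed.

(** The dilation by t < 1 carries [S] into {T_n > 0} and multiplies volumes by t to the power of the
    real dimension 2 n p^2. *)
Lemma lebesgue_dilation n (t : R) (S : set (mseq R p n)) : 0 < t < 1 -> S `<=` @PSDset n ->
  ((t ^+ (n * p * p * 2))%:E * lebesgue_mseq S <= lebesgue_mseq (@PDset n))%E.
Proof.
move=> t01 SP; have /andP[t0 _] := t01; pose Phi (x : env) : env := fun i => t * x i.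
rewrite (lebesgue_mseqE _ (fun=> 0)) (lebesgue_mseqE _ (Phi (fun=> 0))).
rewrite -(lint_triangular (a := fun=> t)) ?uniq_crds ?iota_uniq //; first 1 last.
- by move=> j js x y xy; rewrite /Phi xy.
- by elim: (crds _) => //= i s IHs; split=> //; exists (fun=> 0); split=> // x; rewrite addr0.
rewrite big_const_seq count_predT iter_mulr_1 size_crds size_iota.
rewrite lee_pmul2l ?lte_fin ?exprn_gt0 //; apply: lint_le => y //.
move=> _; rewrite lee_fin ler_nat; case: asboolP => // Sy.
rewrite asboolT // /PDset /=.
rewrite (@toep_ext _ _ _ (fun l => t%:C%C *: entry_or0 (mseq_of y : mseq R p n) l)).
  exact: pd_toep_dilation t01 (SP _ Sy).
move=> l ln; rewrite !entry_mseq_of //.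
by apply/matrixP => a b; rewrite !mxE /Phi /=; simpc.
Qed.

End Density.

(** * Topology of the space of matrix sequences *)

Section Topology.
Context {R : realType} {p n : nat}.
Local Notation C := R[i].
Implicit Types (G : mseq R p n) (A : set (mseq R p n)).

Lemma complex_gt0P (e : C) : 0 < e -> exists2 r : R, 0 < r & e = r%:C%C.
Proof. by move=> /gtc0_Re[eE e0]; exists (complex.Re e). Qed.

#[local] Instance mseq_nbhs_pfilter G : ProperFilter (nbhs G).
Proof. exact: nbhs_pfilter. Qed.

Lemma nbhs_mseqP G A : nbhs G A <->
  exists2 r : R, 0 < r & forall G', (forall l a b, `|G' l a b - G l a b| < r%:C%C) -> A G'.
Proof.
split; last first.
  move=> [r r0 rA]; have rC0 : 0 < r%:C%C :> C by rewrite ltcR.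
  have near_entry l a b : nbhs G [set G' : mseq R p n | `|G' l a b - G l a b| < r%:C%C].
    have cl : (fun G' : mseq R p n => G' l a b) @ G --> G l a b.
      apply: (@continuous_comp _ _ _ (proj l : mseq R p n -> 'M[C]_p) (fun M : 'M[C]_p => M a b)).
        exact: proj_continuous.
      exact: coord_continuous.
    apply: (cl [set z : C | `|z - G l a b| < r%:C%C]).
    apply/nbhs_ballP; exists (r%:C%C) => //= z; by rewrite -ball_normE /= distrC.
  have : nbhs G [set G' : mseq R p n | forall l a b, `|G' l a b - G l a b| < r%:C%C].
    have FG : Filter (nbhs G) by exact: nbhs_filter.
    apply: (filter_forall FG (f := fun l =>
      [set G' : mseq R p n | forall a b, `|G' l a b - G l a b| < r%:C%C])) => l.
    apply: (filter_forall FG (f := fun a =>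
      [set G' : mseq R p n | forall b, `|G' l a b - G l a b| < r%:C%C])) => a.
    exact: (filter_forall FG (near_entry l a)).
  exact: filterS.
(* The entrywise neighbourhoods form a filter; its convergence to [G] can be checked on each
   coordinate of the product, where the least of finitely many radii is taken. *)
move=> GA; pose F : set_system (mseq R p n) := [set B | exists2 r : R, 0 < r &
  forall G', (forall l a b, `|G' l a b - G l a b| < r%:C%C) -> B G'].
suff : F --> G by apply.
have FF : Filter F.
  split.
  - by exists 1.
  - move=> B B' [r r0 rB] [r' r'0 rB']; exists (Num.min r r'); first by rewrite lt_min r0.
    move=> G' h; split; [apply: rB|apply: rB'] => l a b; apply: lt_le_trans (h l a b) _;
      by rewrite lecR ge_min lexx ?orbT.
  - by move=> B B' BB' [r r0 rB]; exists r => // G' /rB/BB'.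
apply/cvg_sup => l B.
rewrite (@nbhsE (initial_topology (fun f : mseq R p n => f l))) => -[B' [oB' BG] OB].
have [V oV BE] := oB'; rewrite -{}BE /= in BG OB.
have : nbhs (G l) V by exact: open_nbhs_nbhs.
move=> [P GP PV].
have ex a b : exists r : R, 0 < r /\ forall z : C, `|z - G l a b| < r%:C%C -> P a b z.
  have /nbhs_ballP[e /= /complex_gt0P[r r0 ->] eP] := GP a b.
  by exists r; split=> // z; rewrite distrC => zr; apply: eP; rewrite -ball_normE.
pose r a b := projT1 (choice (ex a)) b.
have rP a b := projT2 (choice (ex a)) b; rewrite -/(r _ _) in rP.
exists (\big[Num.min/1]_a \big[Num.min/1]_b r a b).
  by apply/bigmin_gtP; split=> // a _; apply/bigmin_gtP; split=> // b _; case: (rP a b).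
move=> G' h; apply: OB => /=; apply: PV => a b; apply: (rP a b).2.
apply: lt_le_trans (h l a b) _; rewrite lecR.
by apply: (@bigmin_inf _ _ _ _ a) => //; exact: bigmin_le.
Qed.

(** Real and imaginary parts are kept apart, so that determinants and forms are handled by real sums
    and products, and closed half-lines can be pulled back. *)
Definition ccont (f : mseq R p n -> C) :=
  continuous (fun G => complex.Re (f G)) /\ continuous (fun G => complex.Im (f G)).

Lemma ccont_cst c : ccont (fun=> c).
Proof. by split=> G; exact: cst_continuous. Qed.

Lemma eq_continuous (h h' : mseq R p n -> R) : h =1 h' -> continuous h -> continuous h'.
Proof. by move=> /funext ->. Qed.

Lemma complex_ReM (z w : C) :
  complex.Re (z * w) = complex.Re z * complex.Re w - complex.Im z * complex.Im w.
Proof. by case: z; case: w. Qed.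

Lemma complex_ImM (z w : C) :
  complex.Im (z * w) = complex.Re z * complex.Im w + complex.Im z * complex.Re w.
Proof. by case: z => a b; case: w => c d /=. Qed.

Lemma ccontD f g : ccont f -> ccont g -> ccont (fun G => f G + g G).
Proof.
move=> [fr fi] [gr gi]; split.
  apply: (eq_continuous (fun G => esym (raddfD _ (f G) (g G)))) => G.
  by apply: cvgD; [exact: fr|exact: gr].
apply: (eq_continuous (fun G => esym (raddfD _ (f G) (g G)))) => G.
by apply: cvgD; [exact: fi|exact: gi].
Qed.

Lemma ccontM f g : ccont f -> ccont g -> ccont (fun G => f G * g G).
Proof.
move=> [fr fi] [gr gi]; split.
  apply: (eq_continuous (fun G => esym (complex_ReM (f G) (g G)))) => G.
  by apply: cvgB; apply: cvgM; [exact: fr|exact: gr|exact: fi|exact: gi].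
apply: (eq_continuous (fun G => esym (complex_ImM (f G) (g G)))) => G.
by apply: cvgD; apply: cvgM; [exact: fr|exact: gi|exact: fi|exact: gr].
Qed.

Lemma ccont_conj f : ccont f -> ccont (fun G => (f G)^*).
Proof.
move=> [fr fi]; split.
  by apply: eq_continuous fr => G; case: (f G).
apply: (@eq_continuous (fun G => - complex.Im (f G))) => [G|G]; first by case: (f G).
by apply: cvgN; exact: fi.
Qed.

Lemma eq_ccont f g : f =1 g -> ccont f -> ccont g.
Proof. by move=> /funext ->. Qed.

Lemma ccont_sum (J : Type) (s : seq J) (P : pred J) (f : J -> mseq R p n -> C) :
  (forall j, ccont (f j)) -> ccont (fun G => \sum_(j <- s | P j) f j G).
Proof.
move=> fc; elim: s => [|j s IHs].
  by apply: eq_ccont (ccont_cst 0) => G; rewrite big_nil.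
apply: (@eq_ccont (fun G => if P j then f j G + \sum_(j <- s | P j) f j G
   else \sum_(j <- s | P j) f j G)) => [G|]; first by rewrite big_cons.
by case: (P j) => //; exact: ccontD.
Qed.

Lemma ccont_prod (J : Type) (s : seq J) (P : pred J) (f : J -> mseq R p n -> C) :
  (forall j, ccont (f j)) -> ccont (fun G => \prod_(j <- s | P j) f j G).
Proof.
move=> fc; elim: s => [|j s IHs].
  by apply: eq_ccont (ccont_cst 1) => G; rewrite big_nil.
apply: (@eq_ccont (fun G => if P j then f j G * \prod_(j <- s | P j) f j G
   else \prod_(j <- s | P j) f j G)) => [G|]; first by rewrite big_cons.
by case: (P j) => //; exact: ccontM.
Qed.

Lemma ccont_det N (f : mseq R p n -> 'M[C]_N) :
  (forall i j, ccont (fun G => f G i j)) -> ccont (fun G => \det (f G)).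
Proof.
move=> fc; apply: ccont_sum => s; apply: ccontM; first exact: ccont_cst.
by apply: ccont_prod => i; exact: fc.
Qed.

Lemma part_entry_continuous l a b c : continuous (fun G : mseq R p n => part c (G l a b)).
Proof.
move=> G; apply/cvgrPdist_lt => e e0; apply/nbhs_mseqP; exists e => // G' h.
have := le_lt_trans (normc_part c _) (h l a b); rewrite ltcR distrC.
by rewrite /part; case: c; rewrite raddfB.
Qed.

Lemma ccont_entry l a b : ccont (fun G : mseq R p n => G l a b).
Proof.
by split; [apply: eq_continuous (part_entry_continuous (l := l) (a := a) (b := b) (c := false)) |
  apply: eq_continuous (part_entry_continuous (l := l) (a := a) (b := b) (c := true))].
Qed.

Lemma ccont_entry_or0 l a b : ccont (fun G : mseq R p n => entry_or0 G l a b).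
Proof.
rewrite /entry_or0; case: insubP => [j _ _|_] /=; first exact: ccont_entry.
by apply: eq_ccont (ccont_cst 0) => G; rewrite mxE.
Qed.

Lemma ccont_toep m i j : ccont (fun G : mseq R p n => toep (entry_or0 G) m i j).
Proof.
apply: (@eq_ccont (fun G => tker (entry_or0 G) (tidx m i) (tidx m j))) => [G|].
  by rewrite mxE.
rewrite /tker /tcoef; case: eqP => _; first exact: ccont_cst.
case: (_ < _)%N; first exact: ccont_entry_or0.
apply: (eq_ccont _ (ccont_conj (ccont_entry_or0 ((tidx m j).1 - (tidx m i).1).-1
  (tidx m j).2 (tidx m i).2))) => G.
by rewrite !mxE.
Qed.

Lemma ccont_qf N (f : mseq R p n -> 'M[C]_N) v :
  (forall i j, ccont (fun G => f G i j)) -> ccont (fun G => qf (f G) v).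
Proof.
move=> fc; apply: (eq_ccont (fun G => esym (qfE (f G) v))).
apply: ccont_sum => i; apply: ccont_sum => j.
apply: ccontM; last exact: ccont_cst.
by apply: ccontM; [exact: ccont_cst|exact: fc].
Qed.

Lemma closed_PSDset : closed (@PSDset R p n).
Proof.
have -> : @PSDset R p n = \bigcap_(v in setT)
    [set G : mseq R p n | 0 <= complex.Re (qf (toep (entry_or0 G) n.+1) v)].
  apply/seteqP; split=> [G [_ pG] v _|G h] /=.
    by have := pG v; rewrite lecE => /andP[].
  split; first exact: toep_adj.
  move=> v; have := h v I; have /complex_realP[r /= ->] := qf_real v (toep_adj (entry_or0 G) n.+1).
  by rewrite lecR.
apply: closed_bigI => v _.
have [cr _] := ccont_qf v (@ccont_toep n.+1).
apply: (@closed_comp _ _ (fun G : mseq R p n => complex.Re (qf (toep (entry_or0 G) n.+1) v)) [set x | 0 <= x]).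
  by move=> G _; exact: cr.
exact: closed_ge.
Qed.

Lemma nbhs_PDset G : PDset G -> nbhs G (@PDset R p n).
Proof.
move=> /pd_perturb[e /complex_gt0P[r r0 ->] eP]; apply/nbhs_mseqP; exists r => // G' h.
apply: eP => [|i j]; first exact: toep_adj.
rewrite !mxE /tker /tcoef; case: eqP => _; first by rewrite subrr normr0 lecR ltW.
have h' l a b : `|entry_or0 G' l a b - entry_or0 G l a b| <= r%:C%C.
  rewrite /entry_or0; case: insubP => [k _ _|_] /=; first exact/ltW/h.
  by rewrite !mxE subrr normr0 lecR ltW.
case: ifP => _ //; rewrite !mxE -rmorphB norm_conjC; exact: h'.
Qed.

Lemma open_PDset : open (@PDset R p n).
Proof. by rewrite openE => G /nbhs_PDset. Qed.

(** The box is the continuous image of a product of real segments, compact by Tychonoff. *)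
Lemma compact_box : compact [set G : mseq R p n | forall l a b c, `|part c (G l a b)| <= 1].
Proof.
pose J := Defs.coord p n; pose E := {ptws J -> R}.
pose Psi (x : E) : mseq R p n := fun l => \matrix_(a, b) Complex (x (l, a, b, false)) (x (l, a, b, true)).
have cPsi : continuous Psi.
  move=> x A /nbhs_mseqP[r r0 rA].
  have r20 : 0 < r / 2 by rewrite divr_gt0.
  have nx (j : J) : nbhs x [set y : E | `|y j - x j| < r / 2].
    have := @proj_continuous J (fun=> R) j x [set t | `|t - x j| < r / 2].
    apply; apply/nbhs_ballP; exists (r / 2) => //= t; by rewrite /ball /= distrC.
  have FX : Filter (nbhs x) by exact: nbhs_filter.
  have := filter_forall FX nx; apply: filterS => y yx; apply: rA => l a b.
  rewrite !mxE; set u := Complex _ _ - Complex _ _.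
  have uE : u = Complex (y (l, a, b, false) - x (l, a, b, false)) 0 +
      Complex 0 (y (l, a, b, true) - x (l, a, b, true)) by rewrite /u; simpc.
  rewrite uE; apply: le_lt_trans (ler_normD _ _) _.
  rewrite !normc_def /= !expr0n /= addr0 add0r !sqrtr_sqr -rmorphD ltcR [r]splitr.
  by apply: ltrD; exact: yx.
have -> : [set G : mseq R p n | forall l a b c, `|part c (G l a b)| <= 1] =
   Psi @` [set x : E | forall j : J, `[(-1)%R, 1%R]%classic (x j)].
  apply/seteqP; split=> [G h|_ [x h <-] l a b c] /=; last first.
    have := h (l, a, b, c); rewrite /= in_itv /= -ler_norml mxE.
    by case: c.
  exists (fun j : J => part j.2 (G j.1.1.1 j.1.1.2 j.1.2)).
    by move=> j /=; rewrite in_itv /= -ler_norml.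
  by apply/funext => l; apply/matrixP => a b; rewrite mxE /=; case: (G l a b).
apply: continuous_compact; first by apply: continuous_subspaceT.
apply: (@tychonoff J (fun=> R) (fun=> `[(-1)%R, 1%R]%classic)) => j.
exact: segment_compact.
Qed.

End Topology.

(** * Riemann sums for signed measures *)

Section RiemannSums.
Context {R : realType} {d : measure_display} {T : measurableType d}.
Context {J : finType} (ix : T -> J) (rep : J -> T).
Hypothesis mix : forall j, measurable (ix @^-1` [set j]).
Local Notation cell j := (ix @^-1` [set j]).

Lemma bounded_integrable (m : {finite_measure set T -> \bar R}) (f : T -> R) (B : R) :
  measurable_fun setT f -> (forall x, `|f x| <= B) -> m.-integrable setT (EFin \o f).
Proof.
move=> mf fB; apply: measurable_bounded_integrable => //.
  by rewrite -ge0_fin_numE //; exact: fin_num_measure.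
by exists B; split; [exact: num_real|move=> x Bx y _; apply: le_trans (fB y) (ltW Bx)].
Qed.

Lemma stepE (g : J -> R) z : g (ix z) = \sum_j g j * \1_(cell j) z.
Proof.
rewrite (bigD1 (ix z)) //= big1 ?addr0 => [|j jz].
  by rewrite indicE mem_set ?mulr1.
by rewrite indicE memNset ?mulr0 //= => /esym/eqP; apply/negP.
Qed.

Lemma measurable_step (g : J -> R) : measurable_fun setT (fun z => g (ix z)).
Proof.
rewrite (funext (stepE g)); apply: measurable_sum => j.
by apply: measurable_funM => //; exact: measurable_indic.
Qed.

Lemma Rintegral_step (m : {finite_measure set T -> \bar R}) (g : J -> R) :
  \int[m]_z g (ix z) = \sum_j g j * fine (m (cell j)).
Proof.
have ind j : m.-integrable setT (EFin \o \1_(cell j)).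
  apply: (@bounded_integrable _ _ 1); first exact: measurable_indic.
  by move=> x; rewrite indicE; case: (_ \in _); rewrite ?normr1 ?normr0.
have bi (s : seq J) : m.-integrable setT (EFin \o (fun z => \sum_(j <- s) g j * \1_(cell j) z)).
  apply: (@bounded_integrable _ _ (\sum_(j <- s) `|g j|)).
    by apply: measurable_sum => j; apply: measurable_funM => //; exact: measurable_indic.
  move=> x; apply: le_trans (ler_norm_sum _ _ _) _; apply: ler_sum => j _.
  rewrite normrM indicE; case: (_ \in _); first by rewrite normr1 mulr1.
  by rewrite normr0 mulr0.
have bi1 j : m.-integrable setT (EFin \o (fun z => g j * \1_(cell j) z)).
  by apply: eq_integrable (bi [:: j]) => // x _ /=; rewrite big_seq1.
have key (s : seq J) : \int[m]_z (\sum_(j <- s) g j * \1_(cell j) z) =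
    \sum_(j <- s) g j * fine (m (cell j)).
  elim: s => [|j s IHs].
    rewrite big_nil; under eq_Rintegral do rewrite big_nil.
    by rewrite Rintegral_cst // mul0r.
  under eq_Rintegral do rewrite big_cons.
  rewrite RintegralD // IHs big_cons RintegralZl //.
  by congr (_ * _ + _); rewrite /Rintegral integral_indic // setIT.
by rewrite -(key (index_enum J)); apply: eq_Rintegral => z _; exact: stepE.
Qed.

Lemma Rintegral_riemann (m : {finite_measure set T -> \bar R}) (f : T -> R) (B e : R) :
  measurable_fun setT f -> (forall x, `|f x| <= B) ->
  (forall z, `|f z - f (rep (ix z))| <= e) ->
  `|\int[m]_z f z - \sum_j f (rep j) * fine (m (cell j))| <= e * fine (m setT).
Proof.
move=> mf fB fe; rewrite -(Rintegral_step m (f \o rep)).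
have i1 := bounded_integrable m mf fB.
have i2 : m.-integrable setT (EFin \o (fun z => (f \o rep) (ix z))).
  by apply: (@bounded_integrable m _ B); [exact: measurable_step|move=> x; exact: fB].
rewrite -RintegralB //.
have i3 : m.-integrable setT (EFin \o (fun z => f z - (f \o rep) (ix z))).
  by have := integrableB _ i1 i2; apply.
apply: le_trans (le_normr_Rintegral _ i3) _ => //.
rewrite -Rintegral_cst //; apply: le_Rintegral => //.
- exact: integrable_norm.
- exact: (@bounded_integrable m _ `|e|).
Qed.

(** The total variation of [nu], which is the constant in the error of a Riemann sum. *)
Definition jordan_mass (nu : {charge set T -> \bar R}) : R :=
  fine (jordan_pos (hahn_pos_neg nu) setT) + fine (jordan_neg (hahn_pos_neg nu) setT).

Lemma charge_integral_riemann (nu : {charge set T -> \bar R}) (f : T -> R) (B e : R) :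
  measurable_fun setT f -> (forall x, `|f x| <= B) ->
  (forall z, `|f z - f (rep (ix z))| <= e) ->
  `|charge_integral nu f - \sum_j f (rep j) * fine (nu (cell j))| <= e * jordan_mass nu.
Proof.
move=> mf fB fe; rewrite /charge_integral /jordan_mass mulrDr.
set mp := jordan_pos _; set mn := jordan_neg _.
have nuE j : fine (nu (cell j)) = fine (mp (cell j)) - fine (mn (cell j)).
  rewrite (jordan_decomp (hahn_pos_neg nu)) // /cadd /= cscaleN1 fineB //; exact: fin_num_measure.
under eq_bigr do rewrite nuE mulrBr.
rewrite sumrB.
have -> (x y u v : R) : x - y - (u - v) = (x - u) - (y - v) by ring.
by apply: le_trans (ler_normB _ _) _; apply: lerD;
  [exact: (@Rintegral_riemann mp f B e)|exact: (@Rintegral_riemann mn f B e)].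
Qed.

Lemma charge_cells (nu : {charge set T -> \bar R}) :
  \sum_j fine (nu (cell j)) = fine (nu setT).
Proof.
have fm (m : {finite_measure set T -> \bar R}) : \sum_j fine (m (cell j)) = fine (m setT).
  have := Rintegral_step m (fun=> 1); rewrite Rintegral_cst // mul1r => ->.
  by apply: eq_bigr => j _; rewrite mul1r.
set mp := jordan_pos (hahn_pos_neg nu); set mn := jordan_neg (hahn_pos_neg nu).
have nuE A : measurable A -> fine (nu A) = fine (mp A) - fine (mn A).
  move=> mA; rewrite (jordan_decomp (hahn_pos_neg nu)) // /cadd /= cscaleN1 fineB //;
  exact: fin_num_measure.
by rewrite (eq_bigr _ (fun j _ => nuE _ (mix j))) sumrB nuE // -!fm.
Qed.

End RiemannSums.

(** * Small cells of the circle and approximation of moments *)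

Section CircleCells.
Context {R : realType}.
Local Notation C := R[i].
Local Notation T := (borel (circle R)).

Definition pt (z : T) : C := val (z : circle R).

Lemma norm_pt z : `|pt z| = 1.
Proof. by have := set_valP (z : circle R). Qed.

Lemma pt_continuous : continuous (pt : circle R -> C).
Proof. exact: initial_continuous. Qed.

Lemma continuous_circle_measurable (h : circle R -> R) :
  continuous h -> measurable_fun setT (h : T -> R).
Proof.
move=> /continuousP ch; apply: (measurability _ (RGenOpens.measurableE R)).
move=> /= _ [_ [x [y ->] <-]]; rewrite setTI.
by apply: sub_sigma_algebra; apply: ch; exact: itv_open.
Qed.

Lemma norm_real (x : R) : `|x%:C%C| = `|x|%:C%C :> C.
Proof. by rewrite normc_def /= expr0n addr0 sqrtr_sqr. Qed.

Lemma norm_part_le (z : C) :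
  `|z| <= (`|part false z| + `|part true z|)%:C%C.
Proof.
case: z => a b; have E : Complex a b = Complex a 0 + Complex 0 b by simpc.
rewrite [X in `|X| <= _]E; apply: le_trans (ler_normD _ _) _.
by rewrite !normc_def /= !expr0n /= addr0 add0r !sqrtr_sqr -rmorphD.
Qed.

Lemma partB c (z w : C) : part c (z - w) = part c z - part c w.
Proof. by case: c; rewrite /part raddfB. Qed.

Lemma norm_partB_le c (z w : C) (e : R) : `|z - w| <= e%:C%C -> `|part c z - part c w| <= e.
Proof. by rewrite -partB => h; rewrite -lecR; exact: le_trans (normc_part c _) h. Qed.

Lemma norm_part_exp_pt c j z : `|part c (pt z ^+ j)| <= 1.
Proof.
by rewrite -lecR; apply: le_trans (normc_part c _) _; rewrite normrX norm_pt expr1n.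
Qed.

Lemma exp_pt_lipschitz j (z w : T) : `|pt z ^+ j - pt w ^+ j| <= j%:R * `|pt z - pt w|.
Proof.
elim: j => [|j IHj]; first by rewrite !expr0 subrr normr0 mul0r.
have -> : pt z ^+ j.+1 - pt w ^+ j.+1 =
    pt z * (pt z ^+ j - pt w ^+ j) + (pt z - pt w) * pt w ^+ j by rewrite !exprS; ring.
apply: le_trans (ler_normD _ _) _; rewrite !normrM normrX !norm_pt expr1n mul1r mulr1.
by rewrite -natr1 mulrDl mul1r lerD2r.
Qed.

Lemma part_exp_pt_continuous c j : continuous (fun z : circle R => part c (pt z ^+ j)).
Proof.
move=> z; have FZ : Filter (nbhs z) by exact: nbhs_filter.
apply: (@cvgrPdist_lt _ _ _ _ FZ _ _).2 => e e0.
have j0 : 0 < (j.+1%:R : R) by [].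
have e'0 : 0 < (e / j.+1%:R)%:C%C :> C by rewrite ltcR divr_gt0.
have : nbhs z [set w : circle R | `|pt w - pt z| < (e / j.+1%:R)%:C%C].
  have := @pt_continuous z [set u : C | `|u - pt z| < (e / j.+1%:R)%:C%C]; apply.
  by apply/nbhs_ballP; exists ((e / j.+1%:R)%:C%C) => //= u; rewrite -ball_normE /= distrC.
apply: (@filterS _ (nbhs z) FZ) => w /= wz; rewrite -partB -ltcR; apply: le_lt_trans (normc_part c _) _.
apply: le_lt_trans (exp_pt_lipschitz _ _ _) _; rewrite distrC.
have [->|j1] := posnP j; first by rewrite mul0r ltcR.
have : j%:R * `|pt w - pt z| < j%:R * (e / j.+1%:R)%:C%C by rewrite ltr_pM2l // ltr0n.
move=> /lt_trans; apply; rewrite -(rmorph_nat (real_complex R)) -rmorphM ltcR.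
by rewrite mulrCA gtr_pMr // ltr_pdivrMr // mul1r ltr_nat.
Qed.

Lemma measurable_part_exp_pt c j : measurable_fun setT (fun z : T => part c (pt z ^+ j)).
Proof. exact: continuous_circle_measurable (@part_exp_pt_continuous c j). Qed.

Definition is_mesh (e : R) (J : finType) (ix : T -> J) (rep : J -> T) :=
  (forall j, measurable (ix @^-1` [set j])) /\
  forall z, `|pt z - pt (rep (ix z))| <= e%:C%C.

Lemma circle_cells (e : R) : 0 < e ->
  exists J : finType, exists ix : T -> J, exists rep : J -> T, is_mesh e ix rep.
Proof.
(* A square grid of mesh 1/N < e/2: on a cell the real and the imaginary part each vary by at most
   e/2. *)
move=> e0; pose N := (Num.truncn (2 / e)).+1.
have Ne : 2 / e < N%:R by have := truncn_itv (ltW (divr_gt0 (ltr0n R 2) e0)) => /andP[].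
have N0 : 0 < N%:R :> R by [].
(* [h c] rescales a coordinate from [-1, 1] to [0, 2N]; its integer part, at most 2N, numbers the
   cell. *)
pose h c (z : T) : R := N%:R * (part c (pt z ^+ 1) + 1).
have h_itv c z : 0 <= h c z <= 2 * N%:R.
  have := norm_part_exp_pt c 1 z; rewrite ler_norml => /andP[h1 h2].
  rewrite /h mulr_ge0 ?ler0n //= ?[2 * _]mulrC ?ler_pM2l //; lra.
have hlt c z : (Num.truncn (h c z) < (2 * N).+1)%N.
  have /andP[h0 h2] := h_itv c z; rewrite truncn_lt_nat //.
  by apply: le_lt_trans h2 _; rewrite -natrM ltr_nat.
pose J : finType := ('I_(2 * N).+1 * 'I_(2 * N).+1)%type.
pose ix (z : T) : J := (Ordinal (hlt false z), Ordinal (hlt true z)).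
(* An empty cell receives the default point, which is harmless: [rep] is compared with z only on the
   cell of z. *)
exists J, ix, (fun j => xget (circle_point R) [set z | ix z = j]); split=> [[i j]|z].
  have -> : ix @^-1` [set (i, j)] = (h false @^-1` `[(i : nat)%:R, (i : nat).+1%:R[%classic) `&`
      (h true @^-1` `[(j : nat)%:R, (j : nat).+1%:R[%classic).
    apply/seteqP; split=> z /=; rewrite !in_itv /=.
      move=> [<- <-] /=.
      have /andP[z0 _] := h_itv false z; have /andP[z1 _] := h_itv true z.
      by split; exact: truncn_itv.
    move=> [/truncn_def hi /truncn_def hj]; congr pair; exact: val_inj.
  have mh c : measurable_fun setT (h c).
    apply: measurable_funM; first exact: measurable_cst.
    apply: measurable_funD; last exact: measurable_cst.
    exact: measurable_part_exp_pt.
  by apply: measurableI; rewrite -[X in measurable X]setTI; apply: mh.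
set w := xget _ _; have : ix w = ix z by apply: (@xgetPex _ (circle_point R) [set w | ix w = ix z]); exists z.
move=> [/esym E1 /esym E2]; apply: le_trans (norm_part_le _) _; rewrite lecR !partB.
have close c : Num.truncn (h c z) = Num.truncn (h c w) ->
    `|part c (pt z) - part c (pt w)| <= e / 2.
  have /andP[z0 _] := h_itv c z; have /andP[w0 _] := h_itv c w.
  have := truncn_itv z0; have := truncn_itv w0 => /[swap] + /[swap] E; rewrite {}E /h !expr1.
  rewrite -natr1; set t := (Num.truncn _)%:R => /andP[a1 a2] /andP[b1 b2].
  have Ne' : 1 < N%:R * (e / 2).
    by rewrite mulrA ltr_pdivlMr // mul1r -ltr_pdivrMr.
  rewrite -(ler_pM2l N0); apply: le_trans (ltW Ne').
  rewrite -[X in X * _](gtr0_norm N0) -normrM ler_norml; apply/andP; split; lra.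
by rewrite [leRHS]splitr; apply: lerD; exact: close.
Qed.

Lemma charge_integral_part_exp (nu : {charge set T -> \bar R}) c j
    (e : R) (J : finType) (ix : T -> J) (rep : J -> T) : is_mesh e ix rep ->
  `|charge_integral nu (fun z => part c (pt z ^+ j))
    - \sum_i part c (pt (rep i) ^+ j) * fine (nu (ix @^-1` [set i]))|
  <= j%:R * e * jordan_mass nu.
Proof.
move=> [mix me]; apply: (@charge_integral_riemann _ _ _ J ix rep mix nu _ 1).
- exact: measurable_part_exp_pt.
- exact: norm_part_exp_pt.
move=> z; apply: norm_partB_le; apply: le_trans (exp_pt_lipschitz _ _ _) _.
by rewrite rmorphM rmorph_nat ler_wpM2l // ler0n.
Qed.

Lemma moment_riemann p (mu : matrix_charge R p) j : exists2 K : R, 0 <= K &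
  forall a b (e : R) (J : finType) (ix : T -> J) (rep : J -> T), is_mesh e ix rep ->
  `|moment mu j a b - \sum_i pt (rep i) ^+ j * matrix_charge_val mu (ix @^-1` [set i]) a b|
  <= (e * K)%:C%C.
Proof.
pose jm a b := jordan_mass (re_part mu a b) + jordan_mass (im_part mu a b).
have m0 (nu : {charge set T -> \bar R}) : 0 <= jordan_mass nu by apply: addr_ge0; exact: fine_ge0.
have jm0 a b : 0 <= jm a b by rewrite addr_ge0.
(* The real and the imaginary part of an entry each involve both charges, with error j e times their
   variations. Summing over all entries gives a constant that serves every (a, b). *)
exists (\sum_a \sum_b 2 * j%:R * jm a b).
  by apply: sumr_ge0 => a _; apply: sumr_ge0 => b _; rewrite !mulr_ge0 ?ler0n ?jm0.
move=> a b e J ix rep me.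
have e0 : 0 <= e.
  by rewrite -lecR; apply: le_trans (me.2 (circle_point R)); rewrite normr_ge0.
have bound c c' := (charge_integral_part_exp (re_part mu a b) c j me,
                    charge_integral_part_exp (im_part mu a b) c' j me).
have SE : \sum_i pt (rep i) ^+ j * matrix_charge_val mu (ix @^-1` [set i]) a b = Complex
    (\sum_i part false (pt (rep i) ^+ j) * fine (re_part mu a b (ix @^-1` [set i])) -
     \sum_i part true (pt (rep i) ^+ j) * fine (im_part mu a b (ix @^-1` [set i])))
    (\sum_i part true (pt (rep i) ^+ j) * fine (re_part mu a b (ix @^-1` [set i])) +
     \sum_i part false (pt (rep i) ^+ j) * fine (im_part mu a b (ix @^-1` [set i]))).
  rewrite -sumrB -big_split /=; apply/eqP; rewrite eq_complex; apply/andP; split; apply/eqP.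
    rewrite (raddf_sum (@complex.Re R)); apply: eq_bigr => i _.
    by rewrite mxE [LHS]complex_ReM.
  rewrite (raddf_sum (@complex.Im R)); apply: eq_bigr => i _.
  by rewrite mxE [LHS]complex_ImM addrC.
rewrite SE mxE; have [b1 b2] := bound false true; have [b3 b4] := bound true false.
apply: le_trans (norm_part_le _) _; rewrite lecR.
have tri (x y u v : R) : `|x + y - (u + v)| <= `|x - u| + `|y - v|.
  by apply: le_trans (ler_normD _ _); rewrite opprD addrACA.
have tri' (x y u v : R) : `|x - y - (u - v)| <= `|x - u| + `|y - v|.
  by apply: le_trans (ler_normB _ _); rewrite (_ : x - y - (u - v) = (x - u) - (y - v)) //; ring.
apply: (@le_trans _ _ (2 * j%:R * e * jm a b)).
  have -> : 2 * j%:R * e * jm a b = (j%:R * e * jordan_mass (re_part mu a b) +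
      j%:R * e * jordan_mass (im_part mu a b)) + (j%:R * e * jordan_mass (re_part mu a b) +
      j%:R * e * jordan_mass (im_part mu a b)) by rewrite /jm; ring.
  apply: lerD; first exact: le_trans (tri' _ _ _ _) (lerD b1 b2).
  exact: le_trans (tri _ _ _ _) (lerD b3 b4).
rewrite mulrAC [leRHS]mulrC ler_wpM2r // (bigD1 a) //= (bigD1 b) //= -addrA lerDl.
by rewrite addr_ge0 // sumr_ge0 // => *; rewrite ?sumr_ge0 // => *; rewrite !mulr_ge0 ?ler0n ?jm0.
Qed.

End CircleCells.

(** * Moment sequences have nonnegative Toeplitz matrices *)

Section MomentsPSD.
Context {R : realType} {p : nat}.
Local Notation C := R[i].
Local Notation T := (borel (circle R)).

Lemma psd_sum (J : Type) (s : seq J) N (A : J -> 'M[C]_N) :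
  (forall j, psd (A j)) -> psd (\sum_(j <- s) A j).
Proof.
move=> pA; elim: s => [|j s [h1 h2]].
  rewrite big_nil; split; first exact: adj0.
  by move=> v; rewrite /qf mulmx0 mul0mx mxE.
rewrite big_cons; have [h3 h4] := pA j; split; first by rewrite adjD h1 h3.
by move=> v; rewrite qfD addr_ge0.
Qed.

Lemma nonneg_hermitianE (A : 'M[C]_p) : nonneg_hermitian A <-> psd A.
Proof.
split=> -[hA pA]; split=> // v; first by have := pA (v^t*); rewrite trmxCK.
by have := pA (v^t*); rewrite /qf trmxCK.
Qed.

(** The Toeplitz kernel of the discrete measure that places the mass of each cell at its
    representative. *)
Definition cell_kernel (mu : matrix_charge R p) (J : finType) (ix : T -> J) (rep : J -> T)
    (x y : nat * 'I_p) : C :=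
  \sum_c pt (rep c) ^+ x.1 * matrix_charge_val mu (ix @^-1` [set c]) x.2 y.2 *
         (pt (rep c) ^+ y.1)^*.

Lemma psd_cell_kernel mu (J : finType) (ix : T -> J) rep N (e : 'I_N -> nat * 'I_p) :
  (forall c, psd (matrix_charge_val mu (ix @^-1` [set c]))) ->
  psd (kmx (cell_kernel mu ix rep) e).
Proof.
move=> pmu; pose X c : 'M[C]_(N, p) := \matrix_(i, a) (pt (rep c) ^+ (e i).1 *+ ((e i).2 == a)).
have -> : kmx (cell_kernel mu ix rep) e =
    \sum_c X c *m matrix_charge_val mu (ix @^-1` [set c]) *m (X c)^t*.
  apply/matrixP => i j; rewrite summxE mxE; apply: eq_bigr => c _.
  rewrite [RHS]mxE (bigD1 (e j).2) //= [X in _ = _ + X]big1 ?addr0; last first.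
    by move=> b bj; rewrite !mxE eq_sym (negPf bj) mulr0n conjC0 mulr0.
  rewrite [X in _ = X * _]mxE (bigD1 (e i).2) //= [X in _ = (_ + X) * _]big1 ?addr0; last first.
    by move=> b bj; rewrite !mxE eq_sym (negPf bj) mulr0n mul0r.
  by rewrite !mxE !eqxx !mulr1n.
by apply: psd_sum => c; exact: psd_congr.
Qed.

Lemma conj_pt (z : T) : pt z * (pt z)^* = 1.
Proof. by rewrite -normCK norm_pt expr1n. Qed.

Lemma cell_kernel_shift mu (J : finType) (ix : T -> J) rep i j a b :
  cell_kernel mu ix rep ((i + j)%N, a) (j, b) =
  \sum_c pt (rep c) ^+ i * matrix_charge_val mu (ix @^-1` [set c]) a b.
Proof.
apply: eq_bigr => c _ /=; rewrite exprD rmorphXn /= mulrAC -!mulrA; congr (_ * _).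
by rewrite mulrA -exprMn conj_pt expr1n mul1r.
Qed.

Lemma cell_kernel_adj mu (J : finType) (ix : T -> J) rep x y :
  (forall c, psd (matrix_charge_val mu (ix @^-1` [set c]))) ->
  (cell_kernel mu ix rep x y)^* = cell_kernel mu ix rep y x.
Proof.
move=> pmu; rewrite rmorph_sum; apply: eq_bigr => c _ /=.
rewrite !rmorphM /= conjCK mulrC [_ * (matrix_charge_val _ _ _ _)^*]mulrC mulrA.
congr (_ * _ * _); have [/matrixP/(_ y.2 x.2) <- _] := pmu c.
by rewrite [RHS]mxE [in RHS]mxE.
Qed.

(** The form of T_n differs by at most a multiple of the mesh from that of the kernel matrix [S],
    which is nonnegative as a sum of congruences of the cell masses. *)
Lemma moment_space_PSD n : moment_space R p n `<=` @PSDset R p n.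
Proof.
move=> G [mu [[pmu mu1] Gmu]]; split; first exact: toep_adj.
set g := entry_or0 G.
have gE l : (l < n)%N -> g l = moment mu l.+1.
  by move=> ln; rewrite /g /entry_or0 insubT /= Gmu.
pose K j := s2val (cid2 (moment_riemann mu j)).
have K0 j : 0 <= K j := s2valP (cid2 (moment_riemann mu j)).
have KP j := s2valP' (cid2 (moment_riemann mu j)); rewrite -/(K _) in KP.
pose M := \sum_(j < n.+1) K j.
have KM j : (j < n.+1)%N -> K j <= M.
  move=> jn; rewrite /M (bigD1 (Ordinal jn)) //= lerDl; exact: sumr_ge0.
have M0 : 0 <= M by exact: sumr_ge0.
move=> v; have rq := qf_real v (toep_adj g n.+1).
have /complex_realP[r rE] := rq; rewrite rE lecR.
pose D := M * (@tsz p n.+1)%:R * complex.Re (qf 1%:M v).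
have q1 : 0 <= qf 1%:M v by exact: (pd_psd (pd1 _)).2.
have D0 : 0 <= D.
  by rewrite !mulr_ge0 ?ler0n //; move: q1; rewrite lecE => /andP[].
(* If r were negative, e = -r/(D+1) would contradict the bound. *)
suff key (e : R) : 0 < e -> - r <= e * D.
  rewrite leNgt; apply/negP => r0; have D1 : 0 < D + 1 by rewrite ltr_wpDl.
  have := key (- r / (D + 1)) _; rewrite divr_gt0 ?oppr_gt0 // => /(_ isT).
  rewrite mulrAC ler_pdivlMr // ler_pM2l ?oppr_gt0 //; lra.
move=> e0; have [J [ix [rep me]]] := circle_cells e0.
have pc c : psd (matrix_charge_val mu (ix @^-1` [set c])).
  by apply/nonneg_hermitianE; apply: pmu; exact: me.1.
pose S := kmx (cell_kernel mu ix rep) (@tidx p n.+1).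
have [_ pS] : psd S by exact: psd_cell_kernel.
(* Below the diagonal the entries are Riemann sums of moments; on the diagonal blocks the agreement
   is exact, because [mu] has total mass 1. The entries above follow by conjugation. *)
have lower x y : (y.1 <= x.1 < n.+1)%N ->
    `|tker g x y - cell_kernel mu ix rep x y| <= (e * M)%:C%C.
  case: x y => [i a] [j b] /= /andP[ji jn]; rewrite -{2}(subnK ji) cell_kernel_shift.
  rewrite /tker /tcoef /=; move: ji; rewrite leq_eqVlt => /predU1P[->|ji].
    rewrite eqxx subnn -mu1.
    have -> : \sum_c pt (rep c) ^+ 0 * matrix_charge_val mu (ix @^-1` [set c]) a b =
        matrix_charge_val mu setT a b.
      rewrite mxE; apply/eqP; rewrite eq_complex; apply/andP; split; apply/eqP;
      [rewrite (raddf_sum (@complex.Re R)) /= -(charge_cells me.1)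
      |rewrite (raddf_sum (@complex.Im R)) /= -(charge_cells me.1)];
      apply: eq_bigr => c _; rewrite expr0 mul1r mxE //.
    by rewrite subrr normr0 lecR mulr_ge0 // ltW.
  rewrite gtn_eqF // ji gE; last by rewrite prednK ?subn_gt0 // (leq_trans (leq_subr _ _)).
  rewrite prednK ?subn_gt0 //; have h := KP (i - j)%N a b e J ix rep me.
  apply: le_trans h _; rewrite lecR ler_pM2l // KM //.
  exact: leq_ltn_trans (leq_subr _ _) jn.
have close i j : `|(S - toep g n.+1) i j| <= (e * M)%:C%C.
  rewrite !mxE distrC; have [ij|/ltnW ij] := leqP (tidx n.+1 j).1 (tidx n.+1 i).1.
    by apply: lower; apply/andP; split; [exact: ij|exact: (@tidx_lt _ n.+1)].
  rewrite -norm_conjC rmorphB /= tker_adj cell_kernel_adj //.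
  by apply: lower; apply/andP; split; [exact: ij|exact: (@tidx_lt _ n.+1)].
have eM : 0 <= (e * M)%:C%C :> C by rewrite lecR mulr_ge0 // ltW.
have := qf_norm_le v eM close; rewrite qfD qfN rE.
have /complex_realP[s sE] : qf S v \is Num.real by apply: qf_real; case: (psd_cell_kernel rep (@tidx p n.+1) pc).
have s0 : 0 <= s by have := pS v; rewrite sE lecR.
have [qE _] : qf 1%:M v = (complex.Re (qf 1%:M v))%:C%C /\ True.
  by split=> //; have /complex_realP[t ->] := ger0_real q1.
rewrite sE qE -rmorphB norm_real -(rmorph_nat (real_complex R)) -!rmorphM lecR.
move=> h; have : s - r <= e * D.
  by apply: le_trans (ler_norm _) (le_trans h _); rewrite /D !mulrA.
lra.
Qed.

End MomentsPSD.

(** * Realising a definite Toeplitz matrix by a unitary matrix *)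

Section Realization.
Context {C : numClosedFieldType} {p : nat}.
Local Notation J := (nat * 'I_p)%type.

Lemma unitary_diag n (U : 'M[C]_n) : U \is unitarymx ->
  exists S : 'M[C]_n, exists D : 'rV[C]_n,
    [/\ S \is unitarymx, U = S^t* *m diag_mx D *m S & (forall i, `|D 0 i| = 1)].
Proof.
move=> uU; have nU : U \is normalmx.
  apply/normalmxP; rewrite (unitarymxP uU).
  by move: uU; rewrite -trmxC_unitary => /unitarymxP; rewrite trmxCK => ->.
have uS := spectral_unitarymx U; have UE := orthomx_spectralP nU.
rewrite (invmx_unitary uS) in UE; exists (spectralmx U), (spectral_diag U); split=> // i.
set S := spectralmx U in uS UE; set D := spectral_diag U in UE *.
have DE : S *m U *m S^t* = diag_mx D.
  by rewrite UE !mulmxA (unitarymxP uS) mul1mx -mulmxA (unitarymxP uS) mulmx1.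
have : diag_mx D *m (diag_mx D)^t* = 1%:M.
  rewrite -DE !adjM trmxCK !mulmxA.
  rewrite -[S *m U *m S^t* *m S]mulmxA.
  have -> : S^t* *m S = 1%:M.
    by move: uS; rewrite -trmxC_unitary => /unitarymxP; rewrite trmxCK.
  by rewrite mulmx1 -[S *m U *m _]mulmxA (unitarymxP uU) mulmx1 (unitarymxP uS).
move=> /matrixP/(_ i i); rewrite mul_diag_mx !mxE eqxx /= !mulr1n -normCK.
by move=> /eqP; rewrite sqrp_eq1 // => /eqP.
Qed.

(** With V_i the block rows of the Cholesky factor, V_(i+1) = V_i U gives Gamma_i = V_0 U^i V_0^*,
    and diagonalising U turns this into a sum over its eigenvalues. *)
Lemma toep_realize (g : nat -> 'M[C]_p) n : pd (toep g n.+1) ->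
  exists N, exists Y : 'M[C]_(p, N), exists D : 'rV[C]_N,
    (forall s, `|D 0 s| = 1) /\ forall i a b, (i <= n)%N ->
      tker g (i, a) (0%N, b) = \sum_s D 0 s ^+ i * (Y a s * (Y b s)^*).
Proof.
move=> pT; pose e := fcat (tidx n) (@pair nat 'I_p n).
have en : enumerates e (fun l => (l < n.+1)%N) := enumerates_back n.
have [_ pK _] := kmx_enumerates (tker g) en (enumerates_tidx n.+1).
have [L [_ _ LE]] := cholesky (pK.2 pT).
(* [F] finds the row of an index in the listing [e]; for block indices beyond n its value is
   arbitrary. *)
have [F FE] : exists F : J -> 'I_(tsz n + p), forall x, (x.1 < n.+1)%N -> e (F x) = x.
  have ex (x : J) : exists k, (x.1 < n.+1)%N ==> (e k == x).
    case: ltnP => [xn|_]; first by have /en.2[k ->] := xn; exists k; rewrite eqxx.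
    by have /(en.2 (0%N, x.2))[k _] := ltn0Sn n; exists k.
  exists (fun x => xchoose (ex x)) => x xn; apply/eqP.
  by have /implyP/(_ xn) := xchooseP (ex x).
have kE x y : (x.1 < n.+1)%N -> (y.1 < n.+1)%N ->
    tker g x y = \sum_j L (F x) j * (L (F y) j)^*.
  move=> xn yn; have /matrixP/(_ (F x) (F y)) := LE; rewrite !mxE !FE // => ->.
  by apply: eq_bigr => j _; rewrite !mxE.
(* Block rows 0, ..., n-1 and 1, ..., n of the factor; by shift invariance they have the same Gram
   matrix. *)
pose A : 'M[C]_(tsz n, tsz n + p) := \matrix_(k, j) L (F (tidx n k)) j.
pose B : 'M[C]_(tsz n, tsz n + p) := \matrix_(k, j) L (F (shift (tidx n k))) j.
have lt k : ((tidx (p := p) n k).1 < n)%N by exact: tidx_lt.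
have AA : A *m A^t* = toep g n.
  apply/matrixP => i j; rewrite [RHS]mxE kE; try exact: ltn_trans (lt _) _.
  by rewrite mxE; apply: eq_bigr => k _; rewrite !mxE.
have BB : B *m B^t* = toep g n.
  rewrite /toep -kmx_shift; apply/matrixP => i j; rewrite [RHS]mxE kE; try exact: (lt _).
  by rewrite mxE; apply: eq_bigr => k _; rewrite !mxE.
have fA : row_free A by apply: row_free_gram; rewrite AA; exact: pd_toepS.
have [U uU AU] := unitary_extension fA (etrans AA (esym BB)).
have [S [D [uS UE D1]]] := unitary_diag uU.
pose V i : 'M[C]_(p, tsz n + p) := \matrix_(a, j) L (F (i, a)) j.
have VS i : (i < n)%N -> V i.+1 = V i *m U.
  move=> i_n; apply/matrixP => a j.
  have [k kia] : exists k, (i, a) = tidx n k by apply/(enumerates_tidx n).2.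
  have /matrixP/(_ k j) := AU; rewrite !mxE -kia /shift /= => <-.
  by apply: eq_bigr => j' _; rewrite !mxE -kia.
(* V_0 in the eigenbasis of U: the atom at the eigenvalue D_s carries the rank one mass formed from
   column s of [Y]. *)
pose Y := V 0%N *m S^t*.
have VY i : (i <= n)%N -> forall a s, (V i *m S^t*) a s = D 0 s ^+ i * Y a s.
  elim: i => [|i IHi] i_n a s; first by rewrite expr0 mul1r.
  rewrite VS // UE !mulmxA -[_ *m S *m S^t*]mulmxA (unitarymxP uS) mulmx1.
  by rewrite mul_mx_diag mxE IHi 1?ltnW // exprS mulrC mulrA.
exists (tsz n + p)%N, Y, D; split=> // i a b i_n.
rewrite kE //; transitivity ((V i *m (V 0%N)^t*) a b).
  by rewrite mxE; apply: eq_bigr => j _; rewrite !mxE.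
have -> : V i *m (V 0%N)^t* = (V i *m S^t*) *m Y^t*.
  rewrite /Y adjM trmxCK mulmxA -[V i *m _ *m S]mulmxA.
  have -> : S^t* *m S = 1%:M.
    by move: uS; rewrite -trmxC_unitary => /unitarymxP; rewrite trmxCK.
  by rewrite mulmx1.
by rewrite mxE; apply: eq_bigr => s _; rewrite VY // !mxE mulrA.
Qed.

End Realization.

(** * Definite sequences are moments of finitely supported measures *)

Section Atomic.
Context {R : realType} {p : nat}.
Local Notation C := R[i].
Local Notation T := (borel (circle R)).

Lemma atomic_charge N (z : 'I_N -> T) (c : 'I_N -> R) :
  exists nu : {charge set T -> \bar R}, forall A,
    nu A = (\sum_s c s * (z s \in A)%:R)%:E.
Proof.
suff [nu nuE] : exists nu : {charge set T -> \bar R}, forall A,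
    nu A = (\sum_(s <- index_enum 'I_N) c s * (z s \in A)%:R)%:E by exists nu.
elim: (index_enum _) => [|s l [nu nuE]].
  by exists (czero : {charge set T -> \bar R}) => A; rewrite big_nil.
exists (cadd (cscale (c s) (charge_of_finite_measure (\d_(z s) : {finite_measure set T -> \bar R}))) nu) => A.
by rewrite big_cons EFinD -nuE EFinM.
Qed.

Lemma circle_of (w : C) : `|w| = 1 -> exists z : T, pt z = w.
Proof.
by move=> w1; exists (SigSub (mem_set (w1 : [set z : C | `|z| = 1] w)) : circle R).
Qed.

(** The realisation supplies atoms and masses. Since [moment] integrates along a chosen Hahn
    decomposition, its agreement with the finite sum over atoms is obtained by comparing both with
    Riemann sums over ever finer cells. *)
Lemma PD_moment_space n : @PDset R p n `<=` moment_space R p n.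
Proof.
move=> G pG; have [N [Y [D [D1 YD]]]] := toep_realize pG.
set g := entry_or0 G in YD pG.
have [z zD] : exists z : 'I_N -> T, forall s, pt (z s) = D 0 s.
  by have [z zP] := choice (fun s => circle_of (D1 s)); exists z.
pose c a b s : C := Y a s * (Y b s)^*.
pose nur a b := sval (cid (atomic_charge z (fun s => complex.Re (c a b s)))).
pose nui a b := sval (cid (atomic_charge z (fun s => complex.Im (c a b s)))).
have nurE a b A : nur a b A = _ := svalP (cid (atomic_charge z (fun s => complex.Re (c a b s)))) A.
have nuiE a b A : nui a b A = _ := svalP (cid (atomic_charge z (fun s => complex.Im (c a b s)))) A.
pose mu := MatrixCharge nur nui.
have muE A a b : matrix_charge_val mu A a b = \sum_s c a b s * (z s \in A)%:R.
  rewrite mxE /= nurE nuiE /=; apply/eqP; rewrite eq_complex; apply/andP; split; apply/eqP.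
    rewrite /= (raddf_sum (@complex.Re R)); apply: eq_bigr => s _.
    by case: (_ \in _); rewrite ?mulr1 ?mulr0.
  rewrite /= (raddf_sum (@complex.Im R)); apply: eq_bigr => s _.
  by case: (_ \in _); rewrite ?mulr1 ?mulr0.
exists mu; split; [split=> [A mA|]|].
- apply/nonneg_hermitianE; pose X : 'M[C]_(p, N) := \matrix_(a, s) (Y a s * (z s \in A)%:R).
  suff -> : matrix_charge_val mu A = X *m X^t* by exact: psd_gram.
  apply/matrixP => a b; rewrite muE mxE; apply: eq_bigr => s _; rewrite !mxE /c.
  by case: (_ \in _); rewrite ?mulr1 // !mulr0 mul0r.
- apply/matrixP => a b; rewrite muE; have := YD 0%N a b isT.
  rewrite /tker /tcoef eqxx /= => ->; apply: eq_bigr => s _.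
  by rewrite in_setT mulr1 expr0 mul1r.
move=> l; apply/matrixP => a b.
have -> : G l a b = \sum_s D 0 s ^+ l.+1 * c a b s.
  rewrite -YD // /tker /tcoef /= ?subn0 /g /entry_or0.
  by rewrite insubT //= => ln; congr (G _ a b); exact: val_inj.
apply/eqP; rewrite -subr_eq0 -normr_le0.
have [K K0 KP] := moment_riemann mu l.+1.
pose M := \sum_s complex.Re `|c a b s|.
have nE (w : C) : `|w| = (complex.Re `|w|)%:C%C.
  by have /complex_realP[t ->] := ger0_real (normr_ge0 w).
have M0 : 0 <= M.
  by apply: sumr_ge0 => s _; have := normr_ge0 (c a b s); rewrite lecE => /andP[].
set d := _ - _; rewrite nE lecR; apply/ler_addgt0Pl => e e0; rewrite addr0.
(* The mesh is chosen so that the two errors, e' K and (l+1) e' M, add up to at most e. *)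
have KM : 0 < K + l.+1%:R * M + 1 by rewrite ltr_wpDl // addr_ge0 // mulr_ge0.
have [J [ix [rep me]]] := circle_cells (divr_gt0 e0 KM).
set e' := e / _ in me; have e'0 : 0 < e' by exact: divr_gt0.
rewrite -lecR -nE.
have := KP a b e' J ix rep me; set S := \sum_i _ => h1.
have SE : S = \sum_s pt (rep (ix (z s))) ^+ l.+1 * c a b s.
  rewrite /S; under eq_bigr do rewrite muE mulr_sumr.
  rewrite exchange_big /=; apply: eq_bigr => s _.
  rewrite (bigD1 (ix (z s))) //= big1 ?addr0 => [|j jz].
    by rewrite mem_set ?mulr1.
  by rewrite memNset ?mulr0 //= => /esym/eqP; apply/negP.
have h2 : `|\sum_s D 0 s ^+ l.+1 * c a b s - S| <= (l.+1%:R * e' * M)%:C%C.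
  rewrite SE -sumrB; apply: le_trans (ler_norm_sum _ _ _) _.
  rewrite /M mulr_sumr rmorph_sum; apply: ler_sum => s _.
  rewrite -mulrBl normrM [`|c a b s|]nE rmorphM /=.
  apply: ler_wpM2r; first by rewrite -nE; exact: normr_ge0.
  rewrite -zD; apply: le_trans (exp_pt_lipschitz _ _ _) _.
  by rewrite rmorphM rmorph_nat ler_wpM2l ?ler0n //; exact: me.2.
have -> : d = (\sum_s D 0 s ^+ l.+1 * c a b s - S) - (moment mu l.+1 a b - S).
  by rewrite /d opprB addrA subrK.
apply: le_trans (ler_normB _ _) _; apply: le_trans (lerD h2 h1) _.
rewrite -rmorphD lecR.
have -> : l.+1%:R * e' * M + e' * K = e' * (K + l.+1%:R * M) by ring.
by rewrite mulrAC ler_pdivrMr // ler_pM2l // lerDl.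
Qed.

End Atomic.

#[local] Existing Instance mseq_nbhs_pfilter.

(** * The interior of the moment space and the rate function *)

Section RateFunction.
Context {R : realType} {p : nat}.
Local Notation C := R[i].
Local Notation Re := complex.Re.

(** Block and inner index of a row of [\mxblock], which presents the Toeplitz matrix of the
    statement as one more listing of [tker]. *)
Definition bidx m (s : 'I_(\sum_(i < m.+1) p)) : nat * 'I_p :=
  (nat_of_ord (tagnat.sig1 (p_ := fun=> p) s), tagnat.sig2 (p_ := fun=> p) s).

Lemma enumerates_bidx m : enumerates (@bidx m) (fun l => (l < m.+1)%N).
Proof.
split=> [s t [/val_inj st st2]|[l a] /=].
  apply: ord_inj; rewrite [LHS](tagnat.rect (p_ := fun=> p) s) [RHS](tagnat.rect (p_ := fun=> p) t).
  by rewrite st; congr addn; rewrite st2.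
split=> [lm|[s [-> _]]]; last exact: ltn_ord.
exists (@tagnat.Rank m.+1 (fun=> p) (Ordinal lm) a); congr pair.
  by rewrite tagnat.Rank1K.
by apply: val_inj; rewrite /= tagnat.Rank2K.
Qed.

Lemma block_toeplitzE k (G : mseq R p k) m :
  block_toeplitz G m = kmx (tker (entry_or0 G)) (@bidx m).
Proof.
apply/matrixP => s t; rewrite !mxE /tker /bidx /=; congr (fun_of_matrix _ _ _).
set i := nat_of_ord _; set j := nat_of_ord _; rewrite /tcoef.
case: (ssrnat.ltngtP i j) => [ij|ji|->]; last by rewrite subrr.
  have [u uE] : exists u, (j - i)%N = u.+1 by exists (j - i.+1)%N; rewrite subnSK.
  have -> : i%:Z - j%:Z = Negz u by rewrite NegzE -uE -subzn 1?ltnW // opprB.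
  by rewrite uE.
have [u uE] : exists u, (i - j)%N = u.+1 by exists (i - j.+1)%N; rewrite subnSK.
have -> : i%:Z - j%:Z = Posz u.+1 by rewrite -uE -subzn 1?ltnW.
by rewrite uE.
Qed.

Lemma det_block_toeplitz k (G : mseq R p k) m :
  \det (block_toeplitz G m) = \det (toep (entry_or0 G) m.+1).
Proof.
rewrite block_toeplitzE /toep.
by have [-> _ _] := kmx_enumerates (tker (entry_or0 G)) (enumerates_bidx m) (enumerates_tidx m.+1).
Qed.

(** An interior point can be pushed out to (1+e) G, whose Toeplitz matrix is still nonnegative;
    shrinking back by 1/(1+e) mixes in the identity and makes it definite. *)
Lemma interior_moment_space k : (moment_space R p k)° = @PDset R p k.
Proof.
apply/seteqP; split=> [G|G pG]; last first.
  by apply: filterS (nbhs_PDset pG); exact: PD_moment_space.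
move=> /nbhs_mseqP[r r0 rM].
pose B : R := \sum_(x : 'I_k * 'I_p * 'I_p) Re `|G x.1.1 x.1.2 x.2|.
have nE (w : C) : `|w| = (Re `|w|)%:C%C.
  by have /complex_realP[t ->] := ger0_real (normr_ge0 w).
have n0 (w : C) : 0 <= Re `|w| by have := normr_ge0 w; rewrite lecE => /andP[].
have GB l a b : Re `|G l a b| <= B.
  by rewrite /B (bigD1 (l, a, b)) //= lerDl; apply: sumr_ge0 => x _; exact: n0.
have B0 : 0 <= B by apply: sumr_ge0 => x _; exact: n0.
(* [B] dominates every entry of G, so e |G_ab| < r and the dilated point stays in the
   neighbourhood. *)
pose e := r / (B + 1); have e0 : 0 < e by rewrite divr_gt0 // ltr_wpDl.
pose G' : mseq R p k := fun l => (1 + e)%:C%C *: G l.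
have /moment_space_PSD pG' : moment_space R p k G'.
  apply: rM => l a b.
  have -> : G' l a b - G l a b = e%:C%C * G l a b.
    by rewrite mxE rmorphD rmorph1 mulrDl mul1r addrC addKr.
  rewrite normrM norm_real (gtr0_norm e0) nE -rmorphM ltcR /e mulrAC ltr_pdivrMr ?ltr_wpDl //.
  by rewrite ltr_pM2l // (le_lt_trans (GB l a b)) // ltrDl.
have t01 : 0 < (1 + e)^-1 < 1 by rewrite invr_gt0 invf_lt1 ?addr_gt0 // ltrDl e0.
rewrite /PDset /= (@toep_ext _ _ _ (fun l => ((1 + e)^-1)%:C%C *: entry_or0 G' l)).
  exact: pd_toep_dilation t01 pG'.
move=> l ln; rewrite /entry_or0 insubT /= /G' scalerA -rmorphM mulVf ?scale1r //.
by rewrite gt_eqF // addr_gt0.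
Qed.

Lemma tdet0 (g : nat -> 'M[C]_p) : pd (toep g 1) -> tdet g 0 = 1.
Proof.
move=> /toep_schur[_ _ -> _].
suff -> : tschur g 0 0 0 = 0 by rewrite addr0 det1.
by apply/matrixP => i j; rewrite !mxE big_ord0 oppr0.
Qed.

(** Solving [g m] = D + A K B for K leaves the factor det(1 - K^* K) <= 1. *)
Lemma tdetS_le (g : nat -> 'M[C]_p) m : pd (toep g m.+2) -> tdet g m.+1 <= tdet g m.
Proof.
move=> pT; have pT1 := pd_toepS pT.
have [A [B [D [[tA A0] [tB B0] _ step]]]] := toep_step pT1.
have uA : A \in unitmx.
  rewrite unitmxE unitfE det_trig //; apply/prodf_neq0 => i _; exact: lt0r_neq0.
have uB : B \in unitmx.
  rewrite unitmxE unitfE -det_tr det_trig //; apply/prodf_neq0 => i _.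
  by rewrite mxE; exact: lt0r_neq0.
have [||pE tE] := step g (invmx A *m (g m - D) *m invmx B) => //.
  by rewrite !mulmxA mulmxV // mul1mx mulmxKV // addrC subrK.
have /contr_le1/andP[_ K1] := pE.1 pT.
rewrite (tE pT) ler_piMr //; exact/ltW/tdet_gt0.
Qed.

Lemma tdet_le (g : nat -> 'M[C]_p) m l : pd (toep g m.+1) -> (l <= m)%N -> tdet g m <= tdet g l.
Proof.
move=> pT /subnKC E; move: pT; rewrite -E; elim: (m - l)%N => [|n IHn]; first by rewrite addn0.
by rewrite addnS => pT; apply: le_trans (tdetS_le pT) (IHn (pd_toepS pT)).
Qed.

Lemma tdet_le1 (g : nat -> 'M[C]_p) m : pd (toep g m.+1) -> tdet g m <= 1.
Proof.
move=> pT; rewrite -(tdet0 (pd_toep_le (isT : (1 <= m.+1)%N) pT)).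
exact: tdet_le.
Qed.

Definition dratio k (G : mseq R p k) : R := Re (tdet (entry_or0 G) k).

Lemma dratio_gt0 k (G : mseq R p k) : PDset G -> 0 < dratio G.
Proof. by move=> /tdet_gt0/gtc0_Re[]. Qed.

Lemma dratio_le1 k (G : mseq R p k) : PDset G -> dratio G <= 1.
Proof. by move=> /tdet_le1; rewrite lecE => /andP[]. Qed.

Lemma dratioE k (G : mseq R p k) : PDset G ->
  dratio G = Re (\det (toep (entry_or0 G) k.+1)) / Re (\det (toep (entry_or0 G) k)) /\
  0 < Re (\det (toep (entry_or0 G) k)).
Proof.
move=> pG; have /gtc0_Re[d1E _] := pd_det_gt0 pG.
have /gtc0_Re[d0E d0] := pd_det_gt0 (pd_toepS pG); split=> //.
by rewrite /dratio /tdet {1}d1E {1}d0E -fmorphV -rmorphM.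
Qed.

(** For k > 0 the matrix [block_toeplitz G k.-1] has k block rows, so its determinant is that of
    [toep _ k], the denominator of [dratio]. *)
Lemma rate_GammaE k (G : mseq R p k) : (0 < k)%N ->
  rate_Gamma R p k G =
  if `[< PDset G >] then (- 2 * p%:R * ln (dratio G))%:E else +oo%E.
Proof.
case: k G => // k G _; rewrite /rate_Gamma interior_moment_space.
by rewrite !det_block_toeplitz.
Qed.

Lemma rate_ge0 k (G : mseq R p k) : (0 < k)%N -> (0 <= rate_Gamma R p k G)%E.
Proof.
move=> k0; rewrite rate_GammaE //; case: asboolP => // pG.
by rewrite lee_fin mulNr mulNr oppr_ge0 mulr_ge0_le0 ?mulr_ge0 // ln_le0 // dratio_le1.
Qed.

Lemma rate_le k (G : mseq R p k) (x : R) : (0 < k)%N -> (0 < p)%N ->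
  (rate_Gamma R p k G <= x%:E)%E <-> PDset G /\ expR (- x / (2 * p%:R)) <= dratio G.
Proof.
move=> k0 p0; rewrite rate_GammaE //; have p2 : 0 < 2 * p%:R :> R by rewrite mulr_gt0 ?ltr0n.
case: asboolP => [pG|npG]; last by split=> [|[]//]; rewrite leNgt ltry.
rewrite lee_fin -[dratio G in X in _ <-> _ /\ X]lnK ?posrE ?dratio_gt0 // ler_expR.
rewrite ler_pdivrMr // [ln _ * _]mulrC lerNl !mulNr.
by split=> [|[]].
Qed.

(* det T >= c^(k+1) holds on the level set, since all the ratios are at least c, and it excludes
   the singular limits. *)
Lemma closed_level k (c : R) : 0 < c ->
  closed [set G : mseq R p k | PDset G /\ c <= dratio G].
Proof.
move=> c0; have -> : [set G : mseq R p k | PDset G /\ c <= dratio G] =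
   @PSDset R p k `&` [set G | c ^+ k.+1 <= Re (\det (toep (entry_or0 G) k.+1))] `&`
   [set G | 0 <= Re (\det (toep (entry_or0 G) k.+1)) - c * Re (\det (toep (entry_or0 G) k))].
  apply/seteqP; split=> G.
    move=> [pG cG]; have [dE d0] := dratioE pG.
    split; [split|].
    - exact: pd_psd.
    - rewrite /=; have : forall m, (m <= k.+1)%N -> (c ^+ m)%:C%C <= \det (toep (entry_or0 G) m).
        elim=> [|m IHm] mk; first by rewrite expr0 det_mx00.
        have pm := pd_toep_le mk pG; have pm' := pd_toepS pm.
        have -> : \det (toep (entry_or0 G) m.+1) = tdet (entry_or0 G) m * \det (toep (entry_or0 G) m).
          by rewrite /tdet divfK // gt_eqF // pd_det_gt0.
        rewrite exprS rmorphM; apply: ler_pM; rewrite ?lecR ?exprn_ge0 ?(ltW c0) //.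
          apply: le_trans (tdet_le pG (mk : (m <= k)%N)).
          by have /gtc0_Re[-> _] := tdet_gt0 pG; rewrite lecR.
        by apply: IHm; exact: ltnW.
      by move=> /(_ k.+1 (leqnn _)); rewrite lecE => /andP[].
    - by rewrite /= subr_ge0 -ler_pdivlMr // -dE.
  move=> [[pG h1] h2] /=; have pd1 : pd (toep (entry_or0 G) k.+1).
    apply: psd_det_pd => //; apply/eqP => d0; move: h1; rewrite /= d0 /= leNgt.
    by rewrite exprn_gt0.
  split=> //; have [-> d0] := dratioE pd1.
  by rewrite ler_pdivlMr // -subr_ge0.
have cdet m : continuous (fun G : mseq R p k => Re (\det (toep (entry_or0 G) m))).
  by have [] := ccont_det (@ccont_toep R p k m).
apply: closedI; first apply: closedI; first exact: closed_PSDset.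
  apply: (@closed_comp _ _ (fun G : mseq R p k => Re (\det (toep (entry_or0 G) k.+1)))
    [set x | c ^+ k.+1 <= x]) => [G _|]; [exact: cdet|exact: closed_ge].
apply: (@closed_comp _ _ (fun G : mseq R p k => Re (\det (toep (entry_or0 G) k.+1)) -
   c * Re (\det (toep (entry_or0 G) k))) [set x | 0 <= x]) => [G _|]; last exact: closed_ge.
apply: cvgB; first exact: cdet.
by apply: cvgM; [exact: cvg_cst|exact: cdet].
Qed.

Lemma rate_lsc k : (0 < k)%N -> (0 < p)%N -> lower_semicontinuous (rate_Gamma R p k).
Proof.
move=> k0 p0 G a aG; exists [set G' | (a%:E < rate_Gamma R p k G')%E] => //.
apply: open_nbhs_nbhs; split=> //.
have -> : [set G' | (a%:E < rate_Gamma R p k G')%E] =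
   ~` [set G' : mseq R p k | PDset G' /\ expR (- a / (2 * p%:R)) <= dratio G'].
  apply/seteqP; split=> G' /=; first by rewrite ltNge => /negP h /(rate_le _ _ k0 p0).
  by rewrite ltNge => h; apply/negP => /(rate_le _ _ k0 p0).
by apply: closed_openC; apply: closed_level; exact: expR_gt0.
Qed.

Lemma qf_subZ n (A : 'M[C]_n) (u w : 'rV[C]_n) (z : C) :
  qf A (u - z *: w) = (u *m A *m u^t*) 0 0 - z^* * (u *m A *m w^t*) 0 0
    - z * (w *m A *m u^t*) 0 0 + z * z^* * (w *m A *m w^t*) 0 0.
Proof.
rewrite /qf adjD adjN adjZ mulmxBl mulmxDr mulmxN 2!mulmxBl -!scalemxAl -!scalemxAr.
move: (u *m A *m u^t*) (u *m A *m w^t*) (w *m A *m u^t*) (w *m A *m w^t*) => M1 M2 M3 M4.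
by rewrite !mxE; ring.
Qed.

(** The form at e_i - A_ij e_j equals 1 - |A_ij|^2. *)
Lemma psd_entry_le1 n (A : 'M[C]_n) i j : psd A -> A i i = 1 -> A j j = 1 -> `|A i j| <= 1.
Proof.
move=> [hA pA] Ai Aj; set z := A i j.
have zc : A j i = z^* by rewrite -hA !mxE.
have e u v : ((delta_mx 0 u : 'rV[C]_n) *m A *m (delta_mx 0 v : 'rV[C]_n)^t*) 0 0 = A u v.
  by rewrite trmx_delta map_delta_mx -rowE -colE !mxE.
have := pA (delta_mx 0 i - z *: delta_mx 0 j).
have -> : qf A (delta_mx 0 i - z *: delta_mx 0 j) = 1 - `|z| ^+ 2.
  by rewrite qf_subZ !e Ai Aj zc -/z normCK; ring.
by rewrite subr_ge0 expr_le1.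
Qed.

Lemma PSD_part_le1 k (G : mseq R p k) l a b c : PSDset G -> `|part c (G l a b)| <= 1.
Proof.
move=> pG; rewrite -lecR; apply: le_trans (normc_part c _) _.
have en := (enumerates_tidx (p := p) k.+1).2.
have [i iE] := (en (l.+1, a)).1 (ltn_ord l).
have [j jE] := (en (0%N, b)).1 isT.
have -> : G l a b = toep (entry_or0 G) k.+1 i j.
  rewrite mxE -iE -jE /tker /tcoef /= ?subn0 /entry_or0 insubT //= => ?.
  by congr (G _ a b); exact: val_inj.
by apply: psd_entry_le1 => //; rewrite mxE -?iE -?jE /tker /tcoef eqxx mxE eqxx.
Qed.

Lemma rate_good k : (0 < k)%N -> (0 < p)%N -> good_rate (rate_Gamma R p k).
Proof.
move=> k0 p0 x; apply: (subclosed_compact _ (@compact_box R p k)).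
  have -> : [set u | (rate_Gamma R p k u <= x%:E)%E] =
    [set G : mseq R p k | PDset G /\ expR (- x / (2 * p%:R)) <= dratio G].
    by apply/seteqP; split=> G /(rate_le _ _ k0 p0).
  by apply: closed_level; exact: expR_gt0.
move=> G /(rate_le _ _ k0 p0)[/pd_psd pG _] l a b c; exact: PSD_part_le1.
Qed.

Lemma nbhs_dratio k (G : mseq R p k) (a : R) : PDset G -> a < dratio G ->
  nbhs G [set G' | PDset G' /\ a <= dratio G'].
Proof.
move=> pG aG.
(* The inequality for the ratio with its denominator cleared, so that continuity of determinants
   suffices. *)
pose h (H : mseq R p k) := Re (\det (toep (entry_or0 H) k.+1)) - a * Re (\det (toep (entry_or0 H) k)).
have ch : continuous h.
  have cdet m : continuous (fun G : mseq R p k => Re (\det (toep (entry_or0 G) m))).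
    by have [] := ccont_det (@ccont_toep R p k m).
  move=> H; apply: cvgB; first exact: cdet.
  by apply: cvgM; [exact: cvg_cst|exact: cdet].
have hG : 0 < h G.
  by have [dG G0] := dratioE pG; rewrite /h subr_gt0 -ltr_pdivlMr // -dG.
have nh : nbhs G [set H | 0 < h H].
  have := @ch G [set x | 0 < x]; apply.
  apply/nbhs_ballP; exists (h G) => //= x; rewrite /ball /= ltr_distl => /andP[_].
  by rewrite -ltrBlDr subrr.
have FG : Filter (nbhs G) by exact: nbhs_filter.
have nn := @filterI _ (nbhs G) FG _ _ (nbhs_PDset pG) nh.
apply: (@filterS _ (nbhs G) FG _ _ _ nn) => H -[pH hH]; split; first exact: pH.
have [-> H0] := dratioE pH; rewrite ler_pdivlMr // -subr_ge0; exact: ltW hH.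
Qed.

End RateFunction.

(** * Exponential bounds for the unnormalised masses *)

Section Masses.
Context {R : realType} {p k : nat}.
Local Notation C := R[i].
Local Notation I := (nat * 'I_p * 'I_p * bool)%type.
Implicit Types A : set (mseq R p k).

Lemma weight_mseq_of e (x : I -> R) : weight k e (gam x) =
  if `[< PDset (mseq_of x : mseq R p k) >] then (dratio (mseq_of x : mseq R p k) ^+ e)%:E else 0%E.
Proof.
rewrite -[LHS](@weight_ext _ _ _ _ (entry_or0 (mseq_of x : mseq R p k))) //.
by move=> l lk; rewrite entry_mseq_of.
Qed.

Definition ncrds : nat := size (@crds p (iota 0 k)).

Lemma kmass_ge0 e A : (0 <= kmass e A)%E.
Proof. by apply: lint_ge0 => x; rewrite mule_ge0 ?weight_ge0 // lee_fin. Qed.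

(** Definite points have all real coordinates in [-1, 1], a cube of volume 2 to the power [ncrds],
    and on [A] the density is at most b^e. *)
Lemma kmass_le e A (b : R) : 0 <= b ->
  (forall G, A G -> PDset G -> dratio G <= b) ->
  (kmass e A <= (b ^+ e * 2 ^+ ncrds)%:E)%E.
Proof.
move=> b0 Ab; have be0 : 0 <= b ^+ e by rewrite exprn_ge0.
rewrite EFinM -(lint_box (fun=> 0) (fun=> 0)) ?uniq_crds ?iota_uniq // -lint_scale //.
apply: lint_le => y; first by rewrite mule_ge0 ?weight_ge0 // lee_fin.
move=> _; rewrite weight_mseq_of; case: asboolP => Ay; last first.
  by rewrite mul0e mule_ge0 ?lee_fin.
case: asboolP => pG; last by rewrite mule0 mule_ge0 ?lee_fin.
have -> : all (fun i => `|y i - 0| <= 1) (crds (iota 0 k)).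
  apply/allP => -[[[l a] c] d]; rewrite mem_crds mem_iota add0n => /andP[_ lk].
  have := PSD_part_le1 (Ordinal lk) a c d (pd_psd pG).
  by rewrite subr0 part_gam.
rewrite mul1e mule1 lee_fin; apply: lerXn2r; rewrite ?nnegrE //.
  exact/ltW/dratio_gt0.
exact: Ab.
Qed.

(** A cube around [G0] has a volume v that is the same for every exponent, and the density on it is
    at least a^e. *)
Lemma kmass_ge A (G0 : mseq R p k) (a : R) : 0 <= a ->
  nbhs G0 [set G | A G /\ (PDset G /\ a <= dratio G)] ->
  exists2 v : R, 0 < v & forall e, ((a ^+ e * v)%:E <= kmass e A)%E.
Proof.
(* Deviations of r/3 in the real and the imaginary part add up to less than r. *)
move=> a0 /nbhs_mseqP[r r0 rA]; pose r' := r / 3.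
have r'0 : 0 < r' by rewrite divr_gt0.
exists ((r' *+ 2) ^+ ncrds); first by rewrite exprn_gt0 // pmulrn_rgt0.
move=> e; have ae0 : 0 <= a ^+ e by rewrite exprn_ge0.
pose c (i : I) := part i.2 (entry_or0 G0 i.1.1.1 i.1.1.2 i.1.2).
rewrite EFinM -(lint_box c (fun=> 0)) ?uniq_crds ?iota_uniq // -lint_scale //.
apply: lint_le => y; first by rewrite mule_ge0 // lee_fin.
move=> _; case: allP => h; last by rewrite mule0 mule_ge0 ?weight_ge0 // lee_fin.
have [|Ay [pG aG]] := rA (mseq_of y).
  move=> l a' b'; apply: le_lt_trans (norm_part_le _) _; rewrite ltcR !partB.
  have close d : `|part d (mseq_of y l a' b') - part d (G0 l a' b')| <= r'.
    have := h (nat_of_ord l, a', b', d); rewrite mem_crds mem_iota add0n ltn_ord => /(_ isT).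
    rewrite /c /= part_gam /entry_or0 insubT //= => ?.
    by congr (`|_ - part d (G0 _ a' b')| <= _); exact: val_inj.
  apply: le_lt_trans (lerD (close false) (close true)) _; rewrite /r'; lra.
rewrite mule1 weight_mseq_of asboolT // mul1e asboolT // lee_fin.
by apply: lerXn2r; rewrite ?nnegrE //; exact/ltW/dratio_gt0.
Qed.

(** Zero matrices, the moments of the uniform measure on the circle, reach the upper bound 1 of
    [dratio]. Near them the normalising mass is at least c^e v, for any c < 1. *)
Lemma dratio_eq1 : exists2 Z : mseq R p k, PDset Z & dratio Z = 1.
Proof.
pose Z : mseq R p k := fun=> 0.
have e0 l : entry_or0 Z l = 0.
  by rewrite /entry_or0; case: insubP.
have T m : toep (entry_or0 Z) m = 1%:M.
  apply/matrixP => i j; rewrite !mxE /tker /tcoef.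
  have [it _] := @enumerates_tidx p m.
  rewrite -(inj_eq it) -pair_eqE /pair_eq; case: eqP => _ /=; first by rewrite mxE.
  by case: ifP => _; rewrite e0 ?adj0 mxE.
exists Z; first by rewrite /PDset /= T; exact: pd1.
by rewrite /dratio /tdet !T !det1 divr1.
Qed.

End Masses.

(** * Limits of scaled logarithms *)

Section Asymptotics.
Context {R : realType}.
Local Open Scope ereal_scope.

Lemma limn_esup_le_asymp (u : nat -> \bar R) (N : nat) (K l : R) :
  (forall n, (N <= n)%N -> (0 < n)%N -> u n <= (K / n%:R + l)%:E) -> limn_esup u <= l%:E.
Proof.
move=> uK; apply/lee_addgt0Pr => e e0.
(* From this rank on, |K| / n <= e. *)
pose M := maxn N (Num.truncn (`|K| / e)%R).+1.
apply: (@le_trans _ _ (ereal_sup (u @` [set n | (M <= n)%N]))).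
  by apply: ereal_inf_lbound; exists [set n | (M <= n)%N] => //; exists M.
apply: ge_ereal_sup => _ [n /= Mn <-].
have [Nn tn] : (N <= n)%N /\ (Num.truncn (`|K| / e)%R < n)%N.
  by move: Mn; rewrite geq_max => /andP[].
have n0 : (0 < n)%N by exact: leq_ltn_trans tn.
apply: le_trans (uK n Nn n0) _; rewrite -EFinD lee_fin addrC lerD2l.
have nR : (0 < n%:R :> R)%R by rewrite ltr0n.
rewrite ler_pdivrMr //; apply: le_trans (ler_norm _) _.
have Ke : (0 <= `|K| / e)%R by rewrite divr_ge0 // ltW.
move: tn; rewrite truncn_lt_nat // ltr_pdivrMr // mulrC => /ltW; by [].
Qed.

Lemma limn_einf_ge_asymp (u : nat -> \bar R) (N : nat) (K l : R) :
  (forall n, (N <= n)%N -> (0 < n)%N -> (K / n%:R + l)%:E <= u n) -> l%:E <= limn_einf u.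
Proof.
move=> uK; rewrite /limn_einf leeNr -EFinN.
apply: (@limn_esup_le_asymp _ N (- K)%R) => n Nn n0.
by rewrite leeNl -EFinN opprD opprK mulNr opprK; exact: uK.
Qed.

(** Since 2pm = 2pn - 2pk, the part in n gives the rate and the fixed shift joins the term of order
    1/n. *)
Lemma scaled_lne_le (n m p k : nat) (q : \bar R) (c r : R) : (0 < c)%R -> (0 < r)%R ->
  (0 < n)%N -> (n = k + m)%N -> 0 <= q -> q <= (c * r ^+ (2 * p * m))%:E ->
  (n%:R^-1)%:E * lne q <= ((ln c - (2 * p * k)%:R * ln r) / n%:R + (2 * p)%:R * ln r)%:E.
Proof.
move=> c0 r0 n0 nE q0 qc; have nR : (0 < n%:R :> R)%R by rewrite ltr0n.
have b0 : (0 < c * r ^+ (2 * p * m))%R by rewrite mulr_gt0 // exprn_gt0.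
apply: (@le_trans _ _ ((n%:R^-1)%:E * lne (c * r ^+ (2 * p * m))%:E)).
  by rewrite lee_pmul2l ?lte_fin ?invr_gt0 // lee_lne // in_itv /= ?q0 ?leey ?lee_fin ?ltW.
rewrite lne_EFin // -EFinM lee_fin lnM ?posrE ?exprn_gt0 // lnXn //.
rewrite le_eqVlt; apply/orP; left; apply/eqP.
have mE : ((2 * p * m)%:R = (2 * p)%:R * n%:R - (2 * p * k)%:R :> R)%R.
  by rewrite nE !natrM natrD; ring.
rewrite -(mulr_natl (ln r)) mE; field; by rewrite gt_eqF.
Qed.

Lemma scaled_lne_ge (n m p k : nat) (q : \bar R) (c r : R) : (0 < c)%R -> (0 < r)%R ->
  (0 < n)%N -> (n = k + m)%N -> (c * r ^+ (2 * p * m))%:E <= q ->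
  ((ln c - (2 * p * k)%:R * ln r) / n%:R + (2 * p)%:R * ln r)%:E <= (n%:R^-1)%:E * lne q.
Proof.
move=> c0 r0 n0 nE qc; have nR : (0 < n%:R :> R)%R by rewrite ltr0n.
have b0 : (0 < c * r ^+ (2 * p * m))%R by rewrite mulr_gt0 // exprn_gt0.
have q0 : 0 <= q by apply: le_trans qc; rewrite lee_fin ltW.
apply: (@le_trans _ _ ((n%:R^-1)%:E * lne (c * r ^+ (2 * p * m))%:E)); last first.
  by rewrite lee_pmul2l ?lte_fin ?invr_gt0 // lee_lne // in_itv /= ?q0 ?leey ?lee_fin ?ltW.
rewrite lne_EFin // -EFinM lee_fin lnM ?posrE ?exprn_gt0 // lnXn //.
rewrite le_eqVlt; apply/orP; left; apply/eqP.
have mE : ((2 * p * m)%:R = (2 * p)%:R * n%:R - (2 * p * k)%:R :> R)%R.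
  by rewrite nE !natrM natrD; ring.
rewrite -(mulr_natl (ln r)) mE; field; by rewrite gt_eqF.
Qed.

End Asymptotics.

(** * The law of the first k coordinates *)

Section Law.
Context {R : realType} {p : nat}.
Local Notation C := R[i].

Lemma lebesgue_mseq_ge0 n (A : set (mseq R p n)) : (0 <= lebesgue_mseq A)%E.
Proof. by rewrite (lebesgue_mseqE _ (fun=> 0)); apply: lint_ge0 => y; rewrite lee_fin. Qed.

Lemma le_lebesgue_mseq n (A B : set (mseq R p n)) : A `<=` B ->
  (lebesgue_mseq A <= lebesgue_mseq B)%E.
Proof.
move=> AB; rewrite !(lebesgue_mseqE _ (fun=> 0)); apply: lint_le => y; first by rewrite lee_fin.
move=> _; rewrite lee_fin ler_nat; case: asboolP => // Ay.
by rewrite asboolT //; exact: AB.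
Qed.

Lemma first_coords_continuous n k : continuous (first_coords k : mseq R p n -> mseq R p k).
Proof.
move=> G U /nbhs_mseqP[r r0 rU]; apply/nbhs_mseqP; exists r => // G' h.
apply: rU => l a b; rewrite /first_coords /entry_or0; case: insubP => [l' _ _|_] /=.
  exact: h.
by rewrite subrr normr0 ltcR.
Qed.

Lemma measurable_first_coords n k (A : set (mseq R p k)) : <<s open >> A ->
  measurable (first_coords k @^-1` A : set (borel (mseq R p n))).
Proof.
move=> mA; have mf : measurable_fun (setT : set (borel (mseq R p n)))
    (first_coords k : borel (mseq R p n) -> borel (mseq R p k)).
  apply: (@measurability _ _ (borel (mseq R p n)) (borel (mseq R p k)) setT _
    (@open (mseq R p k)) erefl).
  move=> _ [U oU <-]; rewrite setTI; apply: sub_sigma_algebra.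
  have /continuousP cf := @first_coords_continuous n k; exact: cf.
by have := mf measurableT A mA; rewrite setTI.
Qed.

(* G |-> t G with t < 1 maps the moment space into PDset, so the boundary has measure 0 as t -> 1. *)
Lemma lebesgue_PDset n (m : R) : lebesgue_mseq (moment_space R p n) = m%:E -> 0 < m ->
  lebesgue_mseq (@PDset R p n) = m%:E.
Proof.
move=> mE m0; apply/eqP; rewrite eq_le -{1}mE le_lebesgue_mseq /=; last exact: PD_moment_space.
have xf : lebesgue_mseq (@PDset R p n) \is a fin_num.
  rewrite ge0_fin_numE ?lebesgue_mseq_ge0 //; apply: le_lt_trans (ltry m).
  by rewrite -mE le_lebesgue_mseq //; exact: PD_moment_space.
have dil := lebesgue_dilation _ (@moment_space_PSD R p n).
rewrite mE -(fineK xf) in dil; rewrite -(fineK xf) lee_fin.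
set x := fine _ in dil *; rewrite leNgt; apply/negP => xm.
(* With this [e], (1 - e) m is the midpoint of x and m, and the [t] below satisfies t^N >= 1 - e,
   which contradicts x < m. Dividing by N + 1 also covers N = 0. *)
pose N := (n * p * p * 2)%N; pose e := (m - x) / (2 * m).
have e0 : 0 < e by rewrite divr_gt0 ?subr_gt0 // mulr_gt0.
pose t := expR (- (e / N.+1%:R)).
have t01 : 0 < t < 1.
  by rewrite expR_gt0 /= -expR0 ltr_expR oppr_lt0 divr_gt0.
have := dil t t01; rewrite -EFinM lee_fin -/N.
have tN : 1 - e <= t ^+ N.
  rewrite -expRM_natl; apply: le_trans (expR_ge1Dx _) _.
  rewrite ler_expR mulrN lerN2 mulrCA ler_piMr ?(ltW e0) //.
  by rewrite ler_pdivrMr // mul1r ler_nat.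
move=> h; have : (1 - e) * m <= x by apply: le_trans h; rewrite ler_pM2r.
have -> : (1 - e) * m = m - (m - x) / 2 by rewrite /e; field; rewrite gt_eqF.
lra.
Qed.

(** Both masses carry the same constant from integrating out the blocks k+1, ..., n; it cancels
    together with the volume of the moment space. *)
Lemma law_first_coords (d : measure_display) (Omega : measurableType d)
    (P : probability Omega R) n k (X : {RV P >-> borel (mseq R p n)}) j :
  (forall A : set (borel (mseq R p n)), measurable A ->
     distribution P X A = uniform_moment_space A) -> n = (k + j)%N ->
  forall A : set (mseq R p k), <<s open >> A ->
  (P [set w | A (first_coords k (X w : mseq R p n))] * kmass (2 * p * j) [set: mseq R p k] =
   kmass (2 * p * j) A)%E.
Proof.
move=> hX nE A mA; pose L := @lebesgue_mseq R p n; pose M := moment_space R p n.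
(* With a volume equal to 0 or infinity, the conventions of extended division would give the whole
   space mass 0 instead of 1. *)
have [m m0 mE] : exists2 m : R, 0 < m & L M = m%:E.
  have := hX setT measurableT; rewrite /uniform_moment_space setTI.
  rewrite (_ : distribution P X setT = 1%E); last exact: probability_setT.
  have := lebesgue_mseq_ge0 M; rewrite -/(L M); case: (L M) => [r| |] //.
    rewrite lee_fin le_eqVlt => /predU1P[<-|r0 _]; last by exists r.
    by rewrite mul0e => /eqP; rewrite onee_eq0.
  by rewrite invey mule0 => _ /eqP; rewrite onee_eq0.
have LPD := lebesgue_PDset mE m0.
have mPD : measurable (@PDset R p n : set (borel (mseq R p n))).
  by apply: sub_sigma_algebra; exact: open_PDset.
pose B : set (borel (mseq R p n)) := first_coords k @^-1` A.
have mB : measurable B by exact: measurable_first_coords.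
have PL (S : set (borel (mseq R p n))) : measurable S -> S `<=` @PDset R p n ->
    P (X @^-1` S) = (L S * m^-1%:E)%E.
  move=> mS SP; rewrite -[LHS]/(distribution P X S) hX // /uniform_moment_space.
  rewrite (setIidl (subset_trans SP (@PD_moment_space R p n))) -/(L S) -/M -/(L M) mE.
  by rewrite inver gt_eqF.
have PPD : P (X @^-1` @PDset R p n) = 1%E.
  by rewrite PL // /L LPD -EFinM divff // gt_eqF.
have mXB S : measurable S -> measurable (X @^-1` S).
  by move=> mS; rewrite -[X in measurable X]setTI; exact: measurable_funP.
(* The law gives no mass to the complement of {T_n > 0}, so the event can be cut down to the set
   where the density is known. *)
have PB : P (X @^-1` B) = P (X @^-1` (B `&` @PDset R p n)).
  rewrite (measureDI P (mXB _ mB) (mXB _ mPD)) [X in (X + _)%E](_ : _ = 0%E) ?add0e //.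
  apply: (subset_measure0 (B := ~` (X @^-1` @PDset R p n))).
  - exact: measurableD (mXB _ mB) (mXB _ mPD).
  - exact: measurableC (mXB _ mPD).
  - by move=> w [].
  by have := probability_setC P (mXB _ mPD); rewrite PPD subee.
rewrite -[P _]/(P (X @^-1` B)) PB PL; last 2 first.
- exact: measurableI.
- by move=> G [].
subst n; have [c c0 cE] := @lebesgue_first_coords R p k j.
have LB : L (B `&` @PDset R p (k + j)) = (c%:E * kmass (2 * p * j) A)%E.
  by rewrite -cE; congr lebesgue_mseq.
have LT : m%:E = (c%:E * kmass (2 * p * j) [set: mseq R p k])%E.
  by rewrite -cE -LPD; congr lebesgue_mseq; apply/seteqP; split=> // G [].
rewrite LB.
have c1 : 0 < c.
  by rewrite lt_def c0 andbT; apply/eqP => cz; move: LT; rewrite cz mul0e => -[mz]; rewrite mz ltxx in m0.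
have kle : (kmass (2 * p * j) A <= kmass (2 * p * j) [set: mseq R p k])%E.
  apply: lint_le => y; first by rewrite mule_ge0 ?weight_ge0 // lee_fin.
  have -> : `[< [set: mseq R p k] (mseq_of y) >] = true by apply/asboolP.
  move=> _; rewrite [X in (_ <= X)%E]mul1e.
  by case: asboolP => _; rewrite ?mul1e ?mul0e ?weight_ge0.
have kA0 := kmass_ge0 (2 * p * j) A.
case E : (kmass _ setT) kle LT => [v| |] kle LT.
- case: (kmass _ A) kle kA0 => [a|//|//] _ _; move: LT; rewrite -EFinM => -[vE].
  rewrite -!EFinM vE; congr EFin; field.
  have : m != 0 by rewrite gt_eqF.
  by rewrite vE mulf_eq0 negb_or => /andP[-> ->].
- by move: LT; rewrite gt0_muley ?lte_fin.
by have := kmass_ge0 (2 * p * j) [set: mseq R p k]; rewrite E.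
Qed.

End Law.

(** * Upper and lower large deviation bounds *)

Section LargeDeviations.
Context {R : realType} {p : nat}.
Context {d : nat -> measure_display} {Omega : forall n, measurableType (d n)}.
Context {P : forall n, probability (Omega n) R}.
Context {X : forall n, {RV (P n) >-> borel (mseq R p n)}}.
Hypothesis hX : forall n (A : set (borel (mseq R p n))), measurable A ->
  distribution (P n) (X n) A = uniform_moment_space A.
Context {k : nat}.

Definition law_k n (A : set (mseq R p k)) : \bar R :=
  P n [set w | A (first_coords k (X n w : mseq R p n))].

(** The mass of [A] is at most a constant times b^e and the normalisation at least c^e v, so the law
    is at most a constant times (b/c)^e. *)
Lemma law_upper (A : set (mseq R p k)) (b c : R) : <<s open >> A -> 0 < b -> 0 < c < 1 ->
  (forall G, A G -> PDset G -> dratio G <= b) ->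
  (limn_esup (scaled_log law_k A) <= ((2 * p)%:R * ln (b / c))%:E)%E.
Proof.
move=> mA b0 /andP[c0 c1] Ab; have bc0 : 0 < b / c by rewrite divr_gt0.
have [Z pZ dZ] := @dratio_eq1 R p k.
have cZ : c < dratio Z by rewrite dZ.
have [v v0 vP] : exists2 v : R, 0 < v & forall e, ((c ^+ e * v)%:E <= kmass e [set: mseq R p k])%E.
  apply: (kmass_ge (G0 := Z)); first exact: ltW.
  have FZ : Filter (nbhs Z) by exact: nbhs_filter.
  by apply: (@filterS _ (nbhs Z) FZ _ _ _ (nbhs_dratio pZ cZ)) => G [].
pose K := 2 ^+ @ncrds p k / v; have K0 : 0 < K by rewrite divr_gt0 // exprn_gt0.
apply: (@limn_esup_le_asymp _ _ k (ln K - (2 * p * k)%:R * ln (b / c))) => n kn n0.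
apply: (scaled_lne_le (m := (n - k)%N)); rewrite ?subnKC //.
set e := (2 * p * (n - k))%N.
have := law_first_coords (@hX n) (esym (subnKC kn)) mA; rewrite -/(law_k n A) -/e => lawE.
have q0 : (0 <= law_k n A)%E by exact: measure_ge0.
have := kmass_le e (ltW b0) Ab; rewrite -lawE => up.
have lo : (law_k n A * (c ^+ e * v)%:E <= law_k n A * kmass e [set: mseq R p k])%E.
  by apply: (lee_wpmul2l q0); exact: vP.
have ce0 : 0 < c ^+ e by rewrite exprn_gt0.
have := le_trans lo up; rewrite muleC -lee_pdivlMl ?mulr_gt0 // => h.
apply: le_trans h _; rewrite -EFinM lee_fin le_eqVlt; apply/orP; left; apply/eqP.
by rewrite /K expr_div_n; field; rewrite !gt_eqF.
Qed.

(** Near [G0] the mass is at least a constant times a^e, while the normalisation stays bounded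
    because [dratio] is at most 1. *)
Lemma law_lower (A : set (mseq R p k)) (G0 : mseq R p k) (a : R) : <<s open >> A ->
  A° G0 -> PDset G0 -> 0 < a < dratio G0 ->
  (((2 * p)%:R * ln a)%:E <= limn_einf (scaled_log law_k A))%E.
Proof.
move=> mA AG pG /andP[a0 aG].
have [v v0 vP] : exists2 v : R, 0 < v & forall e, ((a ^+ e * v)%:E <= kmass e A)%E.
  apply: (kmass_ge (G0 := G0)); first exact: ltW.
  have FZ : Filter (nbhs G0) by exact: nbhs_filter.
  have nn := @filterI _ (nbhs G0) FZ _ _ AG (nbhs_dratio pG aG).
  exact: nn.
pose K := v / 2 ^+ @ncrds p k; have K0 : 0 < K by rewrite divr_gt0 // exprn_gt0.
apply: (@limn_einf_ge_asymp _ _ k (ln K - (2 * p * k)%:R * ln a)) => n kn n0.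
apply: (scaled_lne_ge (m := (n - k)%N)); rewrite ?subnKC //.
set e := (2 * p * (n - k))%N.
have := law_first_coords (@hX n) (esym (subnKC kn)) mA; rewrite -/(law_k n A) -/e => lawE.
have q0 : (0 <= law_k n A)%E by exact: measure_ge0.
have N0 : 0 < 2 ^+ @ncrds p k :> R by rewrite exprn_gt0.
have up : (law_k n A * kmass e [set: mseq R p k] <= law_k n A * (2 ^+ @ncrds p k)%:E)%E.
  apply: (lee_wpmul2l q0).
  have := @kmass_le R p k e [set: mseq R p k] 1 ler01 (fun G _ pG => dratio_le1 pG).
  by rewrite expr1n mul1r.
have := vP e; rewrite -lawE => lo; have := le_trans lo up.
rewrite [X in (_ <= X)%E]muleC -lee_pdivrMl // => h.
apply: le_trans h; rewrite -EFinM lee_fin le_eqVlt; apply/orP; left; apply/eqP.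
by rewrite /K; field; rewrite gt_eqF.
Qed.

Lemma LDP_law : (0 < p)%N -> (0 < k)%N -> LDP law_k (rate_Gamma R p k).
Proof.
move=> p0 k0; have p2 : 0 < 2 * p%:R :> R by rewrite mulr_gt0 ?ltr0n.
have p2E : (2 * p)%:R = 2 * p%:R :> R by rewrite natrM.
split=> [u||A mA]; [exact: rate_ge0|exact: rate_lsc|].
split; last 1 first.
(* Stated for every finite x up to the infimum, so that letting x grow covers an infinite one. The
   choice of [b] and [c] makes 2p ln(b/c) = -x + e. *)
- have key (x e : R) : 0 < e -> (x%:E <= ereal_inf (rate_Gamma R p k @` closure A))%E ->
      (limn_esup (scaled_log law_k A) <= (- x + e)%:E)%E.
    move=> e0 xI; pose c := expR (- (e / (2 * p%:R))); pose b := expR (- x / (2 * p%:R)).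
    have c01 : 0 < c < 1 by rewrite expR_gt0 /= -expR0 ltr_expR oppr_lt0 divr_gt0.
    have Ab G : A G -> PDset G -> dratio G <= b.
      move=> AG pG; have IG : (x%:E <= rate_Gamma R p k G)%E.
        apply: le_trans xI _; apply: ereal_inf_lbound; exists G => //.
        exact: subset_closure.
      move: IG; rewrite rate_GammaE // asboolT // lee_fin => IG.
      rewrite -[dratio G]lnK ?posrE ?dratio_gt0 // ler_expR ler_pdivlMr // mulrC.
      by rewrite lerNr -mulNr -mulNr.
    have := law_upper mA (expR_gt0 _) c01 Ab; congr (_ <= _%:E)%E.
    rewrite /b /c -expRN -expRD expRK p2E; field; by rewrite gt_eqF ?ltr0n.
  set s := ereal_inf _ in key *; case: s key => [s| |] key.
  + rewrite -EFinN; apply/lee_addgt0Pr => e e0; rewrite -EFinD; exact: key.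
  + have h (r : R) : (limn_esup (scaled_log law_k A) <= r%:E)%E.
      have := key (1 - r) 1 ltr01 (leey _); by rewrite opprB subrK.
    case: (limn_esup _) h => [l| |] // h; last by have := h 0; rewrite leye_eq.
    by have := h (l - 1); rewrite lee_fin lerBrDr gerDl ler10.
  + by rewrite leey.
- rewrite leeNl; apply: le_ereal_inf_tmp => _ [G AG <-].
  rewrite rate_GammaE //; case: asboolP => pG; last by rewrite leey.
  rewrite leeNl; apply/lee_addgt0Pr => e e0.
  (* Just below [dratio G]: the bound 2p ln a falls short of minus the rate at [G] by exactly e. *)
  pose a := dratio G * expR (- (e / (2 * p%:R))).
  have a0 : 0 < a < dratio G.
    rewrite mulr_gt0 ?dratio_gt0 ?expR_gt0 //= gtr_pMr ?dratio_gt0 //.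
    by rewrite expR_lt1 oppr_lt0; exact: divr_gt0.
  have := law_lower mA AG pG a0; rewrite -(leeD2rE (x := e%:E)) //.
  apply: le_trans; rewrite -EFinN -EFinD lee_fin /a lnM ?posrE ?dratio_gt0 ?expR_gt0 //.
  rewrite expRK p2E le_eqVlt; apply/orP; left; apply/eqP; field.
  by rewrite gt_eqF ?ltr0n.
exact: limn_einf_sup.
Qed.

End LargeDeviations.

Theorem corollary3p9 (R : realType) (p : nat) (hp : (1 <= p)%N)
  (d : nat -> measure_display) (Omega : forall n, measurableType (d n))
  (P : forall n, probability (Omega n) R)
  (X : forall n, {RV (P n) >-> borel (mseq R p n)})
  (hX : forall n (A : set (borel (mseq R p n))), measurable A ->
     distribution (P n) (X n) A = uniform_moment_space A)
  (k : nat) (hk : (1 <= k)%N) :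
  LDP (fun n (A : set (mseq R p k)) => P n [set w | A (first_coords k (X n w : mseq R p n))])
      (rate_Gamma R p k)
  /\ good_rate (rate_Gamma R p k).
Proof.
split; last exact: rate_good.
exact: (LDP_law hX hp hk).
Qed.
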